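(* Let $r\ge 2$, $p\ge 2$ and $0\le i\le r-1$ be integers. Let $J_r(r+1,p(r+1);n)$ denote the $\mathfrak{sl}_r$ invariant of the torus link $T(r+1,p(r+1))$ with each of its $r+1$ components coloured by the partition $(n)$ (equivalently, by the irreducible $\mathfrak{sl}_r$-module of highest weight $n\Lambda_1$), and let $\overline{\chi}(W(p,\sqrt p\,i\Lambda_1)_{Q_r})$ denote the normalized character of the irreducible module $W(p,\sqrt p\,i\Lambda_1)_{Q_r}$ of the $\mathfrak{sl}_r$ version of the $(1,p)$ triplet vertex operator algebra (both are given explicitly in the context). Then $$\lim_{\substack{n\to\infty\\ n\equiv i\ (\mathrm{mod}\ r)}} q^{\frac p2\left(-\frac{n^2(r+1)^2}{r}+nr(r+1)\right)}J_r(r+1,p(r+1);n)=\frac{(q)_\infty^{r-1}}{\prod_{1\le j<k\le r}(1-q^{k-j})}\;\overline{\chi}(W(p,\sqrt p\,i\Lambda_1)_{Q_r}).$$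
   Context: Partitions. $\lambda\vdash m$ means that $\lambda=(\lambda_1\ge\lambda_2\ge\cdots)$ is a partition of $m$ and $\ell(\lambda)$ is its number of non-zero parts; $(n)^c$ is the partition $(n,\dots,n)$ with $c$ entries. The Kostka number $K_{\lambda,\mu}$ is the number of semistandard Young tableaux (rows weakly increasing, columns strictly increasing) of shape $\lambda$ in which $i$ occurs $\mu_i$ times for every $i\ge1$. Put $\kappa_\lambda=2\sum_{i=1}^{\ell(\lambda)}\sum_{j=1}^{\lambda_i}(j-i)$. Schur polynomials. For $\ell(\lambda)\le r$, $s_\lambda(x_1,\dots,x_r)$ is the Schur polynomial, and $$s_\lambda(q^{\frac{r-1}{2}},q^{\frac{r-3}{2}},\dots,q^{\frac{1-r}{2}})=\prod_{1\le i<j\le r}\frac{q^{\frac12(\lambda_i-\lambda_j+j-i)}-q^{-\frac12(\lambda_i-\lambda_j+j-i)}}{q^{\frac12(j-i)}-q^{-\frac12(j-i)}}.$$ Link invariant. The torus link $T(a,b)$ is the closure of the $a$-strand braid $(\sigma_1\cdots\sigma_{a-1})^b$; $T(c,pc)$ has $c$ components. $J_r(c,pc;n)$ is the (un-normalized) coloured HOMFLY invariant of $T(c,pc)$, all components coloured by $(n)$, specialized to $\mathfrak{sl}_r$ and with an overall monomial factor dropped. By the formula of Lin and Zheng it equals the following expression, which is to be taken as its definition (here with $c=r+1$): $$J_r(c,pc;n)=\sum_{\lambda\vdash nc,\ \ell(\lambda)\le r}K_{\lambda,(n)^c}\;q^{\frac p2\kappa_\lambda}\;s_\lambda(q^{\frac{r-1}{2}},q^{\frac{r-3}{2}},\dots,q^{\frac{1-r}{2}}).$$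 Lie algebra notation for $\mathfrak{sl}_r$. $Q_r$ is the root lattice, $P_r$ the weight lattice, $\Lambda_1,\dots,\Lambda_{r-1}$ the fundamental weights, $P_r^+$ the set of dominant integral weights, $\delta=\Lambda_1+\cdots+\Lambda_{r-1}$ the Weyl vector, and $(\cdot,\cdot)$ the invariant symmetric bilinear form with $(\Lambda_i,\Lambda_j)=\min(i,j)-\frac{ij}{r}$. The group $P_r/Q_r$ is cyclic of order $r$ with coset representatives $i\Lambda_1$, $0\le i\le r-1$. For $\mu\in P_r^+$, $L_r(\mu)$ is the irreducible $\mathfrak{sl}_r$-module of highest weight $\mu$. For $\mu=a_1\Lambda_1+\cdots+a_{r-1}\Lambda_{r-1}\in P_r^+$, $s_\mu(q^{\frac{r-1}{2}},\dots,q^{\frac{1-r}{2}})$ means $s_{\widehat\mu}(q^{\frac{r-1}{2}},\dots,q^{\frac{1-r}{2}})$ for any partition $\widehat\mu$ with $\ell(\widehat\mu)\le r$ and $\widehat\mu_j-\widehat\mu_{j+1}=a_j$ for $1\le j\le r-1$ (the value does not depend on the choice). Triplet characters. Let $(q)_\infty=\prod_{m\ge1}(1-q^m)$. For $\gamma\in\{i\Lambda_1: 0\le i\le r-1\}$, the $(1,p)$ triplet VOA $W(p)_{Q_r}=W(p,0)_{Q_r}$ based on $\mathfrak{sl}_r$ has an irreducible module $W(p,\sqrt p\,\gamma)_{Q_r}$, whose normalized character (the usual character divided by a power of $q$) is, by definition, $$\overline{\chi}(W(p,\sqrt p\,\gamma)_{Q_r})=\frac{\prod_{1\le j<k\le r}(1-q^{k-j})}{(q)_\infty^{r-1}}\sum_{\mu\in(Q_r+\gamma)\cap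 P_r^+}\dim(L_r(\mu))\;q^{\frac p2(\mu,\mu+2\delta)}\;s_\mu(q^{\frac{r-1}{2}},q^{\frac{r-3}{2}},\dots,q^{\frac{1-r}{2}}).$$ The limit is the coefficientwise limit of formal series in rational powers of $q$ (with bounded denominators; each coefficient is eventually constant along $n\equiv i \pmod r$); factors $1/(1-q^k)$ are expanded in non-negative powers of $q$. *)

(* Defs.v *)
From HB Require Import structures.
From mathcomp Require Import all_boot all_order all_algebra.
From mathcomp Require Import finmap.
From mathcomp Require Import boolp classical_sets functions cardinality fsbigop.
From mathcomp Require Import reals.
From mathcomp Require Import complex.

Set Implicit Arguments.
Unset Strict Implicit.
Unset Printing Implicit Defensive.

Import Order.TTheory GRing.Theory Num.Theory.
Local Open Scope classical_set_scope.
Local Open Scope ring_scope.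

(* Formal series in rational powers of q: [f e] is the coefficient of q^e.
   The series used below all have their exponents in (1/N)Z for some N > 0 and
   bounded below, so that the coefficients of a product are finite sums; a sum
   [\sum_(_ \in _)] with infinite support has the value 0 by convention.
   The product is [qmul], not the pointwise product of functions. *)
Definition qseries := rat -> int.

Definition qmon (a : rat) : qseries := fun e => (e == a)%:R.

Definition qone : qseries := qmon 0.

Definition qsub (f g : qseries) : qseries := fun e => f e - g e.

Definition qscale (c : int) (f : qseries) : qseries := fun e => c * f e.

Definition qmul (f g : qseries) : qseries :=
  fun e => \sum_(a \in [set: rat]) f a * g (e - a).

Definition qpow (f : qseries) (k : nat) : qseries := iter k (qmul f) qone.

(* The sum is taken coefficient by coefficient, so that the family may be
   infinite. *)
Definition qsum (I : choiceType) (A : set I) (F : I -> qseries) : qseries :=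
  fun e => \sum_(x \in A) F x e.

(* Geometric series \sum_k (1 - f)^k: the expansion of 1 / f when f is the sum
   of 1 and of terms with positive exponents. *)
Definition qinv (f : qseries) : qseries :=
  qsum [set: nat] (qpow (qsub qone f)).

(* The coefficientwise limit along the integers n such that P n. *)
Definition qcvg (P : nat -> Prop) (u : nat -> qseries) (l : qseries) : Prop :=
  forall e : rat, exists N : nat,
    forall n : nat, (N <= n)%N -> P n -> u n e = l e.

(* A coefficient that is not eventually constant is given the value 0. *)
Definition qlim (u : nat -> qseries) : qseries :=
  fun e => xget 0 [set c : int |
    exists N : nat, forall n : nat, (N <= n)%N -> u n e = c].

(* (q)_oo = \prod_(m >= 1) (1 - q^m) *)
Definition qpoch : qseries :=
  qlim (fun M => \big[qmul/qone]_(1 <= m < M) qsub qone (qmon m%:R)).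

(* \prod_(1 <= j < k <= r) (1 - q^(k - j)) *)
Definition qvandermonde (r : nat) : qseries :=
  \big[qmul/qone]_(1 <= k < r.+1) \big[qmul/qone]_(1 <= j < k)
    qsub qone (qmon (k - j)%N%:R).

(* Partitions have no zero parts, so that the length is [size la]. *)
Definition is_partition (m : nat) (la : seq nat) : Prop :=
  [/\ sorted geq la, 0%N \notin la & sumn la = m].

Definition kappa (la : seq nat) : int :=
  2 * \sum_(i < size la) \sum_(j < nth 0%N la i) (j%:Z - i%:Z).

(* A tableau is the sequence of its rows, from top to bottom. *)
Definition is_ssyt (la : seq nat) (T : seq (seq nat)) : Prop :=
  [/\ shape T = la,
      0%N \notin flatten T,
      all (sorted leq) T
    & forall i j : nat, (j < size (nth [::] T i.+1))%N ->
        (nth 0 (nth [::] T i) j < nth 0 (nth [::] T i.+1) j)%N].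

Definition kostka (la mu : seq nat) : nat :=
  #|` fset_set [set T : seq (seq nat) |
        is_ssyt la T /\
        forall k : nat, count_mem k.+1 (flatten T) = nth 0%N mu k] |.

(* s_la(x_1, ..., x_r), with r = size x and x_k = nth _ x k.-1, as the sum of
   the monomials of the semistandard tableaux with entries in {1, ..., r}. *)
Definition schur (la : seq nat) (x : seq qseries) : qseries :=
  qsum [set T : seq (seq nat) |
          is_ssyt la T /\ all (fun k => k <= size x)%N (flatten T)]
    (fun T => \big[qmul/qone]_(k <- flatten T) nth qone x k.-1).

(* (q^((r-1)/2), q^((r-3)/2), ..., q^((1-r)/2)) *)
Definition principal (r : nat) : seq qseries :=
  mkseq (fun k => qmon ((r%:R - 1 - 2 * k%:R) / 2)) r.

(* The sl_r invariant of the torus link T(c, pc) with its c components coloured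
   by (n), given by the formula of Lin and Zheng. *)
Definition J (r c p n : nat) : qseries :=
  qsum [set la : seq nat | is_partition (n * c)%N la /\ (size la <= r)%N]
    (fun la => qscale (kostka la (nseq c n))%:Z
       (qmul (qmon (p%:R / 2 * (kappa la)%:~R)) (schur la (principal r)))).

(* Weights are given by their coordinates in the basis of the fundamental
   weights; the index j : 'I_r.-1 stands for Lambda_(j+1). *)
Definition weight (r : nat) := 'rV[int]_(r.-1).

Definition dominant (r : nat) (mu : weight r) : Prop := forall j, 0 <= mu 0 j.

Definition Lambda1 (r : nat) : weight r := \row_j (j == 0 :> nat)%:R.

Definition weyl_vector (r : nat) : weight r := const_mx 1.

Definition cartan (r : nat) : 'M[int]_(r.-1) :=
  \matrix_(i, j) (if i == j then 2
                  else if (i.+1 == j :> nat) || (j.+1 == i :> nat) then -1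
                  else 0).

(* The rows of the Cartan matrix are the simple roots. *)
Definition root_lattice (r : nat) : set (weight r) :=
  [set mu | exists c : 'rV[int]_(r.-1), mu = c *m cartan r].

Definition wform (r : nat) (mu nu : weight r) : rat :=
  \sum_(i < r.-1) \sum_(j < r.-1) (mu 0 i)%:~R * (nu 0 j)%:~R *
    ((minn i.+1 j.+1)%:R - (i.+1 * j.+1)%N%:R / r%:R).

(* For dominant mu = \sum_j a_j Lambda_j, the partition with parts
   a_j + ... + a_(r-1), and with r-th part equal to 0. *)
Definition weight_partition (r : nat) (mu : weight r) : seq nat :=
  [seq x <- mkseq (fun j => (\sum_(k < r.-1 | j <= k) `|mu 0%R k|)%N) r.-1
     | (0 < x)%N].

(* sl_r is the space of traceless matrices: the values of [rho] on the other
   matrices are irrelevant. *)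
Definition is_sl_module (K : fieldType) (r : nat) (V : vectType K)
    (rho : 'M[K]_r -> 'End(V)) : Prop :=
  (forall (a : K) (A B : 'M[K]_r), \tr A = 0 -> \tr B = 0 ->
     rho (a *: A + B) = a *: rho A + rho B) /\
  (forall A B : 'M[K]_r, \tr A = 0 -> \tr B = 0 ->
     rho (A *m B - B *m A) = (rho A \o rho B)%VF - (rho B \o rho A)%VF).

Definition is_irreducible (K : fieldType) (r : nat) (V : vectType K)
    (rho : 'M[K]_r -> 'End(V)) : Prop :=
  (fullv : {vspace V}) <> 0%VS /\
  forall U : {vspace V},
    (forall A : 'M[K]_r, \tr A = 0 -> (rho A @: U <= U)%VS) ->
    U = 0%VS \/ U = fullv.

Definition has_highest_weight (K : fieldType) (r : nat) (V : vectType K)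
    (rho : 'M[K]_r -> 'End(V)) (mu : weight r) : Prop :=
  exists v : V, [/\ v != 0,
    (forall a b : 'I_r, (a < b)%N -> rho (delta_mx a b) v = 0)
  & (forall (a b : 'I_r) (j : 'I_r.-1), a = j :> nat -> b = j.+1 :> nat ->
       rho (delta_mx a a - delta_mx b b) v = (mu 0 j)%:~R *: v)].

(* dim L_r(mu): for dominant mu, a module as below exists and is unique up to
   isomorphism, so that the set has exactly one element. *)
Definition dim_irr (R : realType) (r : nat) (mu : weight r) : nat :=
  xget 0%N [set d : nat |
    exists (V : vectType R[i]) (rho : 'M[R[i]]_r -> 'End(V)),
      [/\ is_sl_module rho, is_irreducible rho, has_highest_weight rho mu
        & \dim (fullv : {vspace V}) = d]].

(* The normalized character of W(p, sqrt p gamma)_(Q_r). *)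
Definition triplet_char (R : realType) (r p : nat) (gamma : weight r) :
    qseries :=
  qmul (qmul (qvandermonde r) (qinv (qpow qpoch r.-1)))
    (qsum [set mu : weight r | root_lattice (mu - gamma) /\ dominant mu]
       (fun mu => qscale (dim_irr R mu)%:Z
          (qmul (qmon (p%:R / 2 * wform mu (mu + weyl_vector r *+ 2)))
             (schur (weight_partition mu) (principal r))))).

(* Main.v *)
(* The prefactors on the right cancel, so both sides are sums of shifted Schur
   polynomials.  A partition la of n(r+1) with at most r parts is the partition
   of a dominant weight mu in Q_r + n Lambda_1 to which full columns have been
   added; the Schur polynomial does not see these columns, and the exponents
   agree since (mu, mu + 2 delta) = kappa_la - n^2 (r+1)^2 / r + n r (r+1).

   When n is large with respect to mu, the Kostka number becomes dim L_r(mu): in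
   a Gelfand-Tsetlin pattern for la with r + 1 letters, each of them used n
   times, the diagonal entries are forced by the content and satisfy all the
   inequalities, and removing them leaves an arbitrary pattern with r letters.
   As (mu, mu + 2 delta) grows quadratically while the Schur polynomial lowers
   the exponents only linearly, each coefficient involves finitely many mu.

   That dim L_r(mu) is the number of semistandard tableaux is proved as follows.
   Let gl_r act on the left and on the right on the polynomials in the entries
   of an r x r matrix, and let I be the space of the right highest weight
   vectors of weight la.  By sl_2 theory the leading monomial of an element of
   I encodes a semistandard tableau, and products of minors realize all the
   tableaux: hence the dimension of I.  Leading monomials also show that
   I has a unique left highest weight vector f up to a scalar.  For the apolar
   form, x_u is adjoint to d/dx_u, so that the orthogonal of a submodule is a
   submodule, and (f, f) > 0: hence I is irreducible.  Finally, if v and v' are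
   highest weight vectors of the same weight of irreducible V and V', the
   submodule of V * V' generated by (v, v') is the graph of an isomorphism. *)

(* Most of the work concerns [dim_irr]: it refers to abstract modules, so a model is built and then
   compared with any other module. In the leading monomial of an element of I, the exponent of x_(a,
   j), with indices from 0, is the number of letters a + 1 in row j of a tableau. The order of the
   variables serves three purposes: the leading term of a minor with increasing rows is its
   diagonal; left raising operators lower monomials, so that raising stops at a highest weight
   vector; the rows from a on can be frozen while sl_2 acts on the earlier ones. As the bound on
   leading monomials and the products of minors meet, a basis of I is obtained without any
   straightening law. The forced diagonal entries fit because, for n >= (r + 1) w, the shape has c0
   >= n + w full columns, w being the number of remaining boxes: each diagonal entry exceeds the
   next one by at least c0 - n - w. Series are multiplied by convolutions in which infinite sums
   have the value 0, so associativity and cancellation are proved under conditions on the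
   supports. *)
From HB Require Import structures.
From mathcomp Require Import all_boot all_order all_algebra.
From mathcomp Require Import finmap perm.
From mathcomp Require Import boolp classical_sets functions cardinality fsbigop.
From mathcomp Require Import reals complex.
From mathcomp Require Import ring lra zify.
From mathcomp Require Import mpoly.
Require Import Defs.

Set Implicit Arguments.
Unset Strict Implicit.
Unset Printing Implicit Defensive.

Import Order.TTheory GRing.Theory Num.Theory.
Local Open Scope ring_scope.

(** * Representations of sl_2 *)

Section Sl2.
Variables (K : numFieldType) (V : lmodType K) (E F : V -> V)
  (wt : int -> int -> V -> Prop).
Hypothesis EZ : forall a v, E (a *: v) = a *: E v.
Hypothesis ED : forall u v, E (u + v) = E u + E v.
Hypothesis FZ : forall a v, F (a *: v) = a *: F v.
Hypothesis wtE : forall A B v, wt A B v -> wt (A + 1) (B - 1) (E v).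
Hypothesis wtF : forall A B v, wt A B v -> wt (A - 1) (B + 1) (F v).
Hypothesis wt_lt0 : forall A B v, A < 0 -> wt A B v -> v = 0.
Hypothesis EF : forall A B v, wt A B v -> E (F v) = F (E v) + (A - B)%:~R *: v.

(** [E] raises A - B by 2, so moving [F] through i + 1 copies of [E] collects the sum of the A - B +
    2 k for k <= i, which is (i + 1)(A - B + i). *)
Lemma sl2_iterEF i A B v : wt A B v ->
  iter i.+1 E (F v) =
  F (iter i.+1 E v) + ((i.+1)%:~R * (A - B + i%:Z)%:~R) *: iter i E v.
Proof.
elim: i A B v => [|i IH] A B v wv.
  by rewrite /= (EF wv) mul1r addr0.
rewrite iterSr (EF wv).
have EiD k u w : iter k E (u + w) = iter k E u + iter k E w.
  by elim: k => //= k ->; rewrite ED.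
have EiZ k a w : iter k E (a *: w) = a *: iter k E w.
  by elim: k => //= k ->; rewrite EZ.
rewrite EiD EiZ (IH _ _ _ (wtE wv)) -!iterSr -addrA -scalerDl; congr (_ + _ *: _).
rewrite -!intrM -intrD; congr (_%:~R); lia.
Qed.

(* The raising operator is injective on the weight spaces of negative weight
   as long as its power does not exceed the absolute value of the weight. *)
Lemma sl2_raise_inj i A B v : wt A B v -> A + i%:Z <= B -> iter i E v = 0 -> v = 0.
Proof.
have E0 : E 0 = 0 by rewrite -[X in E X](scale0r 0) EZ scale0r.
have F0 : F 0 = 0 by rewrite -[X in F X](scale0r 0) FZ scale0r.
(* Outer induction on a bound of A, started by [wt_lt0], which replaces finite dimension; inner
   induction on i. *)
have [k] : exists k : nat, A <= k%:Z - 1.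
  by exists (`|A| + 1)%N; lia.
elim: k A B i v => [|k IHk] A B i v hA wv.
  by move=> _ _; apply: (wt_lt0 _ wv); lia.
elim: i => [//|i IHi] hAB Ev.
(* [F v] has weight (A - 1, B + 1) and is killed by the power i + 2 of [E], by the commutation
   formula. Once [F v] is 0, the same formula leaves (i + 1)(A - B + i) E^i v = 0, with a non-zero
   factor since A + i < B. *)
have Fv : F v = 0.
  apply: (IHk (A - 1) (B + 1) i.+2 (F v)); [by clear -hA; lia|exact: wtF|by clear -hAB; lia|].
  by rewrite (sl2_iterEF i.+1 wv) iterS Ev E0 F0 scaler0 addr0.
apply: IHi; first lia.
have := sl2_iterEF i wv; rewrite Fv Ev F0 add0r.
have -> : iter i.+1 E 0 = 0 by elim: (i.+1) => //= m ->.
move/esym/eqP; rewrite scaler_eq0 => /orP[|/eqP //].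
by rewrite mulf_eq0 !intr_eq0 => /orP[|]; clear -hAB; lia.
Qed.
End Sl2.

(** * Ordering of the matrix entries *)

Section Index.
Variable r : nat.

Fact idx_subproof (a j : 'I_r) : ((rev_ord a) * r + rev_ord j < r * r)%N.
Proof.
apply: (@leq_trans ((rev_ord a).+1 * r)); first by rewrite mulSnr ltn_add2l.
by rewrite leq_mul2r ltn_ord orbT.
Qed.

(* The variables x_(a, j) are ordered so that x_(r, r) comes first and the
   rows follow each other, from the last to the first one, each of them being
   read from right to left. *)
Definition idx (a j : 'I_r) : 'I_(r * r) := Ordinal (idx_subproof a j).

Lemma ltn_idx a j b c :
  (idx b c < idx a j)%N = ((a < b) || ((a == b) && (j < c)))%N.
Proof.
rewrite -(inj_eq val_inj) /=; have := ltn_ord a; have := ltn_ord b.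
have := ltn_ord c; have := ltn_ord j.
move: (nat_of_ord a) (nat_of_ord b) (nat_of_ord c) (nat_of_ord j) => {}a {}b {}c {}j.
move=> hj hc hb ha; case: (ltngtP a b) => [lab|lba|<-] /=; last by lia.
  have -> : (r - a.+1 = r - b.+1 + (b - a))%N by lia.
  have : (r <= (b - a) * r)%N by rewrite leq_pmull // subn_gt0.
  by rewrite mulnDl; lia.
have -> : (r - b.+1 = r - a.+1 + (a - b))%N by lia.
have : (r <= (a - b) * r)%N by rewrite leq_pmull // subn_gt0.
by rewrite mulnDl; lia.
Qed.

Lemma idx_eq a j b c : (idx a j == idx b c) = (a == b) && (j == c).
Proof.
apply/eqP/andP => [e|[/eqP -> /eqP ->] //].
have := ltn_idx a j b c; have := ltn_idx b c a j; rewrite e ltnn.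
rewrite -!(inj_eq val_inj) /=; lia.
Qed.

Lemma idx_bij : bijective (fun x : 'I_r * 'I_r => idx x.1 x.2).
Proof.
apply: inj_card_bij; last by rewrite card_prod !card_ord.
by move=> [a j] [b c] /= /eqP; rewrite idx_eq => /andP[/eqP -> /eqP ->].
Qed.

Lemma sum_idx (m : 'I_(r * r) -> nat) :
  (\sum_i m i = \sum_(j < r) \sum_(a < r) m (idx a j))%N.
Proof.
rewrite exchange_big pair_big /=; apply: reindex.
by apply: onW_bij; exact: idx_bij.
Qed.
End Index.

(** * Action of gl_r on the polynomials in the entries of a matrix *)

Section Polarization.
Variables (K : comNzRingType) (n : nat).
Implicit Types (u v : 'I_n) (p q : {mpoly K[n]}) (m : 'X_{1..n}).

Definition pol u v p : {mpoly K[n]} := 'X_u * p^`M(v).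

Lemma polD u v p q : pol u v (p + q) = pol u v p + pol u v q.
Proof. by rewrite /pol mderivD mulrDr. Qed.

Lemma polZ u v c p : pol u v (c *: p) = c *: pol u v p.
Proof. by rewrite /pol mderivZ scalerAr. Qed.

Lemma pol_sum u v I (s : seq I) (P : pred I) (f : I -> {mpoly K[n]}) :
  pol u v (\sum_(i <- s | P i) f i) = \sum_(i <- s | P i) pol u v (f i).
Proof.
by apply: (big_morph (pol u v) (@polD u v)); rewrite /pol mderiv0 mulr0.
Qed.

Lemma polM u v p q : pol u v (p * q) = pol u v p * q + p * pol u v q.
Proof. by rewrite /pol mderivM; ring. Qed.

Lemma polX u v w : pol u v 'X_w = (v == w)%:R *: 'X_u.
Proof.
rewrite /pol mderivX mnm1E eq_sym; case: eqP => [->|_]; last by rewrite !scale0r mulr0.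
by rewrite !scale1r (_ : (U_(w) - U_(w))%MM = 0%MM) ?mpolyX0 ?mulr1 //; apply/mnmP => i;
  rewrite mnmBE subnn mnm0E.
Qed.

Lemma pol_comp u v u' v' p : pol u v (pol u' v' p) =
  (v == u')%:R *: pol u v' p + 'X_u * 'X_u' * p^`M(v')^`M(v).
Proof.
rewrite {2}/pol polM polX -!scalerAl; congr (_ + _).
by rewrite /pol; ring.
Qed.

Lemma pol_comm u v u' v' p :
  pol u v (pol u' v' p) =
  pol u' v' (pol u v p) + (v == u')%:R *: pol u v' p - (v' == u)%:R *: pol u' v p.
Proof.
rewrite !pol_comp [_ * 'X_u]mulrC [p^`M(v)^`M(v')]mderiv_comm.
by rewrite [RHS]addrC; ring.
Qed.

Lemma pol_commute u v u' v' p : v != u' -> v' != u ->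
  pol u v (pol u' v' p) = pol u' v' (pol u v p).
Proof. by move=> /negbTE h /negbTE h'; rewrite pol_comm h h' !scale0r subr0 addr0. Qed.

Lemma coef_pol u v p m :
  (pol u v p)@_(m + U_(u)) = p@_(m + U_(v)) *+ (m v).+1.
Proof. by rewrite /pol mulrC addmC mcoeffMX mcoeff_deriv. Qed.

Lemma coef_pol0 u v p m : m u = 0%N -> (pol u v p)@_m = 0.
Proof.
move=> mu0; rewrite /pol mulrC mcoeffM big1 // => -[k1 k2] /= /eqP mE.
rewrite [X in _ * X]mcoeffX; case: eqP => [ukE|]; last by rewrite mulr0.
by move: (congr1 (fun k : 'X_{1..n} => k u) mE); rewrite /= mu0 -ukE mnmDE mnm1E eqxx addn1.
Qed.

Lemma mnm_subU m u : (0 < m u)%N -> m = ((m - U_(u)) + U_(u))%MM.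
Proof.
move=> mu; apply/mnmP => i; rewrite mnmDE mnmBE mnm1E.
by case: eqP => [<-|_]; rewrite ?subn0 ?addn0 // subnK.
Qed.

Lemma coef_pol_diag u p m : (pol u u p)@_m = p@_m *+ m u.
Proof.
have [mu0|mu] := posnP (m u); first by rewrite (coef_pol0 _ _ mu0) mu0.
by rewrite {1}(mnm_subU mu) coef_pol -(mnm_subU mu) mnmBE mnm1E eqxx subn1 prednK.
Qed.
End Polarization.

Section RowsAndColumns.
Variables (K : comNzRingType) (r : nat).
Implicit Types (a b c d i j k l : 'I_r) (P : pred 'I_r).
Local Notation poly := {mpoly K[(r * r)%N]}.
Implicit Types (p q : poly) (m : 'X_{1..(r * r)%N}).

(* E_(a, b) of gl_r acts on the rows of the matrix (x_(a, j)) by drow a b, and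
   on its columns by dcol predT. *)
Definition drow a b p : poly := \sum_(j < r) pol (idx a j) (idx b j) p.

Definition dcol P i j p : poly := \sum_(a < r | P a) pol (idx a i) (idx a j) p.

Lemma drowD a b p q : drow a b (p + q) = drow a b p + drow a b q.
Proof. by rewrite /drow -big_split; apply: eq_bigr => j _; rewrite polD. Qed.

Lemma drowZ a b (x : K) p : drow a b (x *: p) = x *: drow a b p.
Proof. by rewrite /drow scaler_sumr; apply: eq_bigr => j _; rewrite polZ. Qed.

Lemma drow_sum a b I (s : seq I) (P : pred I) (f : I -> poly) :
  drow a b (\sum_(i <- s | P i) f i) = \sum_(i <- s | P i) drow a b (f i).
Proof.
apply: (big_morph (drow a b) (@drowD a b)).
by have := drowZ a b 0 0; rewrite !scale0r.
Qed.

Lemma dcolD P i j p q : dcol P i j (p + q) = dcol P i j p + dcol P i j q.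
Proof. by rewrite /dcol -big_split; apply: eq_bigr => a _; rewrite polD. Qed.

Lemma dcolZ P i j (x : K) p : dcol P i j (x *: p) = x *: dcol P i j p.
Proof. by rewrite /dcol scaler_sumr; apply: eq_bigr => a _; rewrite polZ. Qed.

Lemma dcol_sum Q k l I (s : seq I) (P : pred I) (f : I -> poly) :
  dcol Q k l (\sum_(i <- s | P i) f i) = \sum_(i <- s | P i) dcol Q k l (f i).
Proof.
apply: (big_morph (dcol Q k l) (@dcolD Q k l)).
by have := dcolZ Q k l 0 0; rewrite !scale0r.
Qed.

Lemma dcol0 P i j : dcol P i j 0 = 0.
Proof. by have := dcolZ P i j 0 0; rewrite !scale0r. Qed.

Lemma drowM a b p q : drow a b (p * q) = drow a b p * q + p * drow a b q.
Proof.
by rewrite /drow mulr_suml mulr_sumr -big_split; apply: eq_bigr => j _; rewrite polM.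
Qed.

Lemma dcolM P i j p q : dcol P i j (p * q) = dcol P i j p * q + p * dcol P i j q.
Proof.
by rewrite /dcol mulr_suml mulr_sumr -big_split; apply: eq_bigr => a _; rewrite polM.
Qed.

Lemma drowX a b c j : drow a b 'X_(idx c j) = (b == c)%:R *: 'X_(idx a j).
Proof.
rewrite /drow (bigD1 j) //= polX idx_eq eqxx andbT big1 ?addr0 // => k kj.
by rewrite polX idx_eq (negbTE kj) andbF scale0r.
Qed.

Lemma dcolX i j c k : dcol predT i j 'X_(idx c k) = (j == k)%:R *: 'X_(idx c i).
Proof.
rewrite /dcol (bigD1 c) //= polX idx_eq eqxx big1 ?addr0 // => a ac.
by rewrite polX idx_eq (negbTE ac) scale0r.
Qed.

Lemma drow_comm a b c d p : drow a b (drow c d p) =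
  drow c d (drow a b p) + (b == c)%:R *: drow a d p - (d == a)%:R *: drow c b p.
Proof.
rewrite [drow c d p]/drow [drow a b p]/drow !drow_sum /drow exchange_big /=.
rewrite !scaler_sumr -!sumrN -!big_split /=.
rewrite [RHS](eq_bigr (fun j => \sum_k
  (pol (idx c k) (idx d k) (pol (idx a j) (idx b j) p) +
  (if k == j then (b == c)%:R *: pol (idx a j) (idx d j) p else 0)
  - (if k == j then (d == a)%:R *: pol (idx c j) (idx b j) p else 0)))); last first.
  move=> j _; rewrite !big_split /= sumrN -!big_mkcond /= !big_pred1_eq //.
apply: eq_bigr => j _; apply: eq_bigr => k _.
rewrite pol_comm !idx_eq; case: (eqVneq k j) => [->|kj].
  by rewrite !andbT.
by rewrite !andbF !scale0r.
Qed.

(** Restricting to the rows of [P] still gives an action of gl_r; this is what lets sl_2 theory be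
    applied to the rows before a given one. *)
Lemma dcol_comm P i j k l p : dcol P i j (dcol P k l p) =
  dcol P k l (dcol P i j p) + (j == k)%:R *: dcol P i l p - (l == i)%:R *: dcol P k j p.
Proof.
rewrite [dcol P k l p]/dcol [dcol P i j p]/dcol !dcol_sum /dcol exchange_big /=.
rewrite !scaler_sumr -!sumrN -!big_split /=.
rewrite [RHS](eq_bigr (fun a => \sum_(b | P b)
  (pol (idx b k) (idx b l) (pol (idx a i) (idx a j) p) +
  (if b == a then (j == k)%:R *: pol (idx a i) (idx a l) p else 0)
  - (if b == a then (l == i)%:R *: pol (idx a k) (idx a j) p else 0)))); last first.
  move=> a Pa; rewrite !big_split /= sumrN -!big_mkcondr /=.
  have sum1 (f : 'I_r -> poly) : \sum_(b | P b && (b == a)) f b = f a.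
    by apply: big_pred1 => b /=; case: eqP => [->|]; rewrite ?Pa ?andbF.
  by rewrite !sum1.
apply: eq_bigr => a Pa; apply: eq_bigr => b Pb.
rewrite pol_comm !idx_eq; case: (eqVneq b a) => [->|kj].
  by [].
by rewrite !scale0r.
Qed.

Lemma drow_dcol a b i j p :
  drow a b (dcol predT i j p) = dcol predT i j (drow a b p).
Proof.
rewrite {1}/dcol drow_sum /drow.
rewrite (eq_bigr (fun c => \sum_k (pol (idx c i) (idx c j) (pol (idx a k) (idx b k) p)
  + ((b == c) && (k == i))%:R *: pol (idx a k) (idx c j) p
  - ((c == a) && (j == k))%:R *: pol (idx c i) (idx b k) p))); last first.
  by move=> c _; apply: eq_bigr => k _; rewrite pol_comm !idx_eq.
under eq_bigr do rewrite big_split big_split /= sumrN.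
rewrite !big_split /= sumrN -addrA [X in _ + X = _](_ : _ = 0) ?addr0.
  by rewrite dcol_sum exchange_big.
(* Each of the two correction sums has a single non-zero term, and both terms are
   [pol (idx a i) (idx b j) p]. *)
apply/eqP; rewrite subr_eq0 (bigD1 b) //= (bigD1 i) //= !eqxx.
rewrite big1 => [|k /negbTE ->]; last by rewrite andbF scale0r.
rewrite big1 => [|c /negbTE cb]; last first.
  by rewrite big1 // => k _; rewrite eq_sym cb scale0r.
rewrite (bigD1 a) //= (bigD1 j) //= !eqxx.
rewrite big1 => [|k kj]; last by rewrite eq_sym (negbTE kj) scale0r.
by rewrite big1 // => c /negbTE ->; rewrite big1 // => k _; rewrite scale0r.
Qed.

Lemma pol_dcol P a i j k l p : ~~ P a ->
  pol (idx a i) (idx a j) (dcol P k l p) = dcol P k l (pol (idx a i) (idx a j) p).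
Proof.
move=> Pa; rewrite /dcol pol_sum; apply: eq_bigr => b Pb; apply: pol_commute;
  by rewrite idx_eq negb_and; apply/orP; left; apply: contraNneq Pa => ?; subst.
Qed.

Lemma coef_dcol_diag P j p m :
  (dcol P j j p)@_m = p@_m *+ (\sum_(a | P a) m (idx a j)).
Proof.
rewrite /dcol raddf_sum /= -sumrMnr; apply: eq_bigr => a _.
exact: coef_pol_diag.
Qed.
End RowsAndColumns.

(** * Leading monomials *)

Section LeadingMonomials.
Variables (K : numFieldType) (r : nat).
Implicit Types (a b c d i j k l : 'I_r) (P : pred 'I_r).
Local Notation poly := {mpoly K[(r * r)%N]}.
Implicit Types (p q h : poly) (m : 'X_{1..(r * r)%N}).

Definition colw (la : nat -> nat) h := forall j, dcol predT j j h = (la j)%:R *: h.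

Lemma colw_sum la h m j : colw la h -> h@_m != 0 ->
  (\sum_a m (idx a j) = la j)%N.
Proof.
move=> /(_ j) /(congr1 (mcoeff m)); rewrite coef_dcol_diag mcoeffZ -[LHS]mulr_natl => e.
move=> hm; apply/eqP; rewrite -(eqr_nat K); apply/eqP; apply: (mulIf hm).
exact: e.
Qed.

(** On monomials of equal degree, the order defining [mlead] is the lexicographic one. *)
Lemma colw_mdeg la h m : colw la h -> h@_m != 0 ->
  mdeg m = (\sum_(j < r) la j)%N.
Proof.
move=> hh hm; rewrite mdegE sum_idx; apply: eq_bigr => j _.
exact: colw_sum hm.
Qed.

(** The variables preceding x_(b, c) are the x_(b', c') of the hypothesis, so [m] would exceed the
    leading monomial of [h]. *)
Lemma coef_above la h m b c : colw la h ->
  (forall b' c', (b < b')%N || ((b == b') && (c < c')%N) ->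
     m (idx b' c') = mlead h (idx b' c')) ->
  (mlead h (idx b c) < m (idx b c))%N -> h@_m = 0.
Proof.
move=> hh hab hlt; apply/eqP; apply: contraT => hm.
have h0 : h != 0 by apply: contraNneq hm => ->; rewrite mcoeff0.
have hl : h@_(mlead h) != 0 by rewrite mleadc_eq0.
suff /mcoeff_gt_mlead e : (mlead h < m)%O by rewrite e eqxx in hm.
apply/ltmcP; first by rewrite (colw_mdeg hh hm) (colw_mdeg hh hl).
exists (idx b c) => // y hy.
have [g _ gK] := idx_bij r; move: hy; rewrite -(gK y) ltn_idx => hy.
by rewrite hab.
Qed.

(** If x_(b, c) divided the leading monomial m, consider the coefficient of m x_(c, c) / x_(b, c) in
    [drow c b h]. Column c contributes a non-zero multiple of the leading coefficient; a column j >
    c contributes the coefficient of a monomial exceeding m, as it has one more x_(b, j); a column j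
    < c contributes nothing, because the exponent of x_(c, j) is 0 by induction. *)
Lemma lead_row_killed la h b c : colw la h -> h != 0 ->
  (forall a b, (a < b)%N -> drow a b h = 0) ->
  (c < b)%N -> mlead h (idx b c) = 0%N.
Proof.
move=> hh h0 hE; have [N] := ubnP (nat_of_ord c).
elim: N b c => // N IH b c cN cb.
apply/eqP; rewrite -leqn0 leqNgt; apply/negP => mbc.
have mE := mnm_subU mbc; set q := (mlead h - _)%MM in mE.
have cbF : (c == b) = false by apply/eqP => e; rewrite e ltnn in cb.
move: (hE _ _ cb) => /(congr1 (mcoeff (q + U_(idx c c)))).
rewrite mcoeff0 /drow raddf_sum /= (bigD1 c) //= coef_pol -mE big1 ?addr0.
  by move/eqP; rewrite mulrn_eq0 /= mleadc_eq0 (negbTE h0).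
move=> j jc; have [q0|qj] := posnP (q (idx c j)).
  by rewrite coef_pol0 // mnmDE mnm1E idx_eq [c == j]eq_sym (negbTE jc) andbF addn0.
have [jltc|cltj|/val_inj e] := ltngtP j c; last by rewrite e eqxx in jc.
  move: qj; rewrite /q mnmBE mnm1E idx_eq eq_sym cbF subn0 IH //.
    exact: leq_trans jltc _.
have -> : (q + U_(idx c c) = (q - U_(idx c j) + U_(idx c c)) + U_(idx c j))%MM.
  by rewrite {1}(mnm_subU qj) -!addmA [(U_(_) + U_(_))%MM]addmC.
rewrite coef_pol (coef_above (b := b) (c := j) hh) ?mul0rn //.
  move=> b' c' hbc; rewrite [in RHS]mE !mnmDE mnmBE !mnm1E !idx_eq.
  have -> : (c == b') = false by apply/eqP => e; case/orP: hbc => [|/andP[/eqP e' _]]; subst; lia.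
  case/orP: hbc => [bb'|/andP[/eqP <- jc']].
    have -> : (b == b') = false by apply/eqP => e; subst; lia.
    by rewrite !andFb subn0 !addn0.
  rewrite eqxx /= subn0 addn0; do 2 (case: eqP => [?|_]; first by subst; lia).
  by [].
rewrite [in X in (X < _)%N]mE !mnmDE mnmBE !mnm1E !idx_eq !eqxx cbF [c == j]eq_sym (negbTE jc) /=.
by rewrite ?andbF ?addn0 ?subn0 ?addn1.
Qed.

Definition mfilter (Q : pred 'X_{1..(r * r)%N}) p : poly :=
  \sum_(m <- msupp p | Q m) p@_m *: 'X_[m].

Lemma coef_mfilter Q p m : (mfilter Q p)@_m = if Q m then p@_m else 0.
Proof.
rewrite /mfilter raddf_sum /= big_mkcond /=.
under eq_bigr => k _.
  rewrite (_ : (if Q k then _ else _) = if k == m then if Q m then p@_m else 0 else 0);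
    first over.
  rewrite mcoeffZ mcoeffX; case: eqP => [->|_]; first by rewrite mulr1.
  by rewrite mulr0 if_same.
rewrite -big_mkcond /=; have [ms|ms] := boolP (m \in msupp p).
  by rewrite (big_rem m ms) /= eqxx big1_seq ?addr0 // => k /andP[/eqP ->];
     rewrite mem_rem_uniqF // msupp_uniq.
rewrite big1_seq => [|k /andP[/eqP -> kp]]; last by rewrite kp in ms.
by case: ifP => // _; rewrite (memN_msupp_eq0 ms).
Qed.

Lemma mfilter_pol Q Q' u v p :
  (forall m, Q (m + U_(v))%MM = Q' (m + U_(u))%MM) ->
  pol u v (mfilter Q p) = mfilter Q' (pol u v p).
Proof.
move=> QQ'; apply/mpolyP => m; rewrite coef_mfilter.
have [m0|mu] := posnP (m u); first by rewrite !coef_pol0 // if_same.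
by rewrite (mnm_subU mu) !coef_pol coef_mfilter QQ'; case: ifP => // _; rewrite mul0rn.
Qed.

Lemma mfilter_dcol Q P i j p :
  (forall b m, P b -> Q (m + U_(idx b j))%MM = Q (m + U_(idx b i))%MM) ->
  dcol P i j (mfilter Q p) = mfilter Q (dcol P i j p).
Proof.
move=> QP; apply/mpolyP => m; rewrite coef_mfilter /dcol !raddf_sum /=.
rewrite -[RHS](_ : \sum_(b | P b) (if Q m then (pol (idx b i) (idx b j) p)@_m else 0) = _);
  last by case: ifP => // _; rewrite big1.
apply: eq_bigr => b Pb; rewrite (mfilter_pol (Q' := Q)) ?coef_mfilter //.
by move=> k; exact: QP.
Qed.

(** Each step shifts the monomials injectively and multiplies their coefficients by the exponents of
    x_v, which stay positive during the k steps. *)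
Lemma iter_pol_inj u v (k : nat) p : u != v ->
  (forall m, p@_m != 0 -> (k <= m v)%N) -> iter k (pol u v) p = 0 -> p = 0.
Proof.
move=> uv; elim: k p => [|k IH] p hp; first by [].
rewrite iterSr => /IH Dp.
have {}Dp : pol u v p = 0.
  apply: Dp => m; have [m0|mu] := posnP (m u); first by rewrite coef_pol0 // eqxx.
  rewrite {1}(mnm_subU mu) coef_pol mulrn_eq0 /= => /hp.
  by rewrite mnmDE mnmBE !mnm1E eqxx (negbTE uv) subn0 addn1.
apply/mpolyP => m; rewrite mcoeff0; apply/eqP; apply: contraT => pm.
have mv : (0 < m v)%N by apply: leq_trans (hp _ pm).
move: Dp => /(congr1 (mcoeff ((m - U_(v)) + U_(u)))) /eqP.
by rewrite mcoeff0 coef_pol -mnm_subU // mulrn_eq0 /= (negbTE pm).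
Qed.

Lemma sum_row_split (f : 'I_r -> nat) a :
  (\sum_b f b = \sum_(b < r | (b < a)%N) f b + f a + \sum_(b < r | (a < b)%N) f b)%N.
Proof.
rewrite (bigD1 a) //= (bigID (fun b : 'I_r => (b < a)%N)) /= addnCA addnA.
congr (_ + _ + _)%N; apply: eq_bigl => b; rewrite -(inj_eq val_inj) /=; lia.
Qed.

(* Put x = x_(a, j), y = x_(a, j + 1), and let the leading monomial of h have
   the exponent t in y.  Let u_k be the sum of the terms of h that have the
   same exponents as the leading one in the rows >= a, except that y^k has been
   replaced by x^k.  The raising operator F of the rows < a satisfies
   F u_0 = 0 and F u_(k+1) = - x d/dy u_k, so that F^(t+1) u_t = 0. Were the
   ballot condition not satisfied, u_t would have a too negative weight. *)
Lemma lead_ballot la h a j j' : colw la h -> h != 0 -> j' = j.+1 :> nat ->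
  dcol predT j j' h = 0 ->
  (\sum_(b < r | (b <= a)%N) mlead h (idx b j') <=
   \sum_(b < r | (b < a)%N) mlead h (idx b j))%N.
Proof.
move=> hh h0 jj' hF; set m := mlead h; set x := idx a j; set y := idx a j'.
have jne : j != j' by apply/eqP => e; rewrite e in jj'; lia.
have xy : x != y by rewrite idx_eq eqxx.
pose base (m' : 'X_{1..(r * r)%N}) := [forall b : 'I_r, forall c : 'I_r,
  ((a < b)%N || [&& a == b, c != j & c != j']) ==> (m' (idx b c) == m (idx b c))].
have baseP m' b c : base m' -> (a < b)%N || [&& a == b, c != j & c != j'] ->
    m' (idx b c) = m (idx b c).
  by move=> /forallP/(_ b)/forallP/(_ c)/implyP h1 h2; apply/eqP; exact: h1.
have baseU w b c c' : (b <= a)%N -> c \in [:: j; j'] -> c' \in [:: j; j'] ->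
    base (w + U_(idx b c))%MM = base (w + U_(idx b c'))%MM.
  move=> ba cj cj'; apply: eq_forallb => b'; apply: eq_forallb => k.
  apply: implyb_id2l => hk; rewrite !mnmDE !mnm1E !idx_eq.
  have [bb|//] := eqVneq b b'.
  rewrite bb in ba; move: hk; rewrite ltnNge ba /= => /and3P[_ kj kj'].
  have cF d : d \in [:: j; j'] -> (d == k) = false.
    by rewrite !inE => /orP[] /eqP ->; rewrite eq_sym; apply: negbTE.
  by rewrite !cF.
pose P := [pred b : 'I_r | (b < a)%N]; pose D := pol (K := K) x y.
pose F := dcol (K := K) P j j'.
(* Otherwise [h] would contain a monomial with one more y than the leading one and the same
   preceding exponents. *)
have topD m' : base m' -> m' y = m y -> (D h)@_m' = 0.
  move=> bm' my; have [?|mx] := posnP (m' x); first by rewrite coef_pol0.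
  rewrite (mnm_subU mx) coef_pol (coef_above (b := a) (c := j') hh) ?mul0rn //.
    move=> b c hbc; rewrite mnmDE mnmBE !mnm1E !idx_eq.
    have -> : m' (idx b c) = mlead h (idx b c).
      apply: baseP bm' _; case/orP: hbc => [->//|/andP[-> /= jc]].
      apply/orP; right; rewrite -!(inj_eq val_inj) /=; lia.
    have [ab|_] := eqVneq a b; last by rewrite !andFb subn0 addn0.
    have jc : (j' < c)%N by case/orP: hbc => [|/andP[]//]; subst; lia.
    rewrite -!(inj_eq val_inj) /=.
    have -> : (j == c :> nat) = false by lia.
    have -> : (j' == c :> nat) = false by lia.
    by rewrite /= ?andbF subn0 addn0.
  by rewrite mnmDE mnmBE !mnm1E eqxx (negbTE xy) subn0 my addn1.
(* The full raising operator is the sum of [F], [D] and the part of the rows > a. On a monomial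
   frozen in these rows the last part contributes 0: it would come from a monomial exceeding the
   leading one. *)
have FDh m' : base m' -> (F h + D h)@_m' = 0.
  move=> bm'; have <- : (dcol predT j j' h)@_m' = 0 by rewrite hF mcoeff0.
  rewrite [in RHS]/dcol (bigD1 a) //= addrC.
  rewrite (bigID (fun b : 'I_r => (b < a)%N)) /= !mcoeffD; congr (_ + _).
  rewrite [X in _ = _ + X]raddf_sum /= [X in _ = _ + X]big1 ?addr0 => [|b hb].
    rewrite /F /dcol; congr (_@__); apply: eq_bigl => b /=.
    by rewrite -(inj_eq val_inj) /=; lia.
  have ab : (a < b)%N by move: hb; rewrite -(inj_eq val_inj) /=; lia.
  have [?|mx] := posnP (m' (idx b j)); first by rewrite coef_pol0.
  rewrite (mnm_subU mx) coef_pol (coef_above (b := b) (c := j') hh) ?mul0rn //.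
    move=> b' c hbc; rewrite mnmDE mnmBE !mnm1E !idx_eq.
    have -> : m' (idx b' c) = mlead h (idx b' c).
      apply: baseP bm' _; case/orP: hbc => [bb|/andP[/eqP <- _]]; last by rewrite ab.
      by rewrite (ltn_trans ab bb).
    have [bb|_] := eqVneq b b'; last by rewrite !andFb subn0 addn0.
    have jc : (j' < c)%N by case/orP: hbc => [|/andP[]//]; subst; lia.
    rewrite -!(inj_eq val_inj) /=.
    have -> : (j == c :> nat) = false by lia.
    have -> : (j' == c :> nat) = false by lia.
    by rewrite /= ?andbF subn0 addn0.
  rewrite mnmDE mnmBE !mnm1E !idx_eq !eqxx (negbTE jne) subn0 addn1.
  by rewrite (baseP _ _ _ bm') // ab.
pose Q (k : nat) m' := [&& base m', m' y + k == m y & m' x == m x + k]%N.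
pose u (k : nat) := mfilter (Q k) h.
have FQ (k : nat) p : F (mfilter (Q k) p) = mfilter (Q k) (F p).
  apply: mfilter_dcol => b w /= ba.
  rewrite /Q (baseU _ _ j' j) ?inE ?eqxx ?orbT ?(ltnW ba) //; congr [&& _, _ & _];
  rewrite !mnmDE !mnm1E !idx_eq; have -> : (b == a) = false by
     (apply/eqP => e; rewrite e ltnn in ba).
    by [].
  by [].
have DQ (k : nat) p : D (mfilter (Q k) p) = mfilter (Q k.+1) (D p).
  apply: mfilter_pol => q; rewrite /Q (baseU _ _ j' j) ?inE ?eqxx ?orbT //.
  rewrite !mnmDE !mnm1E !eqxx [y == x]eq_sym (negbTE xy).
  by congr [&& _, _ & _]; apply/eqP/eqP; lia.
have FuS (k : nat) : F (u k.+1) = - D (u k).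
  rewrite FQ DQ; apply/mpolyP => m'; rewrite mcoeffN !coef_mfilter.
  case: ifP => [/and3P[bm' _ _]|_]; last by rewrite oppr0.
  by apply/eqP; rewrite -addr_eq0 -mcoeffD FDh.
have Fu0 : F (u 0%N) = 0.
  rewrite FQ; apply/mpolyP => m'; rewrite mcoeff0 coef_mfilter.
  case: ifP => // /and3P[bm' /eqP my _]; rewrite addn0 in my.
  by have := FDh _ bm'; rewrite mcoeffD topD // addr0.
have FDC p : F (D p) = D (F p).
  by rewrite /F /D -pol_dcol //= ltnn.
rewrite leqNgt; apply/negP => hlt.
set al := (\sum_(b < r | (b < a)%N) m (idx b j))%N in hlt.
set be := (\sum_(b < r | (b < a)%N) m (idx b j'))%N.
set t := m y.
have {}hlt : (al < be + t)%N.
  apply: leq_trans hlt _; rewrite (bigD1 a) //= addnC leq_add2r.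
  rewrite leq_eqVlt; apply/orP; left; apply/eqP; apply: eq_bigl => b.
  by rewrite -(inj_eq val_inj) /=; lia.
have FZ (z : K) p : F (z *: p) = z *: F p by rewrite /F dcolZ.
(* By induction from F u_(k+1) = - D u_k, since [D] and [F] commute; hence F^(t+1) u_t is, up to
   sign, D^t F u_0 = 0. *)
have Du0 (k : nat) : iter k D (u 0%N) = (-1) ^+ k *: iter k F (u k).
  elim: k => [|k IH]; first by rewrite scale1r.
  have FiD (l : nat) p : iter l F (D p) = D (iter l F p) by elim: l => //= l ->; rewrite FDC.
  have FiZ (l : nat) (z : K) p : iter l F (z *: p) = z *: iter l F p.
    by elim: l => //= l ->; rewrite FZ.
  rewrite iterS IH [D _]polZ -/D -FiD iterSr FuS -scaleN1r FiZ scalerA exprSr.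
  by rewrite -mulrA mulrNN mulr1 mulr1.
have Fut : iter t.+1 F (u t) = 0.
  have : F (iter t D (u 0%N)) = 0.
    have -> : F (iter t D (u 0%N)) = iter t D (F (u 0%N)).
      by elim: (t) => //= l IH; rewrite FDC IH.
    by rewrite Fu0; elim: (t) => //= l ->; rewrite /D /pol mderiv0 mulr0.
  by rewrite Du0 FZ => /eqP; rewrite scaler_eq0 signr_eq0 => /eqP.
(* On the rows < a, [u t] has the weights al - t and be + t: row a has exchanged y^t for x^t, and
   the column degrees of the rows <= a are those of the leading monomial. For the power t + 1, the
   condition of [sl2_raise_inj] is then al < be + t, the negation of the ballot inequality. *)
have ut0 : u t = 0.
  pose wt A B (v : poly) := dcol P j j v = A%:~R *: v /\ dcol P j' j' v = B%:~R *: v.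
  apply: (@sl2_raise_inj K poly F (dcol P j' j) wt _ _ _ _ _ _ _
    t.+1 (al%:Z - t%:Z) (be%:Z + t%:Z) _ _ _ Fut); first exact: dcolZ.
  - exact: dcolD.
  - exact: dcolZ.
  - move=> A B v [vA vB]; split.
      rewrite /F dcol_comm eqxx eq_sym (negbTE jne) vA dcolZ scale0r subr0.
      by rewrite -scalerDl intrD.
    rewrite /F dcol_comm eqxx eq_sym (negbTE jne) vB dcolZ scale0r addr0.
    by rewrite -scalerBl intrB.
  - move=> A B v [vA vB]; split.
      by rewrite /F dcol_comm eqxx (negbTE jne) vA dcolZ scale0r addr0 -scalerBl intrB.
    by rewrite /F dcol_comm eqxx (negbTE jne) vB dcolZ scale0r subr0 -scalerDl intrD.
  - move=> A B v A0 [vA _]; apply/mpolyP => m'; rewrite mcoeff0.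
    move: vA => /(congr1 (mcoeff m')); rewrite coef_dcol_diag mcoeffZ -[LHS]mulr_natl.
    move/eqP; rewrite -subr_eq0 -mulrBl mulf_eq0 => /orP[|/eqP //].
    by rewrite -[(_)%:R]mulrz_nat -intrB intr_eq0; lia.
  - move=> A B v [vA vB].
    by rewrite /F dcol_comm !eqxx !scale1r vA vB -addrA -scalerBl intrB.
  - have rows m' c : (u t)@_m' != 0 ->
        (\sum_(b < r | (b < a)%N) m' (idx b c) + m' (idx a c) =
         \sum_(b < r | (b < a)%N) m (idx b c) + m (idx a c))%N.
      rewrite coef_mfilter; case: ifP => [|_]; last by rewrite eqxx.
      move=> /and3P[bm' _ _] hm'.
      have hl : h@_m != 0 by rewrite mleadc_eq0.
      have := colw_sum c hh hl; rewrite -(colw_sum c hh hm') !(sum_row_split _ a).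
      suff -> : (\sum_(b < r | (a < b)%N) m' (idx b c) = \sum_(b < r | (a < b)%N) m (idx b c))%N.
        by move/addIn.
      by apply: eq_bigr => b ab; rewrite (baseP _ _ _ bm') // ab.
    have ut m' : (u t)@_m' != 0 -> (m' y = 0 /\ m' x = m x + t)%N.
      rewrite coef_mfilter; case: ifP => [|_]; last by rewrite eqxx.
      by move=> /and3P[_ /eqP my /eqP mx] _; split => //; move: my; rewrite -/t; lia.
    have diag c (A : int) : (forall m', (u t)@_m' != 0 ->
        (\sum_(b < r | (b < a)%N) m' (idx b c))%:Z = A) ->
        dcol P c c (u t) = A%:~R *: u t.
      move=> hA; apply/mpolyP => m'; rewrite coef_dcol_diag mcoeffZ -[LHS]mulr_natl.
      have [->|/hA <-] := eqVneq (u t)@_m' 0; first by rewrite !mulr0.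
      by [].

    split; apply: diag => m' hm'; have [my mx] := ut _ hm'.
      by have := rows _ j hm'; rewrite -/x mx -/al; lia.
    by have := rows _ j' hm'; rewrite -/y my -/be -/t; lia.
  - lia.
(* Every monomial of u_0 contains y^t, so that D^t is injective on u_0; but u_0 contains the leading
   term of [h]. *)
have : u 0%N = 0.
  apply: (iter_pol_inj xy (k := t)); last first.
    rewrite -/D Du0 ut0.
    by rewrite (_ : iter _ _ _ = 0) ?scaler0 //; elim: (t) => //= k ->; rewrite /F dcol0.
  move=> m'; rewrite coef_mfilter; case: ifP => [/and3P[_ /eqP]|]; last by rewrite eqxx.
  by rewrite addn0 => ->.
move/(congr1 (mcoeff m))/eqP; rewrite mcoeff0 coef_mfilter /Q addn0 addn0 !eqxx.
rewrite (_ : base m) ?mleadc_eq0 ?(negbTE h0) //.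
by apply/forallP => b; apply/forallP => c; rewrite eqxx implybT.
Qed.
End LeadingMonomials.

(** * Minors and bitableaux *)

Section DerivationOfDeterminants.
Variables (A : comNzRingType) (D : A -> A).
Hypothesis DD : forall x y, D (x + y) = D x + D y.
Hypothesis DM : forall x y, D (x * y) = D x * y + x * D y.

Lemma derivation0 : D 0 = 0.
Proof. by apply: (addIr (D 0)); rewrite -DD !add0r. Qed.

Lemma derivation_sign n : D ((-1) ^+ n) = 0.
Proof.
have D1 : D 1 = 0.
  by apply: (addIr (D 1)); rewrite add0r -{3}[1]mulr1 DM mulr1 mul1r.
have DN1 : D (- 1) = 0 by rewrite -[LHS]addr0 -D1 -DD addNr derivation0.
by elim: n => [|n IH]; rewrite ?expr0 // exprS DM DN1 IH mul0r mulr0 addr0.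
Qed.

Lemma derivation_det0 k (M : 'M[A]_k) :
  (forall i j, D (M i j) = 0) -> D (\det M) = 0.
Proof.
move=> hM; rewrite /determinant.
elim/big_ind: _ => [|x y hx hy|s _]; first exact: derivation0.
  by rewrite DD hx hy addr0.
rewrite DM derivation_sign mul0r add0r.
have -> : D (\prod_i M i (s i)) = 0; last by rewrite mulr0.
elim/big_ind: _ => [|x y hx hy|i _]; first exact: (derivation_sign 0).
  by rewrite DM hx hy mul0r mulr0 addr0.
exact: hM.
Qed.

(** Expand along row i0: the cofactors do not involve this row, so [D] kills them. *)
Lemma derivation_det_row k (M : 'M[A]_k) i0 (B : 'I_k -> A) :
  (forall i j, D (M i j) = (i == i0)%:R * B j) ->
  D (\det M) = \det (\matrix_(i, j) if i == i0 then B j else M i j).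
Proof.
move=> hM; set N := (\matrix_(i, j) _).
rewrite (expand_det_row M i0) (expand_det_row N i0) (big_morph D DD derivation0).
apply: eq_bigr => j _; rewrite DM hM eqxx mul1r.
have liftF i : (lift i0 i == i0) = false by rewrite eq_sym (negbTE (neq_lift _ _)).
have -> : N i0 j = B j by rewrite mxE eqxx.
have -> : cofactor N i0 j = cofactor M i0 j.
  rewrite /cofactor; congr (_ * \det _); apply/matrixP => i l.
  by rewrite !mxE liftF.
rewrite /cofactor [D (_ * _)]DM derivation_sign derivation_det0 => [|i l].
  by rewrite mul0r mulr0 addr0 mulr0 addr0.
by rewrite !mxE hM liftF mul0r.
Qed.

Lemma derivation_det_col k (M : 'M[A]_k) j0 (B : 'I_k -> A) :
  (forall i j, D (M i j) = (j == j0)%:R * B i) ->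
  D (\det M) = \det (\matrix_(i, j) if j == j0 then B i else M i j).
Proof.
move=> hM; rewrite -det_tr (derivation_det_row (i0 := j0) (B := B)) => [|i j].
  by rewrite -det_tr; congr (\det _); apply/matrixP => i j; rewrite !mxE.
by rewrite mxE hM.
Qed.

Lemma derivation_eigen_prod (I : Type) (s : seq I) (P : pred I) (f : I -> A) (w : I -> nat) :
  (forall i, D (f i) = f i *+ w i) ->
  D (\prod_(i <- s | P i) f i) = (\prod_(i <- s | P i) f i) *+ (\sum_(i <- s | P i) w i).
Proof.
move=> hf; elim: s => [|i s IH]; first by rewrite !big_nil mulr0n (derivation_sign 0).
rewrite !big_cons; case: ifP => // _; rewrite DM IH hf mulrnDr.
by rewrite mulrnAl mulrnAr.
Qed.

Lemma derivation_prod0 (I : Type) (s : seq I) (P : pred I) (f : I -> A) :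
  (forall i, D (f i) = 0) -> D (\prod_(i <- s | P i) f i) = 0.
Proof.
move=> hf; rewrite (derivation_eigen_prod _ _ (w := fun=> 0%N)) => [|i].
  by rewrite [(\sum_(_ <- _ | _) _)%N]big1 ?mulr0n.
by rewrite hf mulr0n.
Qed.
End DerivationOfDeterminants.

Section Minors.
Variables (K : numFieldType) (r : nat).
Local Notation poly := {mpoly K[(r * r)%N]}.
Implicit Types (a b c i j : 'I_r) (m : 'X_{1..(r * r)%N}).

Definition minor k (kr : (k <= r)%N) (t : 'I_k -> 'I_r) : poly :=
  \det (\matrix_(p < k, q < k) 'X_(idx (t p) (widen_ord kr q))).

Definition mnm_minor k (kr : (k <= r)%N) (t : 'I_k -> 'I_r) : 'X_{1..(r * r)%N} :=
  (\big[+%MM/0%MM]_(p < k) U_(idx (t p) (widen_ord kr p)))%MM.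

(** The operator replaces column j' by column j. As the minor uses the first k columns, column j is
    already present whenever column j' is. *)
Lemma minor_dcol k (kr : (k <= r)%N) t j j' : (j < j')%N ->
  dcol predT j j' (minor kr t) = 0.
Proof.
move=> jj'; have [kj|jk] := leqP k j'.
  apply: derivation_det0; [exact: dcolD|exact: dcolM|] => p q.
  rewrite mxE dcolX (_ : _ == _ = false) ?scale0r //.
  by apply/eqP => e; move: (ltn_ord q); rewrite leqNgt ltnS; move: kj; rewrite e /= => ->.
rewrite (derivation_det_col (@dcolD _ _ _ _ _) (@dcolM _ _ _ _ _) (j0 := Ordinal jk)
   (B := fun p => 'X_(idx (t p) j))).
  apply/eqP; rewrite -det_tr; apply/eqP.
  apply: (determinant_alternate (i1 := Ordinal jk) (i2 := Ordinal (ltn_trans jj' jk))).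
    by rewrite -(inj_eq val_inj) /=; lia.
  move=> p; rewrite !mxE eqxx -(inj_eq val_inj) /= (ltn_eqF jj').
  by congr ('X_(idx _ _)); apply: val_inj.
by move=> p q; rewrite mxE dcolX eq_sym -!(inj_eq val_inj) scaler_nat mulr_natl.
Qed.

Lemma minor_dcol_diag k (kr : (k <= r)%N) t j :
  dcol predT j j (minor kr t) = minor kr t *+ (j < k).
Proof.
have [kj|jk] := leqP k j.
  apply: derivation_det0; [exact: dcolD|exact: dcolM|] => p q.
  rewrite mxE dcolX (_ : _ == _ = false) ?scale0r //.
  by apply/eqP => e; move: (ltn_ord q); rewrite leqNgt ltnS; move: kj; rewrite e /= => ->.
rewrite (derivation_det_col (@dcolD _ _ _ _ _) (@dcolM _ _ _ _ _) (j0 := Ordinal jk)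
   (B := fun p => 'X_(idx (t p) j))).
  rewrite mulr1n; congr (\det _); apply/matrixP => p q; rewrite !mxE.
  by case: eqP => // ->; congr ('X_(idx _ _)); apply: val_inj.
by move=> p q; rewrite mxE dcolX eq_sym -!(inj_eq val_inj) scaler_nat mulr_natl.
Qed.

(** The same argument with rows, which is why the rows are the first k ones here. *)
Lemma minor_drow k (kr : (k <= r)%N) a b : (a < b)%N ->
  drow a b (minor kr (widen_ord kr)) = 0.
Proof.
move=> ab; have [kb|bk] := leqP k b.
  apply: derivation_det0; [exact: drowD|exact: drowM|] => p q.
  rewrite mxE drowX (_ : _ == _ = false) ?scale0r //.
  by apply/eqP => e; move: (ltn_ord p); rewrite leqNgt ltnS; move: kb; rewrite e /= => ->.
rewrite (derivation_det_row (@drowD _ _ _ _) (@drowM _ _ _ _) (i0 := Ordinal bk)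
   (B := fun q => 'X_(idx a (widen_ord kr q)))).
  apply: (determinant_alternate (i1 := Ordinal bk) (i2 := Ordinal (ltn_trans ab bk))).
    by rewrite -(inj_eq val_inj) /=; lia.
  move=> q; rewrite !mxE eqxx -(inj_eq val_inj) /= (ltn_eqF ab).
  by congr ('X_(idx _ _)); apply: val_inj.
by move=> p q; rewrite mxE drowX eq_sym -!(inj_eq val_inj) scaler_nat mulr_natl.
Qed.

Lemma minor_drow_diag k (kr : (k <= r)%N) a :
  drow a a (minor kr (widen_ord kr)) = minor kr (widen_ord kr) *+ (a < k).
Proof.
have [kb|bk] := leqP k a.
  apply: derivation_det0; [exact: drowD|exact: drowM|] => p q.
  rewrite mxE drowX (_ : _ == _ = false) ?scale0r //.
  by apply/eqP => e; move: (ltn_ord p); rewrite leqNgt ltnS; move: kb; rewrite e /= => ->.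
rewrite (derivation_det_row (@drowD _ _ _ _) (@drowM _ _ _ _) (i0 := Ordinal bk)
   (B := fun q => 'X_(idx a (widen_ord kr q)))).
  rewrite mulr1n; congr (\det _); apply/matrixP => p q; rewrite !mxE.
  by case: eqP => // ->; congr ('X_(idx _ _)); apply: val_inj.
by move=> p q; rewrite mxE drowX eq_sym -!(inj_eq val_inj) scaler_nat mulr_natl.
Qed.
End Minors.

Section LeadingMinors.
Variables (K : numFieldType) (r : nat).
Local Notation poly := {mpoly K[(r * r)%N]}.
Implicit Types (a b c i j : 'I_r) (m : 'X_{1..(r * r)%N}).

Lemma mnm_minorE k (kr : (k <= r)%N) (t : 'I_k -> 'I_r) (s : 'S_k) a c :
  ((\big[+%MM/0%MM]_(p < k) U_(idx (t p) (widen_ord kr (s p))))%MM (idx a c) =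
   \sum_(p < k) ((t p == a) && (s p == c :> nat)))%N.
Proof.
by rewrite mnm_sumE; apply: eq_bigr => p _; rewrite mnm1E idx_eq -[X in _ && X](inj_eq val_inj).
Qed.

(** For the largest p moved by [s], one has s p < p: the diagonal monomial contains x_(t p, p), the
    other one does not, and the preceding exponents agree because [s] fixes every q > p. *)
Lemma mnm_minor_perm k (kr : (k <= r)%N) (t : 'I_k -> 'I_r) (s : 'S_k) :
  {homo t : p q / (p < q)%N} -> s != 1%g ->
  ((\big[+%MM/0%MM]_(p < k) U_(idx (t p) (widen_ord kr (s p))))%MM < mnm_minor kr t)%O.
Proof.
move=> tinc s1.
have [p0 sp0] : exists p, s p != p.
  apply/existsP; apply: contraNT s1; rewrite negb_exists => /forallP h.
  by apply/eqP/permP => p; rewrite perm1; apply/eqP; rewrite -[_ == _]negbK.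
pose p := [arg max_(p > p0 | s p != p) (p : nat)].
have [sp pmax] : s p != p /\ forall q, s q != q -> (q <= p)%N.
  by rewrite /p; case: arg_maxnP.
have fixed (q : 'I_k) : (p < q)%N -> s q = q.
  move=> pq; apply/eqP; apply: contraTT pq => /pmax; rewrite -leqNgt //.
have spp : (s p < p)%N.
  rewrite ltn_neqAle (inj_eq val_inj) sp leqNgt; apply/negP => /fixed /perm_inj e.
  by rewrite e eqxx in sp.
have tinj : injective t.
  move=> q q' e; apply: val_inj; case: (ltngtP q q') => // /tinc; rewrite e ltnn //.
have diagE b c : mnm_minor kr t (idx b c) =
    (\sum_(q < k) ((t q == b) && (q == c :> nat)))%N.
  have -> : mnm_minor kr t =
      (\big[+%MM/0%MM]_(q < k) U_(idx (t q) (widen_ord kr ((1%g : 'S_k) q))))%MM.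
    by apply: eq_bigr => q _; rewrite perm1.
  by rewrite mnm_minorE; apply: eq_bigr => q _; rewrite perm1.
apply/ltmcP.
  rewrite /mnm_minor !mdeg_sum; apply: eq_bigr => q _; by rewrite !mdeg1.
exists (idx (t p) (widen_ord kr p)) => [y hy|].
  have [g _ gK] := idx_bij r; move: hy; rewrite -(gK y) ltn_idx /= => hy.
  rewrite mnm_minorE diagE; apply: eq_bigr => q _.
  have [e|//] := eqVneq (t q) (g y).1; rewrite /=.
  case/orP: hy => [tp|/andP[/eqP tp pc]].
    suff -> : s q = q by [].
    apply: fixed; rewrite ltnNge; apply/negP => qp; move: tp; rewrite -e.
    move: qp; rewrite leq_eqVlt => /orP[/eqP/val_inj ->|/tinc]; first by rewrite ltnn.
    by move=> h1 h2; have := ltn_trans h1 h2; rewrite ltnn.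
  have -> : q = p by apply: tinj; rewrite e tp.
  by congr nat_of_bool; lia.
rewrite mnm_minorE diagE (bigD1 p) //= [X in (_ < X)%N](bigD1 p) //= !eqxx /=.
rewrite (ltn_eqF spp) add0n big1 // => q qp.
by rewrite (inj_eq tinj) (negbTE qp).
Qed.

Lemma lead_minor k (kr : (k <= r)%N) (t : 'I_k -> 'I_r) :
  {homo t : p q / (p < q)%N} ->
  (minor K kr t)@_(mnm_minor kr t) = 1 /\ mlead (minor K kr t) = mnm_minor kr t.
Proof.
move=> tinc; have E m : (minor K kr t)@_m = \sum_(s : 'S_k) (-1) ^+ s *
    ((\big[+%MM/0%MM]_(p < k) U_(idx (t p) (widen_ord kr (s p))))%MM == m)%:R.
  rewrite /minor /determinant raddf_sum /=; apply: eq_bigr => s _.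
  under eq_bigr do rewrite mxE.
  rewrite -(big_morph (fun m => 'X_[m] : poly) (@mpolyXD _ _) (@mpolyX0 _ _)).
  by rewrite !mulr_sign; case: (odd_perm s); rewrite ?mcoeffN mcoeffX.
have E1 : (minor K kr t)@_(mnm_minor kr t) = 1.
  rewrite E (bigD1 (1%g : 'S_k)) //= odd_perm1 expr0 mul1r.
  rewrite (_ : _ == _ = true); last by apply/eqP/eq_bigr => p _; rewrite perm1.
  rewrite big1 ?addr0 // => s s1; apply/eqP; rewrite mulf_eq0; apply/orP; right.
  by rewrite (lt_eqF (mnm_minor_perm kr tinc s1)).
split=> //; apply/eqP; rewrite eq_le msupp_le_mlead ?mcoeff_msupp ?E1 ?oner_neq0 // andbT.
rewrite leNgt; apply/negP => hlt.
have h0 : minor K kr t != 0.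
  by apply: contra_eq_neq E1 => ->; rewrite mcoeff0 eq_sym oner_neq0.
move: (h0); rewrite -mleadc_eq0 E big1 ?eqxx // => s _.
have [->|s1] := eqVneq s (1%g : 'S_k).
  rewrite (_ : _ == _ = false) ?mulr0 //; apply/eqP => e; move: hlt.
  by rewrite -e /mnm_minor; under [X in (_ < X)%O]eq_bigr do rewrite perm1; rewrite ltxx.
have /lt_trans/(_ hlt) h := mnm_minor_perm kr tinc s1.
by rewrite (lt_eqF h) mulr0.
Qed.
End LeadingMinors.

(** The conjugate partition, its parts being numbered from 0. *)
Definition colh (la : seq nat) (c : nat) : nat := count (fun l => (c < l)%N) la.

Lemma ltn_colh la c p : sorted geq la -> (p < colh la c)%N = (c < nth 0 la p)%N.
Proof.
rewrite /colh; elim: la p => [|l la IH] p /=; first by rewrite nth_nil.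
rewrite (path_sortedE (rev_trans leq_trans)) => /andP[/allP hl hs].
have [cl|lc] := ltnP c l; first by case: p => [|p] //=; rewrite add1n ltnS IH.
have -> : count (fun l => (c < l)%N) la = 0%N.
  apply/eqP; rewrite -leqn0 leqNgt -has_count; apply/hasPn => x /hl /= xl.
  by rewrite -leqNgt (leq_trans xl lc).
case: p => [|p] /=; first by rewrite [in RHS]ltnNge lc.
apply/esym/negbTE; rewrite -leqNgt; have [pl|pl] := ltnP p (size la).
  exact: leq_trans (hl _ (mem_nth 0 pl)) lc.
by rewrite nth_default.
Qed.

Lemma nth_le_head la j : sorted geq la -> (nth 0 la j <= head 0 la)%N.
Proof.
case: la => [|l la] /=; first by rewrite nth_nil.
rewrite (path_sortedE (rev_trans leq_trans)) => /andP[/allP hl _].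
case: j => [|j] //=; have [pl|pl] := ltnP j (size la); first exact: (hl _ (mem_nth 0 pl)).
by rewrite nth_default.
Qed.

Section Bitableaux.
Variables (K : numFieldType) (r : nat).
Local Notation poly := {mpoly K[(r * r)%N]}.
Implicit Types (a b i j : 'I_r) (m : 'X_{1..(r * r)%N}).
Variable la : seq nat.
Hypotheses (la_sorted : sorted geq la) (la_size : (size la <= r)%N).

Lemma colh_le c : (colh la c <= r)%N.
Proof. exact: leq_trans (count_size _ _) la_size. Qed.

(** [t p c] is the entry in row p and column c of a tableau, with letters counted from 0. All the
    minors use initial columns of the matrix, so that right raising operators kill them. *)
Definition bitab (t : nat -> nat -> 'I_r) : poly :=
  \prod_(c < head 0%N la) minor K (colh_le c) (fun p => t p c).

Lemma bitab_dcol t j j' : (j < j')%N -> dcol predT j j' (bitab t) = 0.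
Proof.
move=> jj'; apply: derivation_prod0; [exact: dcolD|exact: dcolM|].
by move=> c; apply: minor_dcol.
Qed.

Lemma sum_colh j : (\sum_(c < head 0%N la) (j < colh la c) = nth 0 la j)%N.
Proof.
under eq_bigr do rewrite ltn_colh //.
rewrite -(big_mkord predT (fun c => nat_of_bool (c < nth 0 la j)%N)).
rewrite (big_cat_nat (n := nth 0 la j)) ?nth_le_head //=.
rewrite [X in (_ + X)%N]big_nat [X in (_ + X)%N]big1 ?addn0; last first.
  by move=> c /andP[h _]; rewrite ltnNge h.
have -> : (\sum_(0 <= c < nth 0 la j) (c < nth 0 la j) = \sum_(0 <= c < nth 0 la j) 1)%N.
  by apply: eq_big_nat => c /andP[_ ->].
by rewrite sum_nat_const_nat subn0 muln1.
Qed.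

Lemma bitab_colw t : colw (nth 0%N la) (bitab t).
Proof.
move=> j; rewrite scaler_nat -sum_colh; apply: derivation_eigen_prod;
  [exact: dcolD|exact: dcolM|by move=> c; apply: minor_dcol_diag].
Qed.

(** Leading monomials multiply, and that of the minor of column c is its diagonal: the exponent of
    x_(a, j) counts the letters a in row j. *)
Lemma bitab_lead (t : nat -> nat -> 'I_r) :
  (forall c p q, (p < q < colh la c)%N -> (t p c < t q c)%N) ->
  [/\ bitab t != 0, mleadc (bitab t) = 1 &
   forall a j, mlead (bitab t) (idx a j) =
     (\sum_(c < head 0 la) ((j < colh la c) && (t j c == a)))%N].
Proof.
move=> tinc; have tinc' (c : 'I_(head 0%N la)) : {homo (fun p : 'I_(colh la c) =>
  t p c) : p q / (p < q)%N}.
  by move=> p q pq; apply: tinc; rewrite pq ltn_ord.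
have m1 (c : 'I_(head 0%N la)) : mleadc (minor K (colh_le c) (fun p => t p c)) = 1.
  by have [h ->] := lead_minor K (colh_le c) (@tinc' c).
have m0 (c : 'I_(head 0%N la)) : minor K (colh_le c) (fun p => t p c) != 0.
  by rewrite -mleadc_eq0 m1 oner_neq0.
have b0 : bitab t != 0 by apply/prodf_neq0 => c _; exact: m0.
have bl : mlead (bitab t) = (\big[+%MM/0%MM]_(c < head 0%N la)
   mlead (minor K (colh_le c) (fun p => t p c)))%MM.
  by rewrite /bitab mlead_prod.
split=> //; first by rewrite bl mleadc_prod big1.
move=> a j; rewrite bl mnm_sumE; apply: eq_bigr => c _.
have [_ ->] := lead_minor K (colh_le c) (@tinc' c).
rewrite /mnm_minor mnm_sumE.
have [jc|cj] := ltnP j (colh la c); last first.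
  rewrite big1 // => p _; rewrite mnm1E idx_eq -[X in _ && X](inj_eq val_inj) /=.
  by rewrite andbC (_ : _ == _ = false) //; apply/eqP => e; have := ltn_ord p; rewrite e ltnNge cj.
rewrite (bigD1 (Ordinal jc)) //= mnm1E idx_eq -[X in _ && X](inj_eq val_inj) /= eqxx andbT.
rewrite big1 ?addn0 // => p; rewrite mnm1E idx_eq -(inj_eq val_inj) /= => pj.
by rewrite -[X in _ && X](inj_eq val_inj) /= (negbTE pj) andbF.
Qed.

(** The bitableau of the tableau with row p filled by the letter p; [a0] is a default value, as p <
    r inside the diagram. *)
Definition hw_vector (a0 : 'I_r) : poly := bitab (fun p _ => insubd a0 p).

Lemma hw_minorE (a0 : 'I_r) (c : 'I_(head 0%N la)) :
  minor K (colh_le c) (fun p => insubd a0 (p : nat)) =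
  minor K (colh_le c) (widen_ord (colh_le c)).
Proof.
rewrite /minor; congr (\det _); apply/matrixP => p q; rewrite !mxE.
congr ('X_(idx _ _)); apply: val_inj; rewrite val_insubd /=.
by rewrite (leq_trans (ltn_ord p) (colh_le c)).
Qed.

Lemma hw_vector_drow a0 a b : (a < b)%N -> drow a b (hw_vector a0) = 0.
Proof.
move=> ab; apply: derivation_prod0; [exact: drowD|exact: drowM|].
by move=> c; rewrite hw_minorE minor_drow.
Qed.

Lemma hw_vector_weight a0 a : drow a a (hw_vector a0) = hw_vector a0 *+ nth 0 la a.
Proof.
rewrite -sum_colh; apply: derivation_eigen_prod; [exact: drowD|exact: drowM|].
by move=> c; rewrite hw_minorE minor_drow_diag.
Qed.

Lemma hw_vector_lead a0 : [/\ hw_vector a0 != 0, mleadc (hw_vector a0) = 1 &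
  forall a j, mlead (hw_vector a0) (idx a j) = if a == j then nth 0 la j else 0%N].
Proof.
have [|h0 h1 hl] := @bitab_lead (fun p _ => insubd a0 p).
  move=> c p q /andP[pq qc]; rewrite !val_insubd (leq_trans qc (colh_le c)).
  by rewrite (leq_trans (ltn_trans pq qc) (colh_le c)).
split=> // a j; rewrite hl; have -> : insubd a0 (j : nat) = j.
  by apply: val_inj; rewrite val_insubd ltn_ord.
rewrite eq_sym; case: eqP => _; last by rewrite big1 // => c _; rewrite andbF.
by under eq_bigr do rewrite andbT; rewrite sum_colh.
Qed.

(** Required by [apolar_gt0], the apolar form being bilinear and not Hermitian. *)
Lemma hw_vector_real a0 m : (hw_vector a0)@_m \is Num.real.
Proof.
pose rp (p : poly) := forall m, p@_m \is Num.real.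
have rpM p q : rp p -> rp q -> rp (p * q).
  by move=> hp hq k; rewrite mcoeffM rpred_sum // => i _; apply: rpredM.
have rp1 : rp 1 by move=> k; rewrite mcoeff1 realn.
suff : rp (hw_vector a0) by apply.
rewrite /hw_vector /bitab; apply: (big_ind rp) => [||c _]; [exact: rp1|exact: rpM|].
rewrite /minor /determinant; apply: (big_ind rp) => [k|p q hp hq k|s _].
- by rewrite mcoeff0 rpred0.
- by rewrite mcoeffD rpredD.
- apply: (rpM); first by case: (odd_perm s) => k; rewrite ?expr0 ?expr1 ?mcoeffN ?rpredN
  mcoeff1 realn.
  apply: (big_ind rp) => [||p _ k]; [exact: rp1|exact: rpM|by rewrite mxE mcoeffX realn].
Qed.
End Bitableaux.

(** * The irreducible modules *)

Section ApolarForm.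
Variables (K : numFieldType) (n : nat).
Implicit Types (p q : {mpoly K[n]}) (m : 'X_{1..n}) (u v : 'I_n).

Definition mfactorial m : nat := (\prod_i (m i)`!)%N.

(* The monomials are orthogonal, and the multiplication by x_u is adjoint to
   the derivation with respect to x_u. *)
Definition apolar p q : K := \sum_(m <- msupp p) p@_m * q@_m * (mfactorial m)%:R.

Lemma mfactorialU m u : (mfactorial (m + U_(u)) = mfactorial m * (m u).+1)%N.
Proof.
rewrite /mfactorial (bigD1 u) //= [in RHS](bigD1 u) //= mnmDE mnm1E eqxx addn1.
rewrite factS -mulnA mulnC; congr (_ * _ * _)%N.
by apply: eq_bigr => i iu; rewrite mnmDE mnm1E eq_sym (negbTE iu) addn0.
Qed.

Lemma apolarE s p q : uniq s -> {subset msupp p <= s} ->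
  apolar p q = \sum_(m <- s) p@_m * q@_m * (mfactorial m)%:R.
Proof.
move=> us sub; rewrite (bigID (mem (msupp p))) /= [X in _ + X]big1 ?addr0 => [|m mp]; last first.
  by rewrite (memN_msupp_eq0 mp) !mul0r.
rewrite -big_filter; apply: perm_big; apply: uniq_perm; rewrite ?filter_uniq // => m.
by rewrite mem_filter; case: (boolP (m \in msupp p)) => // /sub ->.
Qed.

Lemma apolarC p q : apolar p q = apolar q p.
Proof.
pose s := undup (msupp p ++ msupp q).
rewrite !(@apolarE s) ?undup_uniq // => [|m|m]; last 2 first.
- by rewrite mem_undup mem_cat orbC => ->.
- by rewrite mem_undup mem_cat => ->.
by apply: eq_bigr => m _; rewrite [p@_m * _]mulrC.
Qed.

Lemma apolarDr p q1 q2 : apolar p (q1 + q2) = apolar p q1 + apolar p q2.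
Proof. by rewrite -big_split; apply: eq_bigr => m _; rewrite mcoeffD /=; ring. Qed.

Lemma apolarZr p x q : apolar p (x *: q) = x * apolar p q.
Proof. by rewrite mulr_sumr; apply: eq_bigr => m _; rewrite mcoeffZ; ring. Qed.

Lemma apolar0r p : apolar p 0 = 0.
Proof. by rewrite -(scale0r 0) apolarZr mul0r. Qed.

Lemma apolar_sumr p I (s : seq I) (P : pred I) (f : I -> {mpoly K[n]}) :
  apolar p (\sum_(i <- s | P i) f i) = \sum_(i <- s | P i) apolar p (f i).
Proof. exact: (big_morph (apolar p) (apolarDr p) (apolar0r p)). Qed.

Lemma apolarXl u p q : apolar ('X_u * p) q = apolar p q^`M(u).
Proof.
rewrite {1}/apolar mulrC (perm_big _ (msuppMX _ _)) big_map; apply: eq_bigr => m _.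
by rewrite mcoeffMX addmC mcoeff_deriv mfactorialU -mulr_natr natrM; ring.
Qed.

Lemma apolar_pol u v p q : apolar (pol u v p) q = apolar p (pol v u q).
Proof. by rewrite apolarXl apolarC -apolarXl apolarC. Qed.

(** For real coefficients the terms are squares times factorials. With complex ones the form has
    isotropic vectors, such as x_0 + i x_1. *)
Lemma apolar_gt0 p : p != 0 -> (forall m, p@_m \is Num.real) -> 0 < apolar p p.
Proof.
move=> p0 pr; rewrite /apolar (big_rem (mlead p)) /= ?mlead_supp //.
have tge0 m : 0 <= p@_m * p@_m * (mfactorial m)%:R.
  by rewrite mulr_ge0 ?ler0n // -expr2 real_exprn_even_ge0.
apply: ltr_wpDr; first by apply: sumr_ge0.
rewrite mulr_gt0 ?ltr0n ?prodn_gt0 // => [|i]; last exact: fact_gt0.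
by rewrite -expr2 real_exprn_even_gt0 //= mleadc_eq0.
Qed.
End ApolarForm.

Section Action.
Variables (K : numFieldType) (r : nat).
Local Notation poly := {mpoly K[(r * r)%N]}.
Implicit Types (a b c i j : 'I_r) (m : 'X_{1..(r * r)%N}) (p q : poly) (A B : 'M[K]_r).

Lemma apolar_drow a b p q : apolar (drow a b p) q = apolar p (drow b a q).
Proof.
rewrite apolarC /drow !apolar_sumr; apply: eq_bigr => j _.
by rewrite apolarC apolar_pol.
Qed.

Definition glact A p : poly := \sum_a \sum_b A a b *: drow a b p.

Lemma glactD A p q : glact A (p + q) = glact A p + glact A q.
Proof.
rewrite /glact -big_split; apply: eq_bigr => a _; rewrite -big_split.
by apply: eq_bigr => b _; rewrite drowD scalerDr.
Qed.

Lemma glactZ A x p : glact A (x *: p) = x *: glact A p.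
Proof.
rewrite /glact scaler_sumr; apply: eq_bigr => a _; rewrite scaler_sumr.
by apply: eq_bigr => b _; rewrite drowZ !scalerA mulrC.
Qed.

Lemma glact_sum A I (s : seq I) (P : pred I) (f : I -> poly) :
  glact A (\sum_(i <- s | P i) f i) = \sum_(i <- s | P i) glact A (f i).
Proof.
apply: (big_morph _ (glactD A)).
by have := glactZ A 0 0; rewrite !scale0r.
Qed.

Lemma glact_linear x A B p : glact (x *: A + B) p = x *: glact A p + glact B p.
Proof.
rewrite /glact scaler_sumr -big_split; apply: eq_bigr => a _.
rewrite scaler_sumr -big_split; apply: eq_bigr => b _.
by rewrite !mxE scalerDl scalerA.
Qed.

Lemma glact_delta a b p : glact (delta_mx a b) p = drow a b p.
Proof.
rewrite /glact (bigD1 a) //= (bigD1 b) //= mxE !eqxx scale1r.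
rewrite big1 => [|c cb]; last by rewrite mxE (negbTE cb) andbF scale0r.
rewrite addr0 big1 ?addr0 // => c ca; rewrite big1 // => d _.
by rewrite mxE (negbTE ca) scale0r.
Qed.

Lemma glact_bracket A B p :
  glact (A *m B - B *m A) p = glact A (glact B p) - glact B (glact A p).
Proof.
have comp A' B' : glact A' (glact B' p) = \sum_a \sum_b \sum_c \sum_d
    (A' a b * B' c d) *: drow a b (drow c d p).
  rewrite {1}/glact; apply: eq_bigr => a _; apply: eq_bigr => b _.
  rewrite drow_sum scaler_sumr; apply: eq_bigr => c _.
  rewrite drow_sum scaler_sumr; apply: eq_bigr => d _.
  by rewrite drowZ scalerA.
have swap4 (F : 'I_r -> 'I_r -> 'I_r -> 'I_r -> poly) :
    \sum_a \sum_b \sum_c \sum_d F a b c d = \sum_a \sum_b \sum_c \sum_d F c d a b.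
  rewrite pair_bigA [RHS]pair_bigA /=; under eq_bigr do rewrite pair_bigA.
  by under [RHS]eq_bigr do rewrite pair_bigA; rewrite exchange_big.
have mul A' B' : glact (A' *m B') p =
    \sum_a \sum_b \sum_c \sum_d (A' a b * B' c d) *: ((b == c)%:R *: drow a d p).
  apply: eq_bigr => a _.
  rewrite [RHS](eq_bigr (fun b => \sum_d (A' a b * B' b d) *: drow a d p)); last first.
    move=> b _; rewrite (bigD1 b) //= [X in _ + X]big1 ?addr0 => [|c cb]; last first.
      by rewrite big1 // => d _; rewrite eq_sym (negbTE cb) scale0r scaler0.
    by apply: eq_bigr => d _; rewrite eqxx scale1r.
  by rewrite exchange_big; apply: eq_bigr => d _; rewrite mxE scaler_suml.
have -> : A *m B - B *m A = (-1) *: (B *m A) + A *m B by rewrite scaleN1r addrC.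
rewrite glact_linear scaleN1r addrC !mul !comp.
(* Exchanging the pairs of indices in the terms with [B] on the left gives all four sums the same
   coefficients A a b * B c d, so that [drow_comm] applies termwise. *)
rewrite [X in _ - X]swap4 [X in _ = _ - X]swap4 -!sumrB; apply: eq_bigr => a _.
rewrite -!sumrB; apply: eq_bigr => b _; rewrite -!sumrB; apply: eq_bigr => c _.
rewrite -!sumrB; apply: eq_bigr => d _; rewrite [B _ _ * _]mulrC -!scalerBr.
by congr (_ *: _); rewrite drow_comm [RHS]addrC !addrA addNr add0r.
Qed.
End Action.

Section IrreducibleModule.
Variables (K : numFieldType) (r : nat) (a0 : 'I_r) (la : seq nat).
Local Notation poly := {mpoly K[(r * r)%N]}.
Implicit Types (a b c i j : 'I_r) (m : 'X_{1..(r * r)%N}) (p q h : poly).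
Hypotheses (la_sorted : sorted geq la) (la_size : (size la <= r)%N).

(** The space I of right highest weight vectors, cut out by the simple raising operators. *)
Definition colinv p := colw (nth 0%N la) p /\
  forall j j', j' = j.+1 :> nat -> dcol predT j j' p = 0.

Lemma colinvD p q : colinv p -> colinv q -> colinv (p + q).
Proof.
move=> [pw pk] [qw qk]; split=> [j|j j' jj']; first by rewrite dcolD pw qw scalerDr.
by rewrite dcolD pk // qk // addr0.
Qed.

Lemma colinvZ x p : colinv p -> colinv (x *: p).
Proof.
move=> [pw pk]; split=> [j|j j' jj']; first by rewrite dcolZ pw !scalerA mulrC.
by rewrite dcolZ pk // scaler0.
Qed.

Lemma colinv0 : colinv 0.
Proof. by split=> [j|j j' _]; rewrite dcol0 ?scaler0. Qed.

Lemma colinv_sum I (s : seq I) (P : pred I) (f : I -> poly) :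
  (forall x, P x -> colinv (f x)) -> colinv (\sum_(i <- s | P i) f i).
Proof. by move=> hf; apply: big_ind => //; [exact: colinv0|exact: colinvD]. Qed.

Lemma colinv_drow a b p : colinv p -> colinv (drow a b p).
Proof.
move=> [pw pk]; split=> [j|j j' jj']; rewrite -drow_dcol ?pw ?drowZ //.
by rewrite pk //; have := drowZ a b 0 (0 : poly); rewrite !scale0r.
Qed.

Lemma colinv_glact A p : colinv p -> colinv (glact A p).
Proof.
move=> hp; apply: colinv_sum => a _; apply: colinv_sum => b _.
by apply/colinvZ/colinv_drow.
Qed.

Lemma colinv_bitab t : colinv (bitab K la_size t).
Proof.
split=> [|j j' jj']; first exact: bitab_colw.
by apply: bitab_dcol => //; rewrite jj'.
Qed.

Lemma mnm_idxP m m' : (forall a j, m (idx a j) = m' (idx a j)) -> m = m'.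
Proof.
move=> h; apply/mnmP => x; have [g _ gK] := idx_bij r; by rewrite -(gK x) h.
Qed.

(** In a tableau, row j only has letters > j. By induction on j: the ballot condition bounds the
    exponents of a column by those of the previous column in earlier rows, which vanish. *)
Lemma lead_strict h a j : colinv h -> h != 0 -> (a < j)%N -> mlead h (idx a j) = 0%N.
Proof.
move=> [hw hk] h0; case: j => j jr /=; elim: j jr a => [//|j IH] jr a aj.
have jr' : (j < r)%N := ltnW jr.
have jj' : Ordinal jr = (Ordinal jr').+1 :> nat by [].
have := lead_ballot a hw h0 jj' (hk _ _ jj').
rewrite [X in (_ <= X)%N]big1 => [|b ba]; last by apply: IH; lia.
by rewrite leqn0 sum_nat_eq0 => /forallP/(_ a)/implyP/(_ (leqnn _))/eqP.
Qed.

Local Notation f := (hw_vector K la_size a0).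

(** The right conditions remove the exponents above the diagonal, the left ones those below it, and
    the column degrees fix the diagonal. *)
Lemma hw_lead h : colinv h -> h != 0 -> (forall a b, (a < b)%N -> drow a b h = 0) ->
  mlead h = mlead f.
Proof.
move=> hi h0 hE; have [hw _] := hi; have [f0 _ fl] := hw_vector_lead K la_sorted la_size a0.
apply: mnm_idxP => a j; rewrite fl; case: (ltngtP a j) => [aj|ja|/val_inj ->].
- rewrite lead_strict //; case: eqP => // e; move: aj; by rewrite e ltnn.
- rewrite (lead_row_killed hw) //; case: eqP => // e; move: ja; by rewrite e ltnn.
rewrite eqxx; have hl : h@_(mlead h) != 0 by rewrite mleadc_eq0.
rewrite -(colw_sum j hw hl) (bigD1 j) //= big1 ?addn0 // => b bj.
case: (ltngtP b j) => [aj|ja|/val_inj e]; last by rewrite e eqxx in bj.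
- exact: lead_strict.
- exact: (lead_row_killed hw).
Qed.

(** Subtract the multiple of [f] with the same leading coefficient: a non-zero difference would
    again have the leading monomial of [f], where its coefficient is 0. *)
Lemma hw_unique h : colinv h -> (forall a b, (a < b)%N -> drow a b h = 0) ->
  exists x, h = x *: f.
Proof.
move=> hi hE; have [->|h0] := eqVneq h 0; first by exists 0; rewrite scale0r.
have [f0 fc fl] := hw_vector_lead K la_sorted la_size a0.
exists (mleadc h); apply/eqP; rewrite -subr_eq0 -scaleNr; apply: contraT => d0.
have di : colinv (h + - mleadc h *: f) by apply/colinvD/colinvZ/colinv_bitab.
have /(hw_lead di d0) dl : forall a b, (a < b)%N -> drow a b (h + - mleadc h *: f) = 0.
  by move=> a b ab; rewrite drowD drowZ hE // hw_vector_drow // scaler0 addr0.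
move: d0; rewrite -mleadc_eq0 dl mcoeffD mcoeffZ fc mulr1.
by rewrite -(hw_lead hi h0 hE) addrN eqxx.
Qed.

(** A variable of row b is replaced by one of row a, which comes later in the order. This makes
    repeated raising terminate. *)
Lemma mlead_drow a b p : (a < b)%N -> drow a b p != 0 ->
  (mlead (drow a b p) < mlead p)%O.
Proof.
move=> ab d0; move: (d0); rewrite -mleadc_eq0; set m := mlead _.
rewrite /drow raddf_sum /= => /eqP s0.
have [j hj] : exists j, (pol (idx a j) (idx b j) p)@_m != 0.
  apply: contra_notP s0 => /forallNP hN; apply: big1 => j _.
  by apply/eqP; have := hN j; case: eqP.
have [m0|mu] := posnP (m (idx a j)); first by rewrite coef_pol0 ?eqxx in hj.
move: hj; rewrite {1}(mnm_subU mu) coef_pol mulrn_eq0 /= => hj.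
rewrite {1}(mnm_subU mu); apply: (@lt_le_trans _ _ (m - U_(idx a j) + U_(idx b j))%MM).
  rewrite ltmc_add2r; apply/ltmcP; first by rewrite !mdeg1.
  exists (idx b j) => [k kl|]; rewrite !mnm1E ?eqxx ?idx_eq.
    have [e|_] := eqVneq (idx a j) k.
      by move: kl; rewrite -e ltn_idx ltnNge (ltnW ab) /= => /andP[/eqP e' _];
        rewrite e' ltnn in ab.
    have [e|//] := eqVneq (idx b j) k; by rewrite e ltnn in kl.
  by have [e|//] := eqVneq a b; rewrite e ltnn in ab.
by apply: msupp_le_mlead; rewrite mcoeff_msupp.
Qed.

Variables (N : nat) (t : 'I_N -> nat -> nat -> 'I_r).
Local Notation B := (fun i : 'I_N => bitab K la_size (t i)).
Hypothesis t_inc : forall x (c k l : nat), (k < l < colh la c)%N -> (t x k c < t x l c)%N.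
Hypothesis t_inj : injective (fun x => mlead (B x)).
Hypothesis t_complete : forall h, colinv h -> h != 0 -> exists x, mlead h = mlead (B x).

(** I is transported to row vectors, because a module has to live on a [vectType] while I is only a
    predicate on polynomials. *)
Definition bvec (v : 'rV[K]_N) : poly := \sum_i v 0 i *: B i.

Lemma bvecD v w : bvec (v + w) = bvec v + bvec w.
Proof. by rewrite -big_split; apply: eq_bigr => i _; rewrite mxE scalerDl. Qed.

Lemma bvecZ x v : bvec (x *: v) = x *: bvec v.
Proof. by rewrite scaler_sumr; apply: eq_bigr => i _; rewrite mxE scalerA. Qed.

Lemma bvec_delta (i : 'I_N) : bvec (delta_mx 0 i) = B i.
Proof.
rewrite /bvec (bigD1 i) //= mxE !eqxx scale1r big1 ?addr0 // => k ki.
by rewrite mxE (negbTE ki) andbF scale0r.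
Qed.

Lemma colinv_bvec v : colinv (bvec v).
Proof. by apply: colinv_sum => i _; apply/colinvZ/colinv_bitab. Qed.

(** The largest leading monomial among the bitableaux that occur cannot cancel. *)
Lemma bvec_eq0 v : bvec v = 0 -> v = 0.
Proof.
move=> v0; apply/eqP; apply: contraT => vn0.
have [i0 hi0] : exists x, v 0 x != 0.
  by move/rV0Pn: vn0.
pose i := [arg max_(x > i0 | v 0 x != 0) mlead (B x)]%O.
have [vi imax] : v 0 i != 0 /\ forall x, v 0 x != 0 -> (mlead (B x) <= mlead (B i))%O.
  by rewrite /i; case: Order.TotalTheory.arg_maxP.
move: v0 => /(congr1 (mcoeff (mlead (B i)))); rewrite mcoeff0 raddf_sum /= (bigD1 i) //=.
have [_ bc _] := bitab_lead K la_size (@t_inc i).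
rewrite mcoeffZ bc mulr1 big1 ?addr0 => [e|k ki]; first by rewrite e eqxx in vi.
rewrite mcoeffZ; have [->|/imax] := eqVneq (v 0 k) 0; first by rewrite mul0r.
rewrite le_eqVlt (inj_eq t_inj) (negbTE ki) /= => /mcoeff_gt_mlead ->.
by rewrite mulr0.
Qed.

Lemma bvec_inj : injective bvec.
Proof.
move=> v w e; apply/eqP; rewrite -subr_eq0; apply/eqP/bvec_eq0.
by rewrite bvecD -scaleN1r bvecZ scaleN1r e subrr.
Qed.

(** Well-founded induction: subtracting the bitableau with the same leading term stays in I and
    lowers the leading monomial. *)
Lemma bvec_surj p : colinv p -> exists v, bvec v = p.
Proof.
move: {2}(mlead p) (erefl (mlead p)) => m; elim/(ltmwf (n := (r * r)%N)): m p.
move=> m IH p pm pi; have [->|p0] := eqVneq p 0.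
  by exists 0; rewrite -(scale0r (0 : 'rV_N)) bvecZ scale0r.
have [i hi] := t_complete pi p0.
have [_ bc _] := bitab_lead K la_size (@t_inc i).
pose q := p + - mleadc p *: B i.
have qi : colinv q by apply/colinvD/colinvZ/colinv_bitab.
have [q0|q0] := eqVneq q 0.
  exists (mleadc p *: delta_mx 0 i); rewrite bvecZ bvec_delta.
  by apply/eqP; rewrite eq_sym -subr_eq0 -scaleNr -/q q0.
have [w hw] : exists w, bvec w = q.
  apply: (IH (mlead q)) => //; rewrite lt_neqAle; apply/andP; split.
    apply/eqP => e; move: q0; rewrite -mleadc_eq0 e mcoeffD mcoeffZ -pm.
    by rewrite [in X in _ * X]hi bc mulr1 addrN eqxx.
  apply: le_trans (mleadD_le _ _) _; rewrite leUx pm lexx /= -pm hi.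
  exact: mleadZ_le.
exists (w + mleadc p *: delta_mx 0 i); rewrite bvecD hw bvecZ bvec_delta.
by rewrite /q scaleNr subrK.
Qed.

Definition bcoord p : 'rV[K]_N := xget 0 [set v | bvec v = p]%classic.

Lemma bcoordK p : colinv p -> bvec (bcoord p) = p.
Proof.
by move=> /bvec_surj hp; rewrite /bcoord; case: xgetP => [v _ //|h]; case: hp => v /h.
Qed.

Definition brho (A : 'M[K]_r) : 'End('rV[K]_N) :=
  linfun (mulmxr (\matrix_(x < N) bcoord (glact A (B x)))).

Lemma bvec_rho A v : bvec (brho A v) = glact A (bvec v).
Proof.
rewrite lfunE /= mulmx_sum_row [in RHS]/bvec glact_sum.
have bvec_sum I (s : seq I) (F : I -> 'rV_N) :
    bvec (\sum_(x <- s) F x) = \sum_(x <- s) bvec (F x).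
  apply: (big_morph bvec bvecD).
  by rewrite -(scale0r (0 : 'rV_N)) bvecZ scale0r.
rewrite bvec_sum; apply: eq_bigr => x _.
rewrite bvecZ glactZ rowK bcoordK //.
exact/colinv_glact/colinv_bitab.
Qed.

Lemma brho_module : is_sl_module brho.
Proof.
split=> [x A A' _ _|A A' _ _]; apply/lfunP => v; apply: bvec_inj.
  by rewrite bvec_rho glact_linear add_lfunE scale_lfunE bvecD bvecZ !bvec_rho.
rewrite bvec_rho glact_bracket add_lfunE opp_lfunE -[X in bvec (_ + X)]scaleN1r bvecD bvecZ
  !comp_lfunE !bvec_rho.
by rewrite scaleN1r.
Qed.

(** Raise [u] until every raising operator kills it, which happens because leading monomials
    decrease; the result is a multiple of [f] by uniqueness. *)
Lemma sub_hw (U : {vspace 'rV[K]_N}) u : u \in U -> u != 0 ->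
  (forall A : 'M[K]_r, \tr A = 0 -> (brho A @: U <= U)%VS) -> bcoord f \in U.
Proof.
move=> uU u0 hU; move: {2}(mlead (bvec u)) (erefl (mlead (bvec u))) => m.
elim/(ltmwf (n := (r * r)%N)): m u uU u0 => m IH u uU u0 um.
have [hE|] := pselect (forall a b, (a < b)%N -> drow a b (bvec u) = 0).
  have [x hx] := hw_unique (colinv_bvec u) hE.
  have fb : bvec (bcoord f) = f by apply/bcoordK/colinv_bitab.
  have ux : u = x *: bcoord f by apply: bvec_inj; rewrite bvecZ fb.
  have x0 : x != 0 by apply: contraNneq u0 => e; rewrite ux e scale0r.
  by rewrite -[bcoord f](scalerK x0) -ux memvZ.
move=> /existsNP[a /existsNP[b /not_implyP[ab /eqP d0]]].
have tr0 : \tr (delta_mx a b : 'M[K]_r) = 0.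
  by rewrite /mxtrace big1 // => c _; rewrite mxE; case: eqP => // ->; case: eqP => // e;
     move: ab; rewrite e ltnn.
have bw : bvec (brho (delta_mx a b) u) = drow a b (bvec u) by rewrite bvec_rho glact_delta.
apply: (IH (mlead (drow a b (bvec u))) _ (brho (delta_mx a b) u)).
- by rewrite -um mlead_drow.
- by apply: (subvP (hU _ tr0)); apply: memv_img.
- apply: contraNneq d0 => e; rewrite -bw e -(scale0r (0 : 'rV_N)) bvecZ scale0r //.
- by rewrite bw.
Qed.

Lemma apolar_glact A p q : apolar (glact A p) q = apolar p (glact A^T q).
Proof.
have E A' p' q' : apolar p' (glact A' q') = \sum_a \sum_b A' a b * apolar p' (drow a b q').
  rewrite /glact apolar_sumr; apply: eq_bigr => a _; rewrite apolar_sumr.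
  by apply: eq_bigr => b _; rewrite apolarZr.
rewrite apolarC !E exchange_big; apply: eq_bigr => b _; apply: eq_bigr => a _.
by rewrite mxE apolarC apolar_drow.
Qed.

Lemma brho_irreducible : is_irreducible brho.
Proof.
have f0 : f != 0 by case: (hw_vector_lead K la_sorted la_size a0).
have fb : bvec (bcoord f) = f by apply/bcoordK/colinv_bitab.
have b0 : bvec 0 = 0 by rewrite -(scale0r (0 : 'rV_N)) bvecZ scale0r.
have fn0 : bcoord f != 0 by apply: contraNneq f0 => e; rewrite -fb e b0.
split.
  by move=> h; move: (memvf (bcoord f)); rewrite h memv0 (negbTE fn0).
move=> U hU; have [->|U0] := eqVneq U 0%VS; [by left|right].
have [//|UF] := eqVneq U fullv.
have fU : bcoord f \in U.
  have [u uU un0] : exists2 u, u \in U & u != 0.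
    by exists (vpick U); [exact: memv_pick|rewrite vpick0].
  exact: sub_hw uU un0 hU.
(* The kernel [W] of this Gram matrix is the orthogonal of [U]. It is non-zero since \dim U < N, so
   that [f] lies in both [U] and [W], against (f, f) > 0. *)
pose M : 'M[K]_(N, \dim U) := \matrix_(x, k) apolar (B x) (bvec (vbasis U)`_k).
pose g : 'Hom('rV[K]_N, 'rV[K]_(\dim U)) := linfun (mulmxr M).
pose W := lker g.
have ME v k : (v *m M) 0 k = apolar (bvec v) (bvec (vbasis U)`_k).
  rewrite mxE apolarC apolar_sumr; apply: eq_bigr => x _.
  by rewrite mxE apolarZr apolarC.
have WP v : v \in W -> forall u, u \in U -> apolar (bvec v) (bvec u) = 0.
  rewrite memv_ker lfunE /= => /eqP vM u uU.
  rewrite (coord_vbasis uU).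
  have bvec_sum (F : 'I_(\dim U) -> 'rV_N) : bvec (\sum_k F k) = \sum_k bvec (F k).
    exact: (big_morph bvec bvecD b0).
  rewrite bvec_sum apolar_sumr big1 // => k _.
  by rewrite bvecZ apolarZr -ME vM mxE mulr0.
have PW v : (forall u, u \in U -> apolar (bvec v) (bvec u) = 0) -> v \in W.
  move=> h; rewrite memv_ker lfunE /=; apply/eqP/rowP => k; rewrite ME mxE h //.
  by apply: vbasis_mem; apply: mem_nth; rewrite size_tuple.
have W0 : W != 0%VS.
  apply/eqP => We; have := limg_ker_dim g fullv.
  rewrite capfv -/W We dimv0 add0n => e.
  have /dimvS : (limg g <= fullv)%VS
    by exact: subvf.
  rewrite e !dimvf => h; have h' : (1 * N <= 1 * \dim U)%N := h.
  move: UF; rewrite eqEdim subvf /= dimvf => /negP; apply.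
  by rewrite [X in (_ <= X)%N]mul1n in h'; exact: h'.
have fW : bcoord f \in W.
  have [u uW un0] : exists2 u, u \in W & u != 0.
    by exists (vpick W); [exact: memv_pick|rewrite vpick0].
  (* [W] is stable because the adjoint of [A] is its transpose, which has trace 0 as well. *)
  apply: (sub_hw uW un0) => A trA; apply/subvP => _ /memv_imgP[v vW ->].
  apply: PW => u' u'U; rewrite bvec_rho apolar_glact -bvec_rho; apply: (WP _ vW).
  by apply: (subvP (hU A^T _)); rewrite ?mxtrace_tr //; apply: memv_img.
have := apolar_gt0 f0 (hw_vector_real K la_size a0).
by rewrite -fb (WP _ fW _ fU) ltxx.
Qed.

Lemma brho_highest_weight (mu : weight r) :
  (forall j : 'I_r.-1, mu 0 j = (nth 0%N la j)%:Z - (nth 0%N la j.+1)%:Z) ->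
  has_highest_weight brho mu.
Proof.
move=> hmu; have fb : bvec (bcoord f) = f by apply/bcoordK/colinv_bitab.
have b0 : bvec 0 = 0 by rewrite -(scale0r (0 : 'rV_N)) bvecZ scale0r.
exists (bcoord f); split.
- apply/eqP => e; have [f0 _ _] := hw_vector_lead K la_sorted la_size a0.
  by move: f0; rewrite -fb e b0 eqxx.
- move=> a b ab; apply: bvec_inj; rewrite bvec_rho glact_delta fb b0.
  exact: hw_vector_drow.
move=> a b j aj bj; apply: bvec_inj; rewrite bvec_rho bvecZ fb.
rewrite -scaleN1r addrC glact_linear !glact_delta !hw_vector_weight // scaleN1r aj bj.
by rewrite hmu intrB scalerBl addrC -!scaler_nat.
Qed.

End IrreducibleModule.

(** * Uniqueness of the irreducible highest weight modules *)

(** Take a subspace of largest dimension among those contained in [P]: adjoining a further vector of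
    [P] would enlarge it. *)
Lemma closed_vspace (K : fieldType) (V : vectType K) (P : V -> Prop) :
  P 0 -> (forall a x y, P x -> P y -> P (a *: x + y)) ->
  exists U : {vspace V}, forall x, x \in U <-> P x.
Proof.
move=> P0 PL; pose Q n := `[< exists U : {vspace V}, (forall x, x \in U -> P x) /\ \dim U = n >].
have exQ : exists n, Q n.
  by exists 0%N; apply/asboolP; exists 0%VS; rewrite dimv0; split=> // x; rewrite memv0 => /eqP ->.
have ubQ n : Q n -> (n <= \dim (fullv : {vspace V}))%N.
  by move=> /asboolP[U [_ <-]]; apply/dimvS/subvf.
case: (ex_maxnP exQ ubQ) => n /asboolP[U [UP dU]] nmax.
exists U => x; split; first exact: UP.
move=> Px; have : Q (\dim (U + <[x]>)%VS).
  apply/asboolP; exists (U + <[x]>)%VS; split=> // y /memv_addP[u uU [w /vlineP[a ->] ->]].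
  by rewrite addrC; apply: PL => //; exact: UP.
move=> /nmax h; have : (U == U + <[x]>)%VS by rewrite eqEdim addvSl dU.
by move=> /eqP ->; apply: (subvP (addvSr _ _)); exact: memv_line.
Qed.

Section LinearFactors.
Variables (K : numFieldType) (W : vectType K) (h : 'End(W)) (c : K).
Implicit Types (s : seq nat) (x y : W).

(* The eigenvalues of h on a highest weight module will be the c - n, the
   highest weight being c: the factors with n > 0 kill the other weights. *)
Definition lfactors s x : W := foldr (fun n u => h u - (c - n%:R) *: u) x s.

Lemma lfactors_linear s a x y : lfactors s (a *: x + y) = a *: lfactors s x + lfactors s y.
Proof.
elim: s => [//|n s IH] /=; rewrite IH linearP /= scalerDr opprD.
by rewrite scalerA [(c - _) * a]mulrC -scalerA addrACA scalerBr.
Qed.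

Lemma lfactors0 s : lfactors s 0 = 0.
Proof.
have := lfactors_linear s (-1) 0 0.
by rewrite scaleN1r addNr scaleN1r addNr.
Qed.

Lemma lfactorsZ s a x : lfactors s (a *: x) = a *: lfactors s x.
Proof. by rewrite -[a *: x]addr0 lfactors_linear lfactors0 addr0. Qed.

Lemma lfactors_cat s1 s2 x : lfactors (s1 ++ s2) x = lfactors s1 (lfactors s2 x).
Proof. exact: foldr_cat. Qed.

Lemma lfactors_comm s1 s2 x : lfactors s1 (lfactors s2 x) = lfactors s2 (lfactors s1 x).
Proof.
have comm1 n s u : lfactors s (h u - (c - n%:R) *: u) =
    h (lfactors s u) - (c - n%:R) *: lfactors s u.
  elim: s => [//|k s IH] /=; rewrite IH !linearB /= !linearZ /=.
  by rewrite !opprK !scalerA [(c - n%:R) * _]mulrC addrACA.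
by elim: s1 => [//|n s IH] /=; rewrite IH comm1.
Qed.

Lemma lfactors_eigen s x : h x = c *: x -> lfactors s x = (\prod_(n <- s) n%:R) *: x.
Proof.
move=> hx; elim: s => [|n s IH] /=; first by rewrite big_nil scale1r.
rewrite IH linearZ /= hx big_cons !scalerA -scalerBl; congr (_ *: _); ring.
Qed.

(** As [e] lowers the eigenvalues of [h] by d, factors shifted by d pass through it and turn [e x]
    into [a *: e y], of eigenvalue c - d, which the additional factor kills. *)
Lemma lfactors_lower (e : 'End(W)) d s x a y :
  (forall u, h (e u) = e (h u) - d%:R *: e u) -> h y = c *: y ->
  lfactors s x = a *: y -> lfactors (d :: map (addn d) s) (e x) = 0.
Proof.
move=> he hy hs.
have eZ b u : e (b *: u) = b *: e u by rewrite linearZ.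
have hZ b u : h (b *: u) = b *: h u by rewrite linearZ.
have -> : lfactors (d :: map (addn d) s) (e x) =
    let u := lfactors (map (addn d) s) (e x) in h u - (c - d%:R) *: u by [].
have -> : lfactors (map (addn d) s) (e x) = e (lfactors s x).
  elim: s {hs} => [//|n s IH] /=; rewrite IH he [e (_ - _)]linearB /= eZ natrD.
  by rewrite -addrA -opprD -scalerDl; congr (_ - _ *: _); ring.
rewrite hs /= he eZ hZ hy eZ eZ !scalerA -!scalerBl.
by rewrite [X in X *: _](_ : _ = 0) ?scale0r //; ring.
Qed.
End LinearFactors.

Section HighestWeightModules.
Variables (K : numFieldType) (r : nat) (mu : weight r) (V V' : vectType K)
  (rho : 'M[K]_r -> 'End(V)) (rho' : 'M[K]_r -> 'End(V')).
Hypotheses (rhoM : is_sl_module rho) (rhoM' : is_sl_module rho').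
Variables (v : V) (v' : V').
Hypotheses (v0 : v != 0) (v0' : v' != 0).
Hypotheses
  (v_raise : forall a b : 'I_r, (a < b)%N -> rho (delta_mx a b) v = 0)
  (v_raise' : forall a b : 'I_r, (a < b)%N -> rho' (delta_mx a b) v' = 0)
  (v_wt : forall (a b : 'I_r) (j : 'I_r.-1), a = j :> nat -> b = j.+1 :> nat ->
       rho (delta_mx a a - delta_mx b b) v = (mu 0 j)%:~R *: v)
  (v_wt' : forall (a b : 'I_r) (j : 'I_r.-1), a = j :> nat -> b = j.+1 :> nat ->
       rho' (delta_mx a a - delta_mx b b) v' = (mu 0 j)%:~R *: v').

(* The submodule of V * V' generated by (v, v'), to be shown to be the graph of
   an isomorphism. *)
Inductive hw_gen : V -> V' -> Prop :=
| hw_gen_vector : hw_gen v v'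
| hw_gen_linear a x x' y y' :
    hw_gen x x' -> hw_gen y y' -> hw_gen (a *: x + y) (a *: x' + y')
| hw_gen_lower (a b : 'I_r) x x' : (a < b)%N ->
    hw_gen x x' -> hw_gen (rho (delta_mx b a) x) (rho' (delta_mx b a) x').

Lemma hw_gen0 : hw_gen 0 0.
Proof.
have := hw_gen_linear (-1) hw_gen_vector hw_gen_vector.
by rewrite !scaleN1r !addNr.
Qed.

Lemma mxtrace_delta (a b : 'I_r) : \tr (delta_mx a b : 'M[K]_r) = (a == b)%:R.
Proof.
rewrite /mxtrace (bigD1 a) //= mxE eqxx big1 ?addr0 // => c ca.
by rewrite mxE (negbTE ca).
Qed.

Let eig (A : 'M[K]_r) :=
  \tr A = 0 /\ exists x, rho A v = x *: v /\ rho' A v' = x *: v'.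

Let eig_linear a A B : eig A -> eig B -> eig (a *: A + B).
Proof.
move=> [tA [x [hx hx']]] [tB [y [hy hy']]]; split.
  by rewrite linearP /= tA tB mulr0 addr0.
exists (a * x + y); rewrite (proj1 rhoM) // (proj1 rhoM') //.
by rewrite !add_lfunE !scale_lfunE hx hx' hy hy' !scalerDl !scalerA.
Qed.

Let rho0 : rho 0 = 0 /\ rho' 0 = 0.
Proof.
have h := proj1 rhoM (-1) 0 0; have h' := proj1 rhoM' (-1) 0 0.
by move: h h'; rewrite mxtrace0 !scaleN1r !addNr => h h'; rewrite h // h'.
Qed.

Let eig0 : eig 0.
Proof.
have [h h'] := rho0.
by split; rewrite ?mxtrace0 //; exists 0; rewrite h h' !zero_lfunE !scale0r.
Qed.

Let eig_sum I (s : seq I) (F : I -> 'M[K]_r) : (forall i, eig (F i)) -> eig (\sum_(i <- s) F i).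
Proof.
move=> h; elim: s => [|i s IH]; first by rewrite big_nil.
by rewrite big_cons -[F i]scale1r; apply: eig_linear.
Qed.

(** A sum of differences of consecutive diagonal units, on which the common highest weight
    prescribes the scalar. *)
Let eig_diff (a b : 'I_r) : eig (delta_mx a a - delta_mx b b).
Proof.
wlog ab : a b / (a <= b)%N.
  move=> h; case: (leqP a b) => [|/ltnW] /h // e.
  rewrite -[X in eig X]addr0 -[delta_mx _ _ - _]opprB -scaleN1r; exact: eig_linear.
case: b ab => b; elim: b => [|b IH] br ab.
  have -> : a = Ordinal br by apply: val_inj; move: ab => /=; case: (nat_of_ord a).
  by rewrite subrr.
move: ab; rewrite leq_eqVlt => /orP[/eqP e|].
  have -> : a = Ordinal br by apply: val_inj.
  by rewrite subrr.
rewrite ltnS /= => ab; have br' : (b < r)%N := ltnW br.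
have bj : (b < r.-1)%N by rewrite -ltnS prednK //; case: (r) br.
have := IH br' ab => e.
have -> : delta_mx a a - delta_mx (Ordinal br) (Ordinal br) = 1 *:
    (delta_mx a a - delta_mx (Ordinal br') (Ordinal br')) +
    (delta_mx (Ordinal br') (Ordinal br') - delta_mx (Ordinal br) (Ordinal br)) :> 'M[K]_r.
  by rewrite scale1r addrA subrK.
apply: eig_linear => //; split; first by rewrite linearB /= !mxtrace_delta !eqxx subrr.
by exists (mu 0 (Ordinal bj))%:~R; rewrite (v_wt (j := Ordinal bj)) // (v_wt' (j := Ordinal bj)).
Qed.

Let eig_diag (d : 'rV[K]_r) : \sum_a d 0 a = 0 -> eig (diag_mx d).
Proof.
move=> d0; case: (posnP r) => [r0|rp].
  have -> : diag_mx d = 0 by apply/matrixP => i; have := ltn_ord i; rewrite [X in (_ < X)%N]r0.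
  exact: eig0.
pose o := Ordinal rp.
have -> : diag_mx d = \sum_a d 0 a *: (delta_mx a a - delta_mx o o).
  rewrite -[LHS]subr0; under [RHS]eq_bigr do rewrite scalerBr.
  rewrite sumrB -scaler_suml d0 scale0r !subr0.
  exact: diag_mx_sum_delta.
apply: eig_sum => a; rewrite -[X in eig X]addr0; apply: eig_linear => //.
Qed.

Let hw_gen_vector_stable A : \tr A = 0 -> hw_gen (rho A v) (rho' A v').
Proof.
move=> tA; pose good (B : 'M[K]_r) := \tr B = 0 /\ hw_gen (rho B v) (rho' B v').
have goodL a B C : good B -> good C -> good (a *: B + C).
  move=> [tB hB] [tC hC]; split; first by rewrite linearP /= tB tC mulr0 addr0.
  rewrite (proj1 rhoM) // (proj1 rhoM') // !add_lfunE !scale_lfunE.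
  exact: hw_gen_linear.
have goodE B : eig B -> good B.
  move=> [tB [x [hx hx']]]; split=> //; rewrite hx hx'.
  by have := hw_gen_linear x hw_gen_vector hw_gen0; rewrite !addr0.
have goodS I (s : seq I) (P : pred I) (F : I -> 'M[K]_r) :
    (forall i, P i -> good (F i)) -> good (\sum_(i <- s | P i) F i).
  move=> h; apply: big_ind => //; first exact: goodE eig0.
  by move=> B C hB hC; rewrite -[B]scale1r; apply: goodL.
have goodD a b : a != b -> good (delta_mx a b).
  move=> ab; split; first by rewrite mxtrace_delta (negbTE ab).
  case: (ltngtP a b) => [lab|lba|/val_inj e]; last by rewrite e eqxx in ab.
    by rewrite v_raise // v_raise' //; exact: hw_gen0.
  by apply: hw_gen_lower => //; exact: hw_gen_vector.
have AE : A = 1 *: diag_mx (\row_a A a a) + \sum_a \sum_(b | a != b) A a b *: delta_mx a b.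
  rewrite scale1r diag_mx_sum_delta {1}[A]matrix_sum_delta -big_split.
  apply: eq_bigr => a _; rewrite (bigD1 a) //= mxE; congr (_ + _).
  by apply: eq_bigl => b; rewrite eq_sym.
suff [] : good A by [].
rewrite AE; apply: (goodL).
  by apply: goodE; apply: eig_diag; apply: etrans tA; apply: eq_bigr => a _; rewrite mxE.
apply: (goodS) => a _; apply: (goodS) => b ab; rewrite -[X in good X]addr0.
by apply: (goodL); [exact: goodD|exact: goodE eig0].
Qed.

(** Only lowering operators generate [hw_gen], as the eigenvalue argument below requires. Stability
    follows from A E x = [A, E] x + E A x, where the bracket has trace 0 and the induction
    hypothesis holds for all matrices of trace 0. *)
Lemma hw_gen_stable A x x' : \tr A = 0 -> hw_gen x x' -> hw_gen (rho A x) (rho' A x').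
Proof.
move=> tA g; elim: g A tA => {x x'} [A tA|a x x' y y' _ IHx _ IHy A tA|a b x x' ab g IH A tA].
- exact: hw_gen_vector_stable.
- by rewrite !linearP; apply: hw_gen_linear; [exact: IHx|exact: IHy].
have tE : \tr (delta_mx b a : 'M[K]_r) = 0.
  by rewrite mxtrace_delta; case: eqP => // e; move: ab; rewrite e ltnn.
have tB : \tr (A *m delta_mx b a - delta_mx b a *m A) = 0.
  by rewrite linearB /= mxtrace_mulC subrr.
have e := congr1 (fun h : 'End(V) => h x) (proj2 rhoM _ _ tA tE).
have e' := congr1 (fun h : 'End(V') => h x') (proj2 rhoM' _ _ tA tE).
move: e e'; rewrite /= !add_lfunE !opp_lfunE !comp_lfunE => /eqP e /eqP e'.
rewrite -[rho A _](_ : 1 *: rho (A *m delta_mx b a - delta_mx b a *m A) x +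
  rho (delta_mx b a) (rho A x) = _); last by rewrite scale1r (eqP e) subrK.
rewrite -[rho' A _](_ : 1 *: rho' (A *m delta_mx b a - delta_mx b a *m A) x' +
  rho' (delta_mx b a) (rho' A x') = _); last by rewrite scale1r (eqP e') subrK.
by apply: hw_gen_linear; [exact: IH|apply: hw_gen_lower => //; exact: IH].
Qed.

(** The sum of the positive coroots, diag(r - 1, r - 3, ..., 1 - r): every lowering operator
    strictly decreases its eigenvalues. *)
Let height : 'M[K]_r := diag_mx (\row_a ((r.-1)%:R - (2 * a)%:R)).

Let height_tr : \sum_a (\row_a ((r.-1)%:R - (2 * a)%:R) : 'rV[K]_r) 0 a = 0.
Proof.
set S := \sum_a _; have SN : S = - S.
  rewrite /S -sumrN (reindex_inj rev_ord_inj); apply: eq_bigr => a _; rewrite !mxE /= opprB.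
  apply/eqP; rewrite subr_eq addrAC eq_sym subr_eq -!natrD eqr_nat; apply/eqP.
  by have := ltn_ord a; lia.
have : S *+ 2 == 0 by rewrite mulr2n {1}SN addNr.
by rewrite mulrn_eq0 => /eqP.
Qed.

Let height_tr0 : \tr height = 0.
Proof. by rewrite mxtrace_diag height_tr. Qed.

Let height_lower (a b : 'I_r) : (a < b)%N ->
  height *m delta_mx b a - delta_mx b a *m height =
  (- (2 * (b - a))%:R) *: delta_mx b a.
Proof.
move=> ab; apply/matrixP => i j; rewrite mul_diag_mx mul_mx_diag !mxE.
have [->|_] := eqVneq i b; last by rewrite !(mulr0, mul0r) subrr.
have [->|_] := eqVneq j a; last by rewrite !(mulr0, mul0r) subrr.
have -> : (2 * (b - a))%:R = (2 * b)%:R - (2 * a)%:R :> K.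
  by rewrite mulnBr natrB // leq_mul2l ltnW.
by rewrite !mulr1n; ring.
Qed.

(** The same factors bring both components back to the highest weight lines, with the same scalar a;
    this links the two coordinates of a pair. *)
Let hw_gen_lfactors c x x' :
  rho height v = c *: v -> rho' height v' = c *: v' -> hw_gen x x' ->
  exists s a, [/\ all (fun n => 0 < n)%N s, lfactors (rho height) c s x = a *: v
    & lfactors (rho' height) c s x' = a *: v'].
Proof.
move=> hc hc'; elim=> {x x' }[|a x x' y y' _ [s [u [sp hs hs']]] _ [t [w [tp ht ht']]]|].
- by exists [::], 1; rewrite !scale1r.
- exists (s ++ t), (a * ((\prod_(n <- t) n%:R) * u) + (\prod_(n <- s) n%:R) * w).
  rewrite all_cat sp tp !lfactors_linear !lfactors_cat ht ht' !(lfactors_comm _ _ s t) hs hs'.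
  rewrite !lfactorsZ !(lfactors_eigen _ hc) !(lfactors_eigen _ hc') !scalerA -!scalerDl.
  by split=> //; congr (_ *: _); ring.
move=> a b x x' ab _ [s [u [sp hs hs']]].
have tE : \tr (delta_mx b a : 'M[K]_r) = 0.
  by rewrite mxtrace_delta; case: eqP => // e; move: ab; rewrite e ltnn.
set d := (2 * (b - a))%N; have d0 : (0 < d)%N by rewrite /d; lia.
exists (d :: map (addn d) s), 0; split.
- by rewrite /= d0; apply/allP => _ /mapP[n _ ->]; rewrite ltn_addr.
- rewrite scale0r; apply: lfactors_lower hc hs => y.
  have := congr1 (fun h : 'End(V) => h y) (proj2 rhoM _ _ height_tr0 tE).
  rewrite /= height_lower // -[X in rho X]addr0 (proj1 rhoM) ?mxtrace0 //.
  rewrite !add_lfunE opp_lfunE scale_lfunE !comp_lfunE -/d scaleNr.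
  have -> : rho 0 = 0 by case: rho0.
  by rewrite zero_lfunE addr0 => e; rewrite e addrC subrK.
- rewrite scale0r; apply: lfactors_lower hc' hs' => y.
  have := congr1 (fun h : 'End(V') => h y) (proj2 rhoM' _ _ height_tr0 tE).
  rewrite /= height_lower // -[X in rho' X]addr0 (proj1 rhoM') ?mxtrace0 //.
  rewrite !add_lfunE opp_lfunE scale_lfunE !comp_lfunE -/d scaleNr.
  have -> : rho' 0 = 0 by case: rho0.
  by rewrite zero_lfunE addr0 => e; rewrite e addrC subrK.
Qed.

(** The y with (0, y) in the graph form a submodule. Were it everything, it would contain v'; the
    factors for (0, v') give a = 0 on the first component and a non-zero product of positive
    integers on the second. *)
Lemma hw_gen_0l x' : is_irreducible rho' -> hw_gen 0 x' -> x' = 0.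
Proof.
move=> [_ irr] gx.
have [U UP] : exists U : {vspace V'}, forall y, y \in U <-> hw_gen 0 y.
  apply: closed_vspace; first exact: hw_gen0.
  by move=> a y z hy hz; have := hw_gen_linear a hy hz; rewrite scaler0 addr0.
have [|U0|UF] := irr U.
- move=> A tA; apply/subvP => _ /memv_imgP[y /UP yU ->]; apply/UP.
  by have := hw_gen_stable tA yU; rewrite linear0.
- by move/UP: gx; rewrite U0 memv0 => /eqP.
have /UP : v' \in U by rewrite UF memvf.
have [_ [c [hc hc']]] : eig height := eig_diag height_tr.
move=> /(hw_gen_lfactors hc hc')[s [a [sp]]].
rewrite lfactors0 => /esym/eqP; rewrite scaler_eq0 (negbTE v0) orbF => /eqP ->.
rewrite (lfactors_eigen _ hc') scale0r => /eqP; rewrite scaler_eq0 (negbTE v0') orbF.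
rewrite prodf_seq_eq0 => /hasP[n ns /=]; rewrite pnatr_eq0 => /eqP n0.
by move/allP: sp => /(_ _ ns); rewrite n0.
Qed.

Lemma hw_gen_total x : is_irreducible rho -> exists x', hw_gen x x'.
Proof.
move=> [_ irr].
have [U UP] : exists U : {vspace V}, forall y, y \in U <-> exists x', hw_gen y x'.
  apply: closed_vspace; first by exists 0; exact: hw_gen0.
  by move=> a y z [y' hy] [z' hz]; exists (a *: y' + z'); exact: hw_gen_linear.
have [|U0|UF] := irr U.
- move=> A tA; apply/subvP => _ /memv_imgP[y /UP[y' yU] ->]; apply/UP.
  by exists (rho' A y'); exact: hw_gen_stable.
- have /UP : exists x', hw_gen v x' by exists v'; exact: hw_gen_vector.
  by rewrite U0 memv0 (negbTE v0).
by apply/UP; rewrite UF memvf.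
Qed.
End HighestWeightModules.

Lemma hw_gen_sym (K : numFieldType) (r : nat) (V V' : vectType K)
    (rho : 'M[K]_r -> 'End(V)) (rho' : 'M[K]_r -> 'End(V')) v v' x x' :
  hw_gen rho rho' v v' x x' -> hw_gen rho' rho v' v x' x.
Proof. by elim=> *; [exact: hw_gen_vector|exact: hw_gen_linear|exact: hw_gen_lower]. Qed.

Lemma hw_dim_le (K : numFieldType) (r : nat) (mu : weight r) (V V' : vectType K)
    (rho : 'M[K]_r -> 'End(V)) (rho' : 'M[K]_r -> 'End(V')) :
  is_sl_module rho -> is_irreducible rho -> has_highest_weight rho mu ->
  is_sl_module rho' -> is_irreducible rho' -> has_highest_weight rho' mu ->
  (\dim (fullv : {vspace V}) <= \dim (fullv : {vspace V'}))%N.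
Proof.
move=> M irr [v [v0 vr vw]] M' irr' [v' [v0' vr' vw']].
have tot x : exists x', hw_gen rho rho' v v' x x'.
  exact: (hw_gen_total M M' v0 vr vr' vw vw' x irr).
have inj_l x' : hw_gen rho rho' v v' 0 x' -> x' = 0.
  exact: (hw_gen_0l M M' v0 v0' vr vr' vw vw' irr').
have inj_r x : hw_gen rho rho' v v' x 0 -> x = 0.
  by move/hw_gen_sym; exact: (hw_gen_0l M' M v0' v0 vr' vr vw' vw irr).
have [g hg] := choice tot.
have gL : linear g.
  move=> a x y; apply/eqP; rewrite -subr_eq0; apply/eqP/inj_l.
  have := hw_gen_linear (-1) (hw_gen_linear a (hg x) (hg y)) (hg (a *: x + y)).
  by rewrite !scaleN1r addNr [X in hw_gen _ _ _ _ _ X]addrC.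
pose gl : {linear V -> V'} := HB.pack g (GRing.isLinear.Build _ _ _ _ g gL).
have ker0 : lker (linfun gl) == 0%VS.
  apply/lker0P => x y; rewrite !lfunE /= => e.
  apply/eqP; rewrite -subr_eq0; apply/eqP/inj_r.
  have := hw_gen_linear (-1) (hg y) (hg x).
  by rewrite !scaleN1r e addNr [X in hw_gen _ _ _ _ X _]addrC.
by rewrite -(limg_dim_eq (f := linfun gl) (U := fullv)) ?(eqP ker0) ?capv0 // dimvS // subvf.
Qed.

(** * Tableaux and the dimension of the irreducible modules *)

Definition psum (m : nat -> nat -> nat) (j k : nat) : nat := (\sum_(a < k) m j a)%N.

(* The array m stands for the tableau whose row j contains m j a times the
   letter a + 1. *)
Definition pattern (L : nat) (la : seq nat) (m : nat -> nat -> nat) : Prop :=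
  [/\ forall j, psum m j L = nth 0%N la j,
      forall j a, (L <= a)%N -> m j a = 0%N
    & forall j k, (psum m j.+1 k.+1 <= psum m j k)%N].

Definition tableau_counts (T : seq (seq nat)) (j a : nat) : nat :=
  count_mem a.+1 (nth [::] T j).

Definition counts_tableau (L : nat) (la : seq nat) (m : nat -> nat -> nat) : seq (seq nat) :=
  mkseq (fun j => flatten (mkseq (fun a => nseq (m j a) a.+1) L)) (size la).

Lemma sorted_nth_le_count s i k : sorted leq s -> (i < size s)%N ->
  (nth 0 s i <= k)%N = (i < count (fun x => x <= k)%N s)%N.
Proof.
elim: s i => [//|x s IH] i /= sx; have ss := path_sorted sx.
move: sx; rewrite (path_sortedE leq_trans) => /andP[/allP xs _].
have [xk|kx] := leqP x k; last first.
  have -> : count (fun x => x <= k)%N s = 0%N.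
    apply/eqP; rewrite -leqn0 leqNgt -has_count; apply/hasPn => y /xs xy.
    by rewrite -ltnNge (leq_trans kx).
  case: i => [|i] hi; first by rewrite leqNgt kx.
  by rewrite ltn0 /= leqNgt (leq_trans kx) // xs // mem_nth.
by case: i => [|i] hi; rewrite ?xk //= IH.
Qed.

Lemma psum_tableau_counts T j k : (0%N \notin nth [::] T j) ->
  psum (tableau_counts T) j k = count (fun x => x <= k)%N (nth [::] T j).
Proof.
rewrite /psum /tableau_counts; move: (nth [::] T j) => s s0.
transitivity (count (fun x => 0 < x <= k)%N s).
  elim: k => [|k IH]; first by rewrite big_ord0; elim: s {s0} => //= x s <-; lia.
  rewrite big_ord_recr /= IH; elim: s {s0 IH} => //= x s IHs.
  by rewrite addnACA IHs; congr (_ + _)%N; lia.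
apply: eq_in_count => x xs; case: x xs => [|//] h.
by rewrite h in s0.
Qed.

Section Tableaux.
Variables (la : seq nat) (L : nat).
Hypothesis la_sorted : sorted geq la.

Lemma size_row (T : seq (seq nat)) j : shape T = la -> size (nth [::] T j) = nth 0%N la j.
Proof.
move=> <-; have [jT|Tj] := ltnP j (size T); first by rewrite (nth_map [::]).
by rewrite !nth_default // size_map.
Qed.

Lemma nth_la_le j : (nth 0 la j.+1 <= nth 0 la j)%N.
Proof.
have [jl|lj] := ltnP j.+1 (size la); last by rewrite nth_default.
by move/(sortedP 0%N): la_sorted => /(_ j jl).
Qed.

Lemma row_notin0 T j : 0%N \notin flatten T -> 0%N \notin nth [::] T j.
Proof.
have [jT|Tj] := ltnP j (size T); last by rewrite nth_default.
by apply: contra => h; apply/flattenP; exists (nth [::] T j) => //; exact: mem_nth.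
Qed.

Lemma row_all (P : pred nat) T j : all P (flatten T) -> all P (nth [::] T j).
Proof.
have [jT|Tj] := ltnP j (size T); last by rewrite nth_default.
move=> /allP h; apply/allP => x xT; apply: h; apply/flattenP.
by exists (nth [::] T j) => //; exact: mem_nth.
Qed.

Lemma row_sorted T j : all (sorted leq) T -> sorted leq (nth [::] T j).
Proof.
have [jT|Tj] := ltnP j (size T); last by rewrite nth_default.
by move=> /allP; apply; exact: mem_nth.
Qed.

Lemma ssyt_pattern T : is_ssyt la T -> all (fun k => k <= L)%N (flatten T) ->
  pattern L la (tableau_counts T).
Proof.
move=> [sh T0 Ts Tc] TL; have T0j j := row_notin0 j T0; split.
- move=> j; rewrite psum_tableau_counts // -(size_row j sh); apply/eqP.
  by rewrite -all_count; exact: row_all.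
- move=> j a La; apply/count_memPn/negP => h.
  by have /allP/(_ _ h) := row_all j TL; rewrite leqNgt ltnS La.
move=> j k; rewrite !psum_tableau_counts //; set s := nth [::] T j; set s' := nth [::] T j.+1.
(* If row j + 1 had more than i letters <= k + 1, its entry in column i would be <= k + 1, hence the
   entry above it <= k; but row j has only i such entries, in the columns < i. *)
rewrite leqNgt; apply/negP => hlt; set i := count _ s in hlt.
have i' : (i < size s')%N by apply: leq_trans hlt (count_size _ _).
have ii : (i < size s)%N by apply: leq_trans i' _; rewrite !size_row // nth_la_le.
have h1 := Tc j i i'.
move: hlt; rewrite -sorted_nth_le_count //; last exact: row_sorted.
move=> h2; have : (nth 0 s i <= k)%N by rewrite -ltnS (leq_trans h1).
by rewrite sorted_nth_le_count ?ltnn //; exact: row_sorted.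
Qed.

Lemma ssyt_counts_inj T T' : is_ssyt la T -> is_ssyt la T' ->
  (forall j a, tableau_counts T j a = tableau_counts T' j a) -> T = T'.
Proof.
move=> [sh T0 Ts _] [sh' T0' Ts' _] e.
have sz : size T = size T' by have := congr1 size (etrans sh (esym sh')); rewrite !size_map.
apply: (eq_from_nth (x0 := [::])) => // j jT.
apply: (sorted_eq leq_trans anti_leq); [exact: row_sorted|exact: row_sorted|].
apply/allP => x _ /=; apply/eqP; case: x => [|a]; last exact: e.
by rewrite !(count_memPn _) // row_notin0.
Qed.

Variable m : nat -> nat -> nat.
Hypothesis mP : pattern L la m.

Let row j := flatten (mkseq (fun a => nseq (m j a) a.+1) L).

Let count_row (P : pred nat) j : count P (row j) = (\sum_(a < L) m j a * P a.+1)%N.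
Proof.
rewrite /row; elim: (L) => [|k IH]; first by rewrite big_ord0.
rewrite mkseqS flatten_rcons count_cat IH count_nseq big_ord_recr /=.
by rewrite mulnC.
Qed.

Let nth_counts_tableau j : nth [::] (counts_tableau L la m) j = row j.
Proof.
have [jl|lj] := ltnP j (size la); first by rewrite nth_mkseq.
rewrite nth_default ?size_mkseq //; apply/esym/nilP; rewrite /nilp.
rewrite -[size _](count_predT) count_row; have [h _ _] := mP.
by move: (h j); rewrite nth_default // /psum; under eq_bigr do rewrite -[m _ _]muln1; move=> ->.
Qed.

Lemma counts_tableauK j a : tableau_counts (counts_tableau L la m) j a = m j a.
Proof.
rewrite /tableau_counts nth_counts_tableau count_row; have [_ h _] := mP.
have [aL|La] := ltnP a L; last first.
  by rewrite h // big1 // => b _ /=; rewrite eqSS (ltn_eqF (leq_trans (ltn_ord b) La)) muln0.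
rewrite (bigD1 (Ordinal aL)) //= eqxx muln1 big1 ?addn0 // => b ba.
by rewrite eqSS -[_ == _]/(b == a :> nat); move: ba;
  rewrite -(inj_eq val_inj) /= => /negbTE ->; rewrite muln0.
Qed.

Lemma counts_tableau_letters : all (fun k => k <= L)%N (flatten (counts_tableau L la m)).
Proof.
apply/allP => x /flattenP[_ /mapP[j _ ->] /flattenP[_ /mapP[a ha ->]]].
by rewrite mem_nseq => /andP[_ /eqP ->]; move: ha; rewrite mem_iota.
Qed.

Lemma counts_tableau_ssyt : is_ssyt la (counts_tableau L la m).
Proof.
have srow j : sorted leq (row j).
  rewrite /row; have : forall b n, sorted leq (flatten [seq nseq (m j a) a.+1 | a <- iota b n])
     /\ all (fun x => b < x)%N (flatten [seq nseq (m j a) a.+1 | a <- iota b n]).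
    move=> b n; elim: n b => [//|n IH] b /=; have [h1 h2] := IH b.+1.
    have h2' : all (fun x => b < x)%N (flatten [seq nseq (m j a) a.+1 | a <- iota b.+1 n]).
      by apply: sub_all h2 => x /ltnW.
    split; last by rewrite all_cat h2' andbT all_nseq ltnSn orbT.
    elim: (m j b) => [//|k IHk] /=; rewrite (path_sortedE leq_trans) IHk andbT all_cat h2' andbT.
    by rewrite all_nseq leqnn orbT.
  by move=> /(_ 0%N L)[].
have r0 j : 0%N \notin row j.
  apply/flattenP => -[_ /mapP[a _ ->]]; by rewrite mem_nseq => /andP[].
have [hs _ hb] := mP.
have ps j k : psum m j k = count (fun x => x <= k)%N (row j).
  rewrite -nth_counts_tableau -psum_tableau_counts ?nth_counts_tableau //.
  by apply: eq_bigr => a _; rewrite counts_tableauK.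
split.
- apply: (eq_from_nth (x0 := 0%N)); first by rewrite size_map size_mkseq.
  move=> j; rewrite size_map size_mkseq => jl.
  rewrite (nth_map [::]) ?size_mkseq // nth_counts_tableau -hs ps.
  apply/esym/eqP; rewrite -all_count.
  by have := row_all j counts_tableau_letters; rewrite nth_counts_tableau.
- by apply/flattenP => -[_ /mapP[j _ ->]]; apply/negP; exact: r0.
- by apply/allP => _ /mapP[j _ ->]; exact: srow.
move=> j i; rewrite !nth_counts_tableau => i'.
have srl k : size (row k) = nth 0%N la k.
  rewrite -hs ps; apply/esym/eqP; rewrite -all_count.
  by have := row_all k counts_tableau_letters; rewrite nth_counts_tableau.
have ii : (i < size (row j))%N by apply: leq_trans i' _; rewrite !srl nth_la_le.
(* The pattern condition is used for the letters <= v of row j + 1, of which there are more than i,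
   and the letters <= v - 1 of row j. *)
set v := nth 0%N (row j.+1) i; have v0 : (0 < v)%N.
  by rewrite lt0n; apply: contraNneq (r0 j.+1) => <-; exact: mem_nth.
rewrite -(prednK v0) ltnS sorted_nth_le_count // -ps.
by apply: leq_trans (hb j v.-1); rewrite prednK // ps -sorted_nth_le_count.
Qed.
End Tableaux.

Definition ssyt_set (L : nat) (la : seq nat) : set (seq (seq nat)) :=
  [set T | is_ssyt la T /\ all (fun k => k <= L)%N (flatten T)]%classic.

Lemma finite_ssyt_set L la : finite_set (ssyt_set L la).
Proof.
pose F (t : (sumn la).-tuple 'I_L.+1) := reshape la (map val t).
apply: (sub_finite_set (B := (F @` setT)%classic)); last exact/finite_image/finite_finset.
move=> T [[sh _ _ _] TL]; have sz : size (map (fun k => inord k : 'I_L.+1) (flatten T)) == sumn la.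
  by rewrite size_map size_flatten sh.
exists (Tuple sz) => //; rewrite /F /= -map_comp map_id_in => [|k kT /=].
  by rewrite -sh flattenK.
by rewrite inordK // ltnS; exact: (allP TL).
Qed.

Section Dimension.
Variables (R : realType) (r : nat) (la : seq nat).
Hypotheses (r0 : (0 < r)%N) (la_sorted : sorted geq la)
  (la_size : (size la <= r)%N).

Lemma ssyt_column T p q c : is_ssyt la T -> (p < q < colh la c)%N ->
  (nth 0%N (nth [::] T p) c < nth 0%N (nth [::] T q) c)%N.
Proof.
move=> [sh _ _ Tc] /andP[pq]; elim: q pq => [//|q IH]; rewrite ltnS leq_eqVlt.
have step : (q.+1 < colh la c)%N -> (nth 0%N (nth [::] T q) c < nth 0%N (nth [::] T q.+1) c)%N.
  by rewrite ltn_colh // => h; apply: Tc; rewrite (size_row _ sh).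
move=> /orP[/eqP -> //|pq] h; apply: leq_trans (IH pq (ltnW h)) (ltnW (step h)).
Qed.

Lemma dim_irr_ssyt (mu : weight r) :
  (forall j : 'I_r.-1, mu 0 j = (nth 0%N la j)%:Z - (nth 0%N la j.+1)%:Z) ->
  dim_irr R mu = #|` fset_set (ssyt_set r la)|.
Proof.
move=> hmu; pose K : numFieldType := R[i].
pose a0 := Ordinal r0.
have [N [tab [Ncard tabX tab_inj tab_surj]]] :
    exists (N : nat) (tab : 'I_N -> seq (seq nat)), [/\ N = #|` fset_set (ssyt_set r la)|,
      forall i, ssyt_set r la (tab i), injective tab
      & forall T, ssyt_set r la T -> exists i, tab i = T].
  pose X := fset_set (ssyt_set r la).
  have XE T : T \in X <-> ssyt_set r la T.
    by rewrite in_fset_set ?inE //; exact: finite_ssyt_set.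
  exists #|` X|, (fun i => nth [::] X i); split=> //.
  - by move=> i; apply/XE/mem_nth; exact: ltn_ord.
  - move=> x y e; apply: val_inj; apply/eqP.
    by have := nth_uniq [::] (ltn_ord x) (ltn_ord y) (fset_uniq X); rewrite e eqxx => <-.
  - by move=> T /XE /(nthP [::])[i iN iE]; exists (Ordinal iN).
have letter T p c : ssyt_set r la T -> (c < nth 0%N la p)%N ->
    (0 < nth 0%N (nth [::] T p) c <= r)%N.
  move=> [[sh T0 _ _] TL] cp; have cT : (c < size (nth [::] T p))%N by rewrite (size_row _ sh).
  rewrite (allP (row_all p TL) _ (mem_nth 0%N cT)) andbT lt0n.
  by apply: contraNneq (row_notin0 p T0) => <-; exact: mem_nth.
have [t tE] : exists t : 'I_N -> nat -> nat -> 'I_r, forall i p c, (c < nth 0%N la p)%N ->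
    t i p c = (nth 0%N (nth [::] (tab i) p) c).-1 :> nat.
  exists (fun i p c => insubd a0 (nth 0%N (nth [::] (tab i) p) c).-1) => i p c.
  move=> /(letter _ _ _ (tabX i)) /andP[h1 h2].
  by rewrite val_insubd prednK // h2.
have t_inc x (c k l : nat) : (k < l < colh la c)%N -> (t x k c < t x l c)%N.
  move=> /[dup] klc /andP[kl lc]; have [hT _] := tabX x.
  have := ssyt_column hT klc; rewrite !tE; last 2 first.
    - by rewrite -ltn_colh.
    - by rewrite -ltn_colh // (ltn_trans kl).
  have /andP[h1 _] : (0 < nth 0%N (nth [::] (tab x) k) c <= r)%N.
    by apply: (letter _ _ _ (tabX x)); rewrite -ltn_colh // (ltn_trans kl).
  by case: (nth 0%N _ c) h1 => // y _; case: (nth 0%N _ c).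
have leadE i (a j : 'I_r) : mlead (bitab K la_size (t i)) (idx a j) = tableau_counts (tab i) j a.
  have [_ _ ->] := bitab_lead K la_size (@t_inc i).
  rewrite /tableau_counts; have [[sh _ _ _] _] := tabX i.
  have sj := size_row j sh.
  rewrite -sum1_count (big_nth 0%N) sj big_mkord [RHS]big_mkcond /=.
  rewrite -(big_mkord predT (fun c => nat_of_bool ((j < colh la c)%N && (t i j c == a)))).
  rewrite -(big_mkord predT (fun c => if nth 0%N (nth [::] (tab i) j) c == a.+1 then 1%N else 0%N)).
  rewrite (big_cat_nat (n := nth 0%N la j)) ?nth_le_head //=.
  rewrite [X in (_ + X)%N]big_nat [X in (_ + X)%N]big1 ?addn0; last first.
    by move=> c /andP[h _]; rewrite ltn_colh // ltnNge h.
  apply: eq_big_nat => c /andP[_ cj]; rewrite ltn_colh // cj /= -(inj_eq val_inj) /= tE //.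
  by have /andP[h _] := letter _ j c (tabX i) cj; rewrite -(prednK h) eqSS; case: eqP.
have hrow i j : (r <= j)%N -> nth [::] (tab i) j = [::].
  move=> rj; have [[sh _ _ _] _] := tabX i.
  by rewrite nth_default // -(size_map size) -/(shape _) sh (leq_trans la_size rj).
have t_inj : injective (fun x => mlead (bitab K la_size (t x))).
  move=> x y e; apply: tab_inj.
  have [hx hxr] := tabX x; have [hy hyr] := tabX y.
  apply: (ssyt_counts_inj hx hy) => j a.
  have [rj|jr] := leqP r j; first by rewrite /tableau_counts !hrow.
  have [ra|ar] := leqP r a.
    have [_ h _] := ssyt_pattern la_sorted hx hxr; have [_ h' _] := ssyt_pattern la_sorted hy hyr.
    exact: etrans (h j a ra) (esym (h' j a ra)).
  have e' := congr1 (fun m : 'X_{1..(r * r)%N} => m (idx (Ordinal ar) (Ordinal jr))) e.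
  exact: etrans (esym (leadE x _ _)) (etrans e' (leadE y _ _)).
(* The leading exponents form a pattern: row sums are column degrees, and column strictness is the
   ballot condition. The exponents are extended by 0 outside of the matrix. *)
have t_complete (h : {mpoly K[(r * r)%N]}) :
    colinv la h -> h != 0 -> exists x, mlead h = mlead (bitab K la_size (t x)).
  move=> hi h0; have [hw hk] := hi.
  pose m j a : nat := if insub j is Some j' then
    if insub a is Some a' then mlead h (idx a' (j' : 'I_r)) else 0%N else 0%N.
  have mE (a j : 'I_r) : m j a = mlead h (idx a j) by rewrite /m !valK.
  have hl : h@_(mlead h) != 0 by rewrite mleadc_eq0.
  have mj0 j a : (r <= j)%N -> m j a = 0%N.
    by move=> rj; rewrite /m; case: insubP => // j' _ e; move: (ltn_ord j'); rewrite e ltnNge rj.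
  have ma0 j a : (r <= a)%N -> m j a = 0%N.
    move=> ra; rewrite /m; case: insubP => // j' _ _; case: insubP => // a' _ e.
    by move: (ltn_ord a'); rewrite e ltnNge ra.
  have mP : pattern r la m.
    split=> [j|j a|j k]; last 2 first.
    - exact: ma0.
    - have [rj|jr] := leqP r j.+1; first by rewrite /psum big1 // => a _; rewrite mj0.
      have psumE (j' : nat) (hj : (j' < r)%N) k' : (k' <= r)%N ->
          psum m j' k' = (\sum_(b < r | (b < k')%N) mlead h (idx b (Ordinal hj)))%N.
        move=> k'r; rewrite /psum (big_ord_widen_cond r predT (fun a => m j' a)) //=.
        by apply: eq_bigr => b _; rewrite -mE.
      have main k' : (k' < r)%N -> (psum m j.+1 k'.+1 <= psum m j k')%N.
        move=> kr; rewrite (psumE _ jr) // (psumE _ (ltnW jr)) ?(ltnW kr) //.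
        have jj' : Ordinal jr = (Ordinal (ltnW jr)).+1 :> nat by [].
        exact: (lead_ballot (Ordinal kr) hw h0 jj' (hk _ _ jj')).
      (* Beyond r the partial sums are stationary, so the case k = r - 1 is enough. *)
      have [kr|rk] := ltnP k r; first exact: main.
      have stab j' k' : (r <= k')%N -> psum m j' k' = psum m j' r.
        move=> rk'; rewrite /psum -(subnKC rk') big_split_ord /= [X in (_ + X)%N]big1 ?addn0 //.
        by move=> b _; rewrite ma0 // leq_addr.
      rewrite (stab _ k.+1) ?(leq_trans rk) // (stab _ k) //.
      have := main r.-1; rewrite prednK // => /(_ (leqnn _)) h1.
      apply: leq_trans h1 _; rewrite -[X in (_ <= psum _ _ X)%N](prednK r0).
      by rewrite /psum big_ord_recr leq_addr.
    have [rj|jr] := leqP r j.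
      by rewrite /psum big1 => [|a _]; rewrite ?mj0 // nth_default // (leq_trans la_size).
    have <- := colw_sum (Ordinal jr) hw hl; apply: eq_bigr => a _.
    by rewrite -mE.
  have TX : ssyt_set r la (counts_tableau r la m).
    by split; [exact: counts_tableau_ssyt|exact: counts_tableau_letters].
  have [i iE] := tab_surj _ TX.
  exists i; apply: mnm_idxP => a j; rewrite leadE iE.
  by rewrite (counts_tableauK mP) mE.
have e : #|` fset_set (ssyt_set r la)| = \dim (fullv : {vspace 'rV[K]_N}).
  by rewrite -Ncard dimvf [dim _]mul1n.
have bM := brho_module la_sorted t_inc t_inj t_complete.
have bI := brho_irreducible a0 la_sorted t_inc t_inj t_complete.
have bH := brho_highest_weight a0 la_sorted t_inc t_inj t_complete hmu.
(* Whatever module [xget] has chosen, comparing it with the model in both directions gives its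
   dimension; the model itself excludes the default value. *)
rewrite /dim_irr; case: xgetP => [d _ [V [rho [M irr hw <-]]]|/(_ N) []].
  rewrite e; apply/eqP; rewrite eqn_leq; apply/andP; split.
    exact: (hw_dim_le M irr hw bM bI bH).
  exact: (hw_dim_le bM bI bH M irr hw).
by exists 'rV[K]_N, (brho la_size t); split; rewrite // -e Ncard.
Qed.
End Dimension.

(** * Formal series *)

Section QSeries.
Implicit Types (f g S : qseries) (e : rat).

Definition natsupp f := forall e, f e != 0 -> exists k : nat, e = k%:R.

Definition lower_bounded (b : rat) S := forall e, S e != 0 -> b <= e.

Definition unit_series f := natsupp f /\ f 0 = 1.

Lemma natsupp_lower_bounded f : natsupp f -> lower_bounded 0 f.
Proof. by move=> h e /h[k ->]. Qed.

(** A non-zero term needs a natural exponent k with e - k >= b. Any larger M is also allowed, which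
    lets several products be truncated at the same place. *)
Lemma qmul_natE f S b e M : natsupp f -> lower_bounded b S -> e - b < M%:R ->
  qmul f S e = \sum_(k < M) f k%:R * S (e - k%:R).
Proof.
move=> hf hS hM.
rewrite -(big_mkord predT (fun k : nat => f k%:R * S (e - k%:R))) /index_iota subn0 /=.
rewrite -(big_map (fun k : nat => k%:R : rat) predT (fun a => f a * S (e - a))).
rewrite /qmul (fsbigE (map (fun k : nat => k%:R : rat) (iota 0 M))) //.
- by apply: eq_bigl => a; rewrite in_setT.
- by rewrite map_inj_uniq ?iota_uniq // => x y /eqP; rewrite eqr_nat => /eqP.
move=> a _ ha; apply/eqP; rewrite mulf_eq0 -[_ || _]negbK negb_or; apply/negP => /andP[fa Sa].
have [k ak] := hf _ fa; move: ha; rewrite ak map_f // mem_iota /= add0n.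
by rewrite -(ltr_nat rat) (le_lt_trans _ hM) // lerBrDr addrC -lerBrDr -ak hS.
Qed.

Lemma ratr_bound (x : rat) : exists M : nat, x < M%:R.
Proof.
have [x0|x0] := ltP x 0; first by exists 0%N.
by exists (Num.bound x); apply: archi_boundP.
Qed.

Lemma qmul_lower_bounded f S b : natsupp f -> lower_bounded b S -> lower_bounded b (qmul f S).
Proof.
move=> hf hS e; have [M hM] := ratr_bound (e - b); rewrite (qmul_natE hf hS hM).
apply: contraNT; rewrite -ltNge => eb; rewrite big1 // => k _.
have -> : S (e - k%:R) = 0; last by rewrite mulr0.
apply/eqP; apply: contraTT eb => /hS; rewrite -leNgt => h.
by rewrite (le_trans h) // gerBl.
Qed.

Lemma qmul_natsupp f g : natsupp f -> natsupp g -> natsupp (qmul f g).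
Proof.
move=> hf hg e; have [M hM] := ratr_bound (e - 0).
rewrite (qmul_natE hf (natsupp_lower_bounded hg) hM) => h.
have [k hk] : exists k : 'I_M, f k%:R * g (e - k%:R) != 0.
  by apply: contra_neqP h => /forallNP h; apply: big1 => k _; apply/eqP/negPn/negP/h.
have : g (e - k%:R) != 0 by apply: contraNneq hk => ->; rewrite mulr0.
by move=> /hg[l hl]; exists (l + k)%N; rewrite natrD -hl subrK.
Qed.

Lemma qmul_nat f g n : natsupp f -> natsupp g ->
  qmul f g n%:R = \sum_(k < n.+1) f k%:R * g (n - k)%:R.
Proof.
move=> hf hg; rewrite (qmul_natE (M := n.+1) hf (natsupp_lower_bounded hg)).
  by apply: eq_bigr => k _; rewrite natrB // -ltnS.
by rewrite subr0 ltr_nat.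
Qed.

Lemma qmul_ext_nat f g : natsupp f -> natsupp g -> (forall n : nat, f n%:R = g n%:R) -> f = g.
Proof.
move=> hf hg h; apply/funext => e.
have [fe|/hf[k ->]] := eqVneq (f e) 0; last exact: h.
have [ge|/hg[k ->]] := eqVneq (g e) 0; last exact: h.
by rewrite fe ge.
Qed.

Lemma qmulC f g : natsupp f -> natsupp g -> qmul f g = qmul g f.
Proof.
move=> hf hg; apply: qmul_ext_nat; [exact: qmul_natsupp|exact: qmul_natsupp|move=> n].
rewrite !qmul_nat // (reindex_inj rev_ord_inj); apply: eq_bigr => k _ /=.
by rewrite mulrC subSS subKn // -ltnS.
Qed.

(** The supports make all sums finite; both sides are truncated at a common M and reindexed by n = k
    + l, the terms with k + l >= M being 0. *)
Lemma qmulA f g S b : natsupp f -> natsupp g -> lower_bounded b S ->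
  qmul f (qmul g S) = qmul (qmul f g) S.
Proof.
move=> hf hg hS; apply/funext => e; have [M hM] := ratr_bound (e - b).
rewrite (qmul_natE hf (qmul_lower_bounded hg hS) hM) (qmul_natE (qmul_natsupp hf hg) hS hM).
transitivity (\sum_(k < M) \sum_(n < M | (k <= n)%N)
    f k%:R * (g (n - k)%:R * S (e - n%:R))).
  apply: eq_bigr => k _; rewrite (qmul_natE (M := M) hg hS); last first.
    by apply: le_lt_trans hM; rewrite lerBlDr subrK gerBl.
  rewrite mulr_sumr.
  rewrite -(big_mkord predT (fun l : nat => f k%:R * (g l%:R * S (e - k%:R - l%:R)))).
  rewrite (big_cat_nat (n := (M - k)%N)) ?leq_subr //= [X in _ + X]big_nat [X in _ + X]big1.
    rewrite addr0 -(big_mkord (fun n => (k <= n)%N) (fun n =>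
      f k%:R * (g (n - k)%:R * S (e - n%:R)))).
    rewrite [RHS](big_cat_nat (n := k)) ?(ltnW (ltn_ord k)) //=.
    rewrite [X in _ = X + _]big_nat_cond [X in _ = X + _]big1 ?add0r; last first.
      by move=> n /andP[/andP[_ nk] kn]; move: nk; rewrite ltnNge kn.
    have shift (G : nat -> int) :
        \sum_(k <= n < M | (k <= n)%N) G n = \sum_(0 <= l < M - k) G (l + k)%N.
      rewrite -[X in \sum_(X <= _ < M | _) _]add0n big_addn.
      by apply: eq_bigl => l; rewrite leq_addl.
    rewrite shift; apply: eq_bigr => l _.
    by rewrite addnK natrD opprD addrA addrAC.
  move=> l /andP[Ml _]; have -> : S (e - k%:R - l%:R) = 0; last by rewrite !mulr0.
  apply/eqP; apply: contraTT hM => /hS h; rewrite -leNgt lerBrDr.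
  have : M%:R <= k%:R + l%:R :> rat by rewrite -natrD ler_nat -leq_subLR.
  by move: h; lra.
rewrite (exchange_big_dep predT) //=; apply: eq_bigr => n _.
rewrite qmul_nat // mulr_suml.
rewrite (big_ord_widen_cond M predT (fun k => f k%:R * g (n - k)%:R * S (e - n%:R))) //=.
by apply: eq_bigr => k _; rewrite mulrA.
Qed.

Lemma qone_natsupp : natsupp qone.
Proof. by move=> e; rewrite /qone /qmon; case: (e =P 0) => // -> _; exists 0%N. Qed.

Lemma qmul_monE a S e : qmul (qmon a) S e = S (e - a).
Proof.
rewrite /qmul (fsbigE [:: a]) //=.
- by rewrite big_cons big_nil in_setT /qmon eqxx mul1r addr0.
- by move=> b _; rewrite inE /qmon => /negbTE ->; rewrite mul0r.
Qed.

Lemma qmul1 S : qmul qone S = S.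
Proof. by apply/funext => e; rewrite qmul_monE subr0. Qed.

Lemma unit_qone : unit_series qone.
Proof. by split; [exact: qone_natsupp|rewrite /qone /qmon eqxx]. Qed.

Lemma unit_qmul f g : unit_series f -> unit_series g -> unit_series (qmul f g).
Proof.
move=> [hf f0] [hg g0]; split; first exact: qmul_natsupp.
by rewrite (qmul_nat 0) // big_ord1 subnn f0 g0.
Qed.

Lemma unit_qpow f k : unit_series f -> unit_series (qpow f k).
Proof. by move=> hf; elim: k => [|k IH]; [exact: unit_qone|exact: unit_qmul]. Qed.

Lemma unit_qfactor m : (0 < m)%N -> unit_series (qsub qone (qmon m%:R)).
Proof.
move=> m0; split.
  move=> e; rewrite /qsub /qone /qmon; case: (e =P 0) => [-> _|_]; first by exists 0%N.
  by case: (e =P m%:R) => [-> _|]; [exists m|rewrite subrr].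
by rewrite /qsub /qone /qmon eqxx eq_sym pnatr_eq0 (gtn_eqF m0) subr0.
Qed.

Lemma unit_qvandermonde r : unit_series (qvandermonde r).
Proof.
rewrite /qvandermonde; apply: big_ind => [||k _]; [exact: unit_qone|exact: unit_qmul|].
rewrite big_nat; apply: big_ind => [||j /andP[_ jk]]; [exact: unit_qone|exact: unit_qmul|].
by apply: unit_qfactor; rewrite subn_gt0.
Qed.

(** A coefficient of the limit is either one of a partial product or the default 0, which gives the
    support; the constant terms of the partial products are all 1. *)
Lemma unit_qpoch : unit_series qpoch.
Proof.
pose u M := \big[qmul/qone]_(1 <= m < M) qsub qone (qmon m%:R).
have uu M : unit_series (u M).
  rewrite /u big_nat; apply: big_ind => [||m /andP[m1 _]]; [exact: unit_qone|exact: unit_qmul|].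
  exact: unit_qfactor.
rewrite /unit_series /natsupp /qpoch /qlim; split=> [e|].
  case: xgetP => [c _ [N hN]|_]; last by rewrite eqxx.
  by rewrite -(hN _ (leqnn N)) => /(proj1 (uu N)).
case: xgetP => [c _ [N hN]|/(_ 1) []]; first by rewrite -(hN _ (leqnn N)); exact: (proj2 (uu N)).
by exists 0%N => n _; exact: (proj2 (uu n)).
Qed.

(** 1 - f has no constant term, so its power k only has exponents >= k. *)
Lemma qinvE f n : unit_series f ->
  qinv f n%:R = \sum_(k < n.+1) qpow (qsub qone f) k n%:R /\
  forall k, (n < k)%N -> qpow (qsub qone f) k n%:R = 0.
Proof.
move=> [hf f0]; set u := qsub qone f.
have hu : natsupp u.
  move=> e; rewrite /u /qsub; have [->|/hf //] := eqVneq (f e) 0.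
  by rewrite subr0 => /qone_natsupp.
have u0 : u 0 = 0 by rewrite /u /qsub f0 /qone /qmon eqxx subrr.
have hp k : natsupp (qpow u k) by elim: k => [|k IH]; [exact: qone_natsupp|exact: qmul_natsupp].
have big k l : (l < k)%N -> qpow u k l%:R = 0.
  elim: k l => [//|k IH] l; rewrite ltnS => lk; rewrite /= qmul_nat // big_ord_recl u0 mul0r add0r.
  by apply: big1 => i _; rewrite lift0 IH ?mulr0 //; have := ltn_ord i; lia.
split=> // [|k]; last exact: big.
rewrite -(big_mkord predT (fun k => qpow u k n%:R)) /index_iota subn0.
rewrite /qinv /qsum (fsbigE (iota 0 n.+1)) ?iota_uniq //.
- by apply: eq_bigl => a; rewrite in_setT.
- by move=> k _; rewrite mem_iota /= add0n -leqNgt => /big.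
Qed.

Lemma unit_qinv f : unit_series f -> unit_series (qinv f).
Proof.
move=> uf; have [hf f0] := uf; split; last first.
  have [-> _] := qinvE 0 uf; rewrite big_ord1 /= /qone /qmon eqxx //.
have hu : natsupp (qsub qone f).
  move=> e; rewrite /qsub; have [->|/hf //] := eqVneq (f e) 0.
  by rewrite subr0 => /qone_natsupp.
have hp k : natsupp (qpow (qsub qone f) k).
  by elim: k => [|k IH]; [exact: qone_natsupp|exact: qmul_natsupp].
move=> e he; have : exists k, qpow (qsub qone f) k e != 0.
  by apply: contra_neqP he => /forallNP h; apply: fsbig1 => k _; apply/eqP/negPn/negP/h.
by case=> k /hp.
Qed.

Lemma qmul_qinv f : unit_series f -> qmul f (qinv f) = qone.
Proof.
move=> uf; have [hf f0] := uf; have [hi _] := unit_qinv uf.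
have hu : natsupp (qsub qone f).
  move=> e; rewrite /qsub; have [->|/hf //] := eqVneq (f e) 0.
  by rewrite subr0 => /qone_natsupp.
have hp k : natsupp (qpow (qsub qone f) k).
  by elim: k => [|k IH]; [exact: qone_natsupp|exact: qmul_natsupp].
apply: qmul_ext_nat; [exact: qmul_natsupp|exact: qone_natsupp|move=> n].
have inv_le (l : nat) : (l <= n)%N ->
    qinv f l%:R = \sum_(k < n.+1) qpow (qsub qone f) k l%:R.
  move=> ln; have [-> h] := qinvE l uf.
  rewrite (big_ord_widen_cond n.+1 predT (fun k => qpow (qsub qone f) k l%:R)) // big_mkcond /=.
  by apply: eq_bigr => k _; case: ltnP => // /h.
have fE e : f e = qone e - qsub qone f e by rewrite /qsub opprB addrC subrK.
rewrite qmul_nat //; under eq_bigr do rewrite fE mulrBl.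
rewrite sumrB -(qmul_nat _ qone_natsupp hi) -(qmul_nat _ hu hi) qmul1 (inv_le n) //.
rewrite qmul_nat //; under [X in _ - X]eq_bigr => k _ do
  rewrite (inv_le _ (leq_subr _ _)) mulr_sumr.
rewrite exchange_big /=; under [X in _ - X]eq_bigr => k _ do rewrite -qmul_nat //.
(* With u = 1 - f, the product (1 - u)(1 + u + ... + u^n) telescopes to 1 - u^(n+1), whose last term
   has no coefficient at q^n. *)
rewrite big_ord_recl big_ord_recr /= -[qmul _ _]/(qpow (qsub qone f) n.+1).
have [_ h] := qinvE n uf; rewrite (h n.+1) // addr0.
apply/eqP; rewrite subr_eq; apply/eqP.
by congr (_ + _); apply: eq_bigr => k _.
Qed.

(** Only [S] may have negative or fractional exponents, so it stays on the right while the other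
    factors are regrouped. *)
Lemma qmul_cancel P V S b : unit_series P -> unit_series V -> lower_bounded b S ->
  qmul (qmul P (qinv V)) (qmul (qmul V (qinv P)) S) = S.
Proof.
move=> uP uV hS; have [hP _] := uP; have [hV _] := uV.
have [hP' _] := unit_qinv uP; have [hV' _] := unit_qinv uV.
have nb g : natsupp g -> lower_bounded 0 g := @natsupp_lower_bounded g.
rewrite (qmulA (b := b)) //; try exact: qmul_natsupp.
rewrite -(qmulA (b := 0) hP hV'); last by apply: nb; exact: qmul_natsupp.
rewrite (qmulA hV' hV (nb _ hP')) (qmulC hV' hV) qmul_qinv // qmul1 qmul_qinv //.
exact: qmul1.
Qed.
End QSeries.

(** * Gelfand-Tsetlin patterns and Kostka numbers *)

Section SetBijections.
Local Open Scope classical_set_scope.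

Lemma set_bij_card (T U : choiceType) (A : set T) (B : set U) (f : T -> U) :
  finite_set A -> set_bij A B f ->
  finite_set B /\ #|` fset_set A| = #|` fset_set B|.
Proof.
move=> fA fb; have AB : (A #= B)%card by apply: pcard_eq; exact: (bij_of_set_bijection fb).
have fB : finite_set B by rewrite -(eq_finite_set AB).
by split=> //; apply/fcard_eq.
Qed.

Lemma set_bijI (T U : Type) (A : set T) (B : set U) (f : T -> U) (P : set T) (Q : set U) :
  set_bij A B f -> (forall x, A x -> P x <-> Q (f x)) -> set_bij (A `&` P) (B `&` Q) f.
Proof.
move=> [fF fI fS] PQ; split.
- by move=> x [Ax Px]; split; [exact: fF|exact/PQ].
- move=> x y; rewrite !inE => -[Ax _] [Ay _]; apply: fI; exact/mem_set.
- move=> y [By Qy]; have [x Ax xy] := fS _ By; exists x => //; split=> //.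
  by apply/PQ => //; rewrite xy.
Qed.

Lemma set_bij_can (T U : Type) (A : set T) (B : set U) (f : T -> U) (g : U -> T) :
  (forall x, A x -> B (f x)) -> (forall y, B y -> A (g y)) ->
  (forall x, A x -> g (f x) = x) -> (forall y, B y -> f (g y) = y) -> set_bij A B f.
Proof.
move=> hf hg fK gK; split=> //.
- by move=> x y; rewrite !inE => Ax Ay e; rewrite -(fK _ Ax) e fK.
- by move=> y By; exists (g y); [exact: hg|exact: gK].
Qed.
End SetBijections.

(* Gelfand-Tsetlin patterns: c j k is the number of letters <= k in row j. *)
Definition gt_pattern (L : nat) (la : seq nat) : set (nat -> nat -> nat) :=
  [set c | [/\ forall j, c j 0%N = 0%N, forall j k, (c j k <= c j k.+1)%N,
    forall j k, (L <= k)%N -> c j k = nth 0%N la j &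
    forall j k, (c j.+1 k.+1 <= c j k)%N]]%classic.

Definition gt_counts (c : nat -> nat -> nat) (j a : nat) : nat := (c j a.+1 - c j a)%N.

Lemma psum_gt_counts L la c j k : gt_pattern L la c -> psum (gt_counts c) j k = c j k.
Proof.
move=> [c0 cm _ _]; rewrite /psum; elim: k => [|k IH]; first by rewrite big_ord0 c0.
by rewrite big_ord_recr /= IH /gt_counts subnKC.
Qed.

Lemma psumS m j k : psum m j k.+1 = (psum m j k + m j k)%N.
Proof. by rewrite /psum big_ord_recr. Qed.

Section GelfandTsetlin.
Variables (L : nat) (la : seq nat).
Hypothesis la_sorted : sorted geq la.

Lemma gt_pattern_counts c : gt_pattern L la c -> pattern L la (gt_counts c).
Proof.
move=> hc; have [c0 cm cL cb] := hc; split=> [j|j a La|j k].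
- by rewrite (psum_gt_counts _ _ hc) cL.
- by rewrite /gt_counts !cL ?subnn // ltnW.
- by rewrite !(psum_gt_counts _ _ hc).
Qed.

Definition gt_tableau (c : nat -> nat -> nat) : seq (seq nat) :=
  counts_tableau L la (gt_counts c).

Definition tableau_gt (T : seq (seq nat)) (j k : nat) : nat := psum (tableau_counts T) j k.

Lemma gt_tableauK c : gt_pattern L la c -> tableau_gt (gt_tableau c) = c.
Proof.
move=> hc; apply/funext => j; apply/funext => k; rewrite -(psum_gt_counts j k hc).
by apply: eq_bigr => a _; rewrite counts_tableauK //; exact: gt_pattern_counts.
Qed.

Lemma gt_tableau_bij : set_bij (gt_pattern L la) (ssyt_set L la) gt_tableau.
Proof.
have psumK m : gt_counts (psum m) = m.
  by apply/funext => j; apply/funext => k; rewrite /gt_counts psumS addKn.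
have tP T : ssyt_set L la T -> gt_pattern L la (tableau_gt T).
  move=> [hT TL]; have [h1 h2 h3] := ssyt_pattern la_sorted hT TL; split=> //.
  - by move=> j; rewrite /tableau_gt /psum big_ord0.
  - by move=> j k; rewrite /tableau_gt psumS leq_addr.
  move=> j k Lk; rewrite -h1 /tableau_gt /psum -(subnKC Lk) big_split_ord /=.
  by rewrite [X in (_ + X)%N]big1 ?addn0 // => a _; rewrite h2 // leq_addr.
apply: (set_bij_can (g := tableau_gt)) => //.
- move=> c /gt_pattern_counts hc.
  by split; [exact: counts_tableau_ssyt|exact: counts_tableau_letters].
- exact: gt_tableauK.
move=> T hT; have [hs hl] := hT; have hP := gt_pattern_counts (tP _ hT).
apply: (ssyt_counts_inj (la := la)) => // [|j a]; first exact: counts_tableau_ssyt.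
by rewrite /gt_tableau counts_tableauK // /tableau_gt psumK.
Qed.

Lemma finite_gt_pattern : finite_set (gt_pattern L la).
Proof.
have [h _ _] := gt_tableau_bij.
apply: (sub_finite_set (B := tableau_gt @` ssyt_set L la)%classic).
  by move=> c hc; exists (gt_tableau c); [exact: h|exact: gt_tableauK].
exact/finite_image/finite_ssyt_set.
Qed.
End GelfandTsetlin.

Section KostkaStabilization.
Variables (r n : nat) (la : seq nat) (w c0 : nat).
Hypotheses (r0 : (0 < r)%N) (la_size : (size la <= r)%N).
(* The shape la consists of at least c0 full columns and of w further boxes. *)
Hypotheses (la_ge : forall j, (j < r)%N -> (c0 <= nth 0 la j)%N)
  (la_sum : (sumn la = r * c0 + w)%N) (la_n : sumn la = (n * r.+1)%N)
  (n_large : (r.+1 * w <= n)%N).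

Definition column_weight (c : nat -> nat -> nat) : Prop :=
  forall k, (k <= r.+1)%N -> (\sum_(j < r) c j k = n * k)%N.

(* Row k of the array (c j k) for r letters is row k + 1 of the one for r + 1
   letters, without its diagonal entry c k (k + 1). *)
Definition gt_trim (c : nat -> nat -> nat) (j k : nat) : nat :=
  if (j < k)%N then c j k.+1 else 0%N.

(** The value forced by the content: in the array for r + 1 letters, there are n (j + 1) letters <=
    j + 1. *)
Definition gt_diag (c : nat -> nat -> nat) (j : nat) : nat :=
  (n * j.+1 - \sum_(i < j) c i j)%N.

Definition gt_untrim (c : nat -> nat -> nat) (j k : nat) : nat :=
  if ((k <= j) || (r <= j))%N then 0%N else
  if k == j.+1 then gt_diag c j else c j k.-1.

Let la_nth_ge j : (r <= j)%N -> nth 0%N la j = 0%N.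
Proof. by move=> rj; rewrite nth_default // (leq_trans la_size). Qed.

Let la_total : (\sum_(j < r) nth 0%N la j = n * r.+1)%N.
Proof.
rewrite -la_n sumnE (big_nth 0%N) big_mkord.
rewrite [RHS](big_ord_widen_cond r predT (fun j => nth 0%N la j)) //=.
rewrite [RHS]big_mkcond; apply: eq_bigr => j _ /=; case: ltnP => // h.
by rewrite nth_default.
Qed.

Lemma gt_pattern_low L c j k : gt_pattern L la c -> (k <= j)%N -> c j k = 0%N.
Proof.
move=> [c0' _ _ cb]; elim: k j => [//|k IH] [//|j]; rewrite ltnS => kj.
by apply/eqP; rewrite -leqn0 -(IH j kj) cb.
Qed.

Lemma gt_pattern_le L c j k : gt_pattern L la c -> (c j k <= nth 0 la j)%N.
Proof.
move=> [_ cm cL _]; rewrite -(cL j (maxn L k)) ?leq_maxl //.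
by apply: (homo_leq (fun x => leqnn x) leq_trans (cm j)); rewrite leq_maxr.
Qed.

(** Follow the interlacing inequalities diagonally down to row r - 1, where the entry is the last
    part of [la]. *)
Lemma gt_pattern_ge c j k : gt_pattern r la c -> (j < k)%N -> (j < r)%N -> (c0 <= c j k)%N.
Proof.
move=> [_ cm cL cb] jk jr.
have diag i : (c (j + i) (k + i) <= c j k)%N.
  elim: i => [|i IH]; first by rewrite !addn0.
  by rewrite !addnS (leq_trans (cb _ _)).
apply: leq_trans (diag (r.-1 - j)%N); rewrite cL; last by lia.
by apply: la_ge; lia.
Qed.

(** From r c0 = r n + n - w and n >= (r + 1) w; this is what makes the diagonal entries decrease. *)
Let c0_large : (n + w <= c0)%N.
Proof.
rewrite -(leq_pmul2l r0) -(leq_add2r w) -la_sum la_n !mulnDr mulnS.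
by move: n_large; rewrite mulSn; lia.
Qed.

Let prefix_sum c j : gt_pattern r la c -> (j < r)%N ->
  (j * c0 <= \sum_(i < j) c i j <= j * c0 + w)%N.
Proof.
move=> hc jr; apply/andP; split.
  rewrite -{1}[j]card_ord -sum_nat_const; apply: leq_sum => i _.
  exact: gt_pattern_ge hc (ltn_ord i) (ltn_trans (ltn_ord i) jr).
apply: (@leq_trans (\sum_(i < j) nth 0 la i)%N).
  by apply: leq_sum => i _; exact: gt_pattern_le hc.
have tot : (\sum_(i < j) nth 0 la i + \sum_(j <= i < r) nth 0 la i = r * c0 + w)%N.
  rewrite -la_sum la_n -la_total -(big_mkord predT (fun i => nth 0%N la i)).
  by rewrite -[in RHS](big_mkord predT (fun i => nth 0%N la i)) [RHS](big_cat_nat (n := j))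
    ?(ltnW jr).
have : ((r - j) * c0 <= \sum_(j <= i < r) nth 0 la i)%N.
  rewrite -sum_nat_const_nat !big_nat; apply: leq_sum => i /andP[_ ir]; exact: la_ge.
have : (r * c0 = j * c0 + (r - j) * c0)%N by rewrite -mulnDl subnKC // ltnW.
by move: tot; lia.
Qed.

(** The subtraction is not truncated: by the size of the shape, j c0 + w <= n (j + 1) amounts to (r
    - j) w <= (r - j) n. *)
Let gt_diagE c j : gt_pattern r la c -> (j < r)%N ->
  (gt_diag c j + \sum_(i < j) c i j = n * j.+1)%N.
Proof.
move=> hc jr; rewrite /gt_diag subnK //.
have /andP[_ h] := prefix_sum hc jr; apply: leq_trans h _.
rewrite -(leq_pmul2l r0) mulnDr mulnCA.
have e : (r * c0 = n * r.+1 - w)%N by rewrite -la_n la_sum addnK.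
rewrite e; move: n_large; rewrite mulSn; nia.
Qed.

Lemma gt_trim_pattern c : gt_pattern r.+1 la c -> column_weight c ->
  gt_pattern r la (gt_trim c).
Proof.
move=> hc _; have [ch cm cL cb] := hc; rewrite /gt_trim; split=> [j //|j k|j k rk|j k].
- case: ltnP => // jk; by rewrite ltnS (ltnW jk).
- case: ltnP => jk; first by rewrite cL.
  by rewrite la_nth_ge // (leq_trans rk).
- by rewrite ltnS; case: ltnP.
Qed.

Lemma gt_untrim_pattern c : gt_pattern r la c ->
  gt_pattern r.+1 la (gt_untrim c) /\ column_weight (gt_untrim c).
Proof.
move=> hc; have [ch cm cL cb] := hc.
(* The two inequalities met by the new entries: [diag_le] is the growth along row j past the
   diagonal, [diag_dec] the interlacing of consecutive diagonal entries. Both follow from the bounds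
   j c0 and j c0 + w on prefix sums and from n + w <= c0. *)
have diag_le j : (j < r)%N -> (gt_diag c j <= c j j.+1)%N.
  move=> jr; have := gt_diagE hc jr; have /andP[h1 h2] := prefix_sum hc jr.
  have := gt_pattern_ge hc (leqnn j.+1) jr.
  by move: c0_large; nia.
have diag_dec j : (j.+1 < r)%N -> (gt_diag c j.+1 <= gt_diag c j)%N.
  move=> jr; have := gt_diagE hc jr; have /andP[h1 h2] := prefix_sum hc jr.
  have := gt_diagE hc (ltnW jr); have /andP[h3 h4] := prefix_sum hc (ltnW jr).
  by move: c0_large; nia.
split.
  rewrite /gt_untrim; split=> [j //|j k|j k rk|j k].
  - case: (leqP r j) => [|jr]; rewrite ?orbT ?orbF //.
    case: (ltngtP k j.+1) => [kj|jk|->].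
    + by have -> : (k <= j)%N = true by lia.
    + have -> : (k <= j)%N = false by lia.
      have -> : (k.+1 <= j)%N = false by lia.
      have -> : (k.+1 == j.+1) = false by lia.
      by rewrite /=; case: k jk.
    have -> : (j.+1 <= j)%N = false by lia.
    have -> : (j.+2 <= j)%N = false by lia.
    have -> : (j.+2 == j.+1) = false by lia.
    exact: diag_le.
  - case: (leqP r j) => [rj|jr]; rewrite ?orbT ?orbF; first by rewrite la_nth_ge.
    have -> : (k <= j)%N = false by lia.
    have -> : (k == j.+1) = false by lia.
    by rewrite cL //; lia.
  case: (leqP r j.+1) => [|jr]; rewrite ?orbT ?orbF //.
  have -> : (r <= j)%N = false by lia.
  rewrite orbF ltnS; case: (leqP k j) => // jk.
  rewrite !eqSS /=; case: (eqVneq k j.+1) => [_|kj]; first exact: diag_dec.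
  case: k jk kj => // k jk kj /=; exact: cb.
move=> k kr; case: k kr => [|k] kr.
  by rewrite muln0 big1 // => j _.
have [kr'|rk] := ltnP k r.
  rewrite -(gt_diagE hc kr') -(big_mkord predT (fun j => gt_untrim c j k.+1)).
  rewrite (big_cat_nat (n := k.+1)) //= [X in (_ + X)%N = _]big_nat.
  rewrite [X in (_ + X)%N = _]big1 ?addn0; last first.
    by move=> j /andP[kj _]; rewrite /gt_untrim kj.
  rewrite big_nat_recr //= big_mkord addnC.
  rewrite /gt_untrim ltnn /= [(r <= k)%N]leqNgt kr' /= eqxx; congr (_ + _)%N.
  apply: eq_bigr => j _; have jk := ltn_ord j; rewrite leqNgt ltnS (ltnW jk) /=.
  have -> : (r <= j)%N = false by lia.
  by rewrite eqSS (gtn_eqF jk).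
have -> : k = r by lia.
rewrite -la_total; apply: eq_bigr => j _; have jr := ltn_ord j; rewrite /gt_untrim.
have -> : (r.+1 <= j)%N = false by lia.
have -> : (r <= j)%N = false by lia.
by rewrite eqSS (gtn_eqF jr) /= cL.
Qed.

Lemma gt_trim_bij :
  set_bij (gt_pattern r.+1 la `&` column_weight)%classic (gt_pattern r la) gt_trim.
Proof.
apply: (set_bij_can (g := gt_untrim)).
- by move=> c [hc hw]; exact: gt_trim_pattern.
- exact: gt_untrim_pattern.
- move=> c [hc hw]; have [ch cm cL cb] := hc.
  apply/funext => j; apply/funext => k; rewrite /gt_untrim.
  have [kj|jk] := leqP k j; first by rewrite (gt_pattern_low hc).
  have [rj|jr] /= := leqP r j.
    by apply/esym/eqP; rewrite -leqn0 -(la_nth_ge rj) (gt_pattern_le _ _ hc).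
  have [->|kj] := eqVneq k j.+1; last first.
    rewrite /gt_trim; case: k jk kj => // k jk kj.
    by have -> : (j < k)%N by lia.
  rewrite /gt_diag; have <- := hw j.+1 (leqW jr).
  rewrite -(big_mkord predT (fun i => c i j.+1)) (big_cat_nat (n := j.+1)) //=.
  rewrite [X in (_ + X - _)%N]big_nat [X in (_ + X - _)%N]big1 ?addn0; last first.
    by move=> i /andP[ji _]; rewrite (gt_pattern_low hc).
  rewrite big_nat_recr //= big_mkord.
  rewrite (_ : \sum_(i < j) gt_trim c i j = \sum_(i < j) c i j.+1)%N ?addKn //.
  by apply: eq_bigr => i _; rewrite /gt_trim ltn_ord.
move=> c hc; have [ch cm cL cb] := hc.
apply/funext => j; apply/funext => k; rewrite /gt_trim.
have [jk|kj] := ltnP j k; last by rewrite (gt_pattern_low hc).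
rewrite /gt_untrim leqNgt ltnS (ltnW jk) eqSS (gtn_eqF jk) /=.
by case: leqP => // rj; apply/esym/eqP; rewrite -leqn0 -(la_nth_ge rj) (gt_pattern_le _ _ hc).
Qed.
End KostkaStabilization.

(** * Schur polynomials and Kostka numbers in terms of patterns *)

Definition qexponent (r a : nat) : rat := (r%:R - 1 - 2 * a%:R) / 2.

Definition gt_total (r : nat) (c : nat -> nat -> nat) (k : nat) : nat := (\sum_(j < r) c j k)%N.

(** The exponent of q contributed by a tableau to the principal specialization, the number of
    letters a + 1 being a difference of totals. *)
Definition gt_weight (r : nat) (c : nat -> nat -> nat) : rat :=
  \sum_(a < r) ((gt_total r c a.+1)%:R - (gt_total r c a)%:R) * qexponent r a.

Lemma count_mem_flatten r (T : seq (seq nat)) a : (size T <= r)%N ->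
  count_mem a.+1 (flatten T) = (\sum_(j < r) tableau_counts T j a)%N.
Proof.
move=> Tr; rewrite count_flatten sumnE big_map (big_nth [::]) big_mkord.
rewrite [LHS](big_ord_widen_cond r predT (fun j => count_mem a.+1 (nth [::] T j))) //=.
rewrite big_mkcond; apply: eq_bigr => j _ /=; case: ltnP => // h.
by rewrite /tableau_counts nth_default.
Qed.

Lemma sum_letters (F : nat -> rat) L (s : seq nat) : 0%N \notin s -> all (fun k => k <= L)%N s ->
  \sum_(k <- s) F k.-1 = \sum_(a < L) (count_mem a.+1 s)%:R * F a.
Proof.
elim: s => [|k s IH] /=; first by rewrite big_nil big1 // => a _; rewrite mul0r.
rewrite inE negb_or => /andP[k0 s0] /andP[kL sL]; rewrite big_cons IH //.
case: k k0 kL => [//|k] _ kL; under [RHS]eq_bigr do rewrite natrD mulrDl.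
rewrite big_split /=; congr (_ + _).
rewrite (bigD1 (Ordinal kL)) //= eqxx mul1r big1 ?addr0 // => a ak.
rewrite eqSS (_ : _ == _ = false) ?mul0r // eq_sym.
by apply/negbTE; rewrite -(inj_eq val_inj) in ak.
Qed.

Section GtTableauWeight.
Variables (L r : nat) (la : seq nat).
Hypothesis la_size : (size la <= r)%N.

Lemma gt_tableau_count c a : gt_pattern L la c ->
  (gt_total r c a + count_mem a.+1 (flatten (gt_tableau L la c)) = gt_total r c a.+1)%N.
Proof.
move=> hc; rewrite (@count_mem_flatten r) ?size_mkseq // -big_split.
apply: eq_bigr => j _ /=; rewrite counts_tableauK ?subnKC //; last exact: gt_pattern_counts.
by case: hc.
Qed.

Lemma gt_total0 c : gt_pattern L la c -> gt_total r c 0%N = 0%N.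
Proof. by move=> [h _ _ _]; rewrite /gt_total big1. Qed.
End GtTableauWeight.

Section SchurKostka.
Variables (r : nat) (la : seq nat).
Hypotheses (la_sorted : sorted geq la) (la_size : (size la <= r)%N).

Lemma qmon_prod (s : seq nat) : 0%N \notin s -> all (fun k => k <= r)%N s ->
  \big[qmul/qone]_(k <- s) nth qone (principal r) k.-1 = qmon (\sum_(k <- s) qexponent r k.-1).
Proof.
elim: s => [|k s IH] /=; first by rewrite !big_nil.
rewrite inE negb_or => /andP[k0 s0] /andP[kr sr]; rewrite !big_cons IH //.
rewrite /principal nth_mkseq; last by case: k k0 kr.
apply/funext => e; rewrite qmul_monE /qmon /qexponent.
by rewrite subr_eq addrC.
Qed.

Lemma schur_gt e : schur la (principal r) e =
  \sum_(c \in gt_pattern r la) ((e == gt_weight r c)%:R : int).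
Proof.
rewrite /schur /qsum size_mkseq -/(ssyt_set r la).
rewrite (reindex_fsbig _ _ _ _ (gt_tableau_bij r la_sorted)).
apply: eq_fsbigr => c; rewrite inE => hc.
have [hT TL] : ssyt_set r la (gt_tableau r la c) by have [h _ _] := gt_tableau_bij r la_sorted;
  exact: h.
have T0 : 0%N \notin flatten (gt_tableau r la c) by case: hT.
rewrite qmon_prod // /qmon (sum_letters _ T0 TL); congr (_ == _)%:R.
by apply: eq_bigr => a _; rewrite -(gt_tableau_count la_size a hc) natrD addrC addKr.
Qed.

Lemma card_ssyt_gt : #|` fset_set (ssyt_set r la)| = #|` fset_set (gt_pattern r la)|.
Proof.
by have [_ ->] := set_bij_card (finite_gt_pattern r la_sorted) (gt_tableau_bij r la_sorted).
Qed.

Lemma kostka_gt n : sumn la = (n * r.+1)%N ->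
  kostka la (nseq r.+1 n) = #|` fset_set (gt_pattern r.+1 la `&` column_weight r n)%classic|.
Proof.
move=> la_n; rewrite /kostka.
have -> : [set T : seq (seq nat) | is_ssyt la T /\
    forall k, count_mem k.+1 (flatten T) = nth 0%N (nseq r.+1 n) k]%classic =
  (ssyt_set r.+1 la `&` [set T | forall k, count_mem k.+1 (flatten T) = nth 0%N (nseq r.+1 n)
    k])%classic.
  apply/seteqP; split=> T /=; last by case=> -[].
  (* Letters beyond r + 1 are excluded because the content has the default value 0 there. *)
  move=> [hT hc]; split=> //; split=> //; apply/allP => -[//|k] kT; rewrite leqNgt;
    apply/negP => rk.
  have /count_memPn : count_mem k.+1 (flatten T) = 0%N
    by rewrite hc -[n :: _]/(nseq r.+1 n) nth_nseq ltnNge -ltnS rk.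
  by rewrite kT.
have bij := gt_tableau_bij r.+1 la_sorted.
pose Q T := forall k, count_mem k.+1 (flatten T) = nth 0%N (nseq r.+1 n) k.
suff PQ c : gt_pattern r.+1 la c -> column_weight r n c <-> Q (gt_tableau r.+1 la c).
  have fA : finite_set (gt_pattern r.+1 la `&` column_weight r n)%classic.
    by apply: finite_setIl; exact: finite_gt_pattern.
  by have [_ ->] := set_bij_card fA (set_bijI bij PQ).
move=> hc; rewrite /Q.
have cnt a := gt_tableau_count la_size a hc; split=> [hw k|h].
  rewrite nth_nseq; case: ltnP => kr.
    by have := cnt k; rewrite /gt_total (hw k (ltnW kr)) (hw k.+1 kr) mulnS addnC => /addIn ->.
  apply/count_memPn/negP => kT.
  have [_ /allP/(_ _ kT)] : ssyt_set r.+1 la (gt_tableau r.+1 la c) by case: bij => h _ _; exact: h.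
  by rewrite leqNgt ltnS kr.
elim=> [|k IH] kr; first by rewrite muln0; exact: (gt_total0 r hc).
by rewrite -[LHS]/(gt_total r c k.+1) -cnt h nth_nseq kr mulnS addnC -(IH (ltnW kr)).
Qed.

(** A full column can only be filled with 1, ..., r, so it puts one letter j + 1 in row j and adds 1
    to the entries with j < k. *)
Lemma gt_shift_bij (la' : seq nat) c0 :
  (forall j, nth 0%N la' j = (nth 0 la j + c0 * (j < r))%N) ->
  set_bij (gt_pattern r la) (gt_pattern r la')
    (fun c j k => (c j k + c0 * ((j < k) && (j < r)))%N).
Proof.
move=> hla; have la0 j : (r <= j)%N -> nth 0%N la j = 0%N.
  by move=> rj; rewrite nth_default // (leq_trans la_size).
have diag_ge c : gt_pattern r la' c -> forall j k, (j < k)%N -> (j < r)%N -> (c0 <= c j k)%N.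
  move=> hc j k jk jr; have [_ _ cL cb] := hc.
  have diag i : (c (j + i)%N (k + i)%N <= c j k)%N.
    elim: i => [|i IH]; first by rewrite !addn0.
    by rewrite !addnS (leq_trans (cb _ _)).
  apply: leq_trans (diag (r.-1 - j)%N); rewrite cL ?hla; last by lia.
  have -> : (j + (r.-1 - j) < r)%N = true by lia.
  by rewrite muln1 leq_addl.
apply: (set_bij_can (g := fun c j k => (c j k - c0 * ((j < k) && (j < r)))%N)).
- move=> c [ch cm cL cb]; split=> [j|j k|j k rk|j k].
  + by rewrite ch muln0.
  + rewrite leq_add // leq_mul2l; case: (ltnP j k) => [jk|_]; last by rewrite orbT.
    by rewrite ltnS (ltnW jk) leqnn orbT.
  + rewrite cL // hla; case: (ltnP j r) => [jr|_]; last by rewrite andbF.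
    by rewrite (leq_trans jr rk).
  + rewrite ltnS leq_add // leq_mul2l; apply/orP; right.
    by case: (j < k)%N => //=; case: (ltnP j.+1 r) => //= /ltnW ->.
- move=> c hc; have hd := diag_ge c hc; have [ch cm cL cb] := hc.
  split=> [j|j k|j k rk|j k].
  + by rewrite ch.
  + have [jr|rj] := ltnP j r; rewrite ?andbF ?andbT ?muln0 ?subn0 //.
    have [jk|kj] := ltnP j k; first by rewrite ltnS (ltnW jk) leq_sub2r.
    rewrite muln0 subn0; case: (ltnP j k.+1) => jk1; last by rewrite muln0 subn0.
    have h0 : c j k = 0%N.
      elim: k j kj {jr jk1} => [|k IH] [|j] //; rewrite ltnS => kj.
      by apply/eqP; rewrite -leqn0 -(IH j kj) cb.
    by rewrite h0.
  + rewrite cL // hla; case: (ltnP j r) => [jr|rj]; last by rewrite andbF !muln0 addn0 subn0.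
    by rewrite (leq_trans jr rk) addnK.
  + rewrite ltnS; case: (ltnP j k) => [jk|_] /=; last by rewrite muln0 !subn0 cb.
    have [jr|rj] := ltnP j.+1 r; first by rewrite (ltnW jr) leq_sub2r.
    have [ck|kc] := leqP r k.+1.
      by rewrite cL // hla la0 // ltnNge rj muln0.
    by move: jk; lia.
- by move=> c _; apply/funext => j; apply/funext => k; rewrite addnK.
move=> c hc; apply/funext => j; apply/funext => k; rewrite subnK //.
case: (ltnP j k) => [jk|_]; last by rewrite muln0.
by case: (ltnP j r) => [jr|_]; rewrite ?muln0 // muln1; exact: diag_ge.
Qed.

Lemma qexponent_sum : \sum_(a < r) qexponent r a = 0.
Proof.
set S := \sum_(a < r) _; have SN : S = - S.
  rewrite /S -sumrN (reindex_inj rev_ord_inj); apply: eq_bigr => a _.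
  by rewrite /qexponent /= natrB // -natr1; field.
by move: SN; lra.
Qed.

(** A full column contributes the product of the variables, which is 1 at the principal
    specialization. *)
Lemma gt_weight_shift c c0 :
  gt_weight r (fun j k => (c j k + c0 * ((j < k) && (j < r)))%N) = gt_weight r c.
Proof.
have tot k : (k <= r)%N -> gt_total r (fun j k => (c j k + c0 * ((j < k) && (j < r)))%N) k =
    (gt_total r c k + c0 * k)%N.
  move=> kr; rewrite /gt_total big_split /=; congr (_ + _)%N.
  rewrite -big_distrr /=; congr (_ * _)%N.
  transitivity (\sum_(j < r | (j < k)%N) 1)%N.
    by rewrite [RHS]big_mkcond; apply: eq_bigr => j _; rewrite ltn_ord andbT; case: ltnP.
  by rewrite -(big_ord_widen _ (fun=> 1%N) kr) sum1_card card_ord.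
have q0 : \sum_(a < r) c0%:R * qexponent r a = 0.
  by rewrite -mulr_sumr qexponent_sum mulr0.
rewrite /gt_weight -[RHS]addr0 -[X in _ = _ + X]q0 -big_split.
apply: eq_bigr => a _ /=; rewrite !tot ?(ltnW (ltn_ord a)) //.
by rewrite mulnS !natrD; ring.
Qed.
End SchurKostka.

(** * Weights and exponents *)

Section AbelSummation.
Variable R : comNzRingType.
Implicit Types x y : nat -> R.

Lemma abel_index x N :
  \sum_(i < N) (x i - x i.+1) * i.+1%:R = \sum_(i < N) x i - N%:R * x N.
Proof.
elim: N => [|N IH]; first by rewrite !big_ord0 mul0r subrr.
by rewrite !big_ord_recr /= IH -natr1; ring.
Qed.

Lemma abel_min y N i : (i < N)%N ->
  \sum_(j < N) (y j - y j.+1) * (minn i.+1 j.+1)%:R = \sum_(j < i.+1) y j - i.+1%:R * y N.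
Proof.
elim: N => [//|N IH]; rewrite ltnS leq_eqVlt => /orP[/eqP <-|iN].
  rewrite -abel_index; apply: eq_bigr => j _.
  by rewrite (minn_idPr _) // ltnS -ltnS.
rewrite big_ord_recr /= IH // (minn_idPl _) ?ltnS ?(ltnW iN) //.
ring.
Qed.

Lemma abel_prefix x y N :
  \sum_(i < N) (x i - x i.+1) * \sum_(j < i.+1) y j =
  \sum_(i < N) x i * y i - x N * \sum_(j < N) y j.
Proof.
elim: N => [|N IH]; first by rewrite !big_ord0 mulr0 subrr.
by rewrite !big_ord_recr /= IH; ring.
Qed.
End AbelSummation.

(** With gl_r coordinates, the form is the standard one on the projections of x and y to sum 0; Abel
    summation converts the sums over fundamental weights. *)
Lemma wformE (r : nat) (mu nu : weight r) (x y : nat -> rat) : (0 < r)%N ->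
  (forall j, (mu 0 j)%:~R = x j - x j.+1) -> (forall j, (nu 0 j)%:~R = y j - y j.+1) ->
  wform mu nu = \sum_(i < r) x i * y i - (\sum_(i < r) x i) * (\sum_(i < r) y i) / r%:R.
Proof.
case: r mu nu => [//|N] mu nu _ hx hy; rewrite /wform /=.
transitivity (\sum_(i < N) (x i - x i.+1) * (\sum_(j < i.+1) y j - i.+1%:R * y N) -
   (\sum_(i < N) (x i - x i.+1) * i.+1%:R) * (\sum_(j < N) (y j - y j.+1) * j.+1%:R) / N.+1%:R).
  rewrite -mulrA mulr_suml -sumrB; apply: eq_bigr => i _.
  rewrite -(abel_min y (ltn_ord i)) mulrA -mulrA [X in _ = _ - X]mulrC.
  rewrite mulr_sumr !mulr_suml -sumrB; apply: eq_bigr => j _.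
  rewrite hx hy natrM; ring.
rewrite !abel_index (eq_bigr (fun i : 'I_N => (x i - x i.+1) * (\sum_(j < i.+1) y j) -
    (x i - x i.+1) * i.+1%:R * y N)); last by move=> i _; ring.
rewrite sumrB abel_prefix -mulr_suml abel_index !big_ord_recr /=.
have N0 : N%:R + 1 != 0 :> rat by rewrite natr1 pnatr_eq0.
by rewrite -natr1; field.
Qed.

Lemma tridiagonal_sum (f : nat -> int) M k : (k < M)%N ->
  \sum_(j < M) f j * (if k == j then 2 else
     if (k.+1 == j) || (j.+1 == k) then -1 else 0) =
  2 * f k - (if (k.+1 < M)%N then f k.+1 else 0) - (if (0 < k)%N then f k.-1 else 0).
Proof.
move=> kM; have pick a : \sum_(j < M) (if j == a :> nat then f j else 0) = if (a < M)%N then f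
  a else 0.
  rewrite -big_mkcond /=; case: ltnP => [aM|Ma]; first by rewrite (big_pred1 (Ordinal aM)).
  by rewrite big_pred0 // => j; apply/negbTE/eqP => e; have := ltn_ord j; rewrite e ltnNge Ma.
have pick' : \sum_(j < M) (if j.+1 == k then f j else 0) = if (0 < k)%N then f k.-1 else 0.
  case: k kM => [|k] kM; first by rewrite big1.
  by rewrite (pick k) ltnW.
rewrite -(pick k.+1) -pick'.
have -> : 2 * f k = 2 * \sum_(j < M) (if j == k :> nat then f j else 0) by rewrite pick kM.
rewrite mulr_sumr -!sumrB; apply: eq_bigr => j _; rewrite [k == j]eq_sym [k.+1 == j]eq_sym.
case: (eqVneq (j : nat) k) => [->|jk].
  by rewrite (ltn_eqF (leqnn k.+1)) (gtn_eqF (leqnn k.+1)) subr0 subr0 mulrC.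
case: (eqVneq (j : nat) k.+1) => [->|_] /=; last by case: eqP; lia.
by rewrite (gtn_eqF _) //; lia.
Qed.

Lemma root_latticeP (r : nat) (v : weight r) : (2 <= r)%N ->
  root_lattice v <-> exists t : int, \sum_(j < r.-1) (j.+1%:Z * v 0 j) = r%:Z * t.
Proof.
case: r v => [//|[//|N]] v _ /=.
have row_sum (c : 'rV[int]_N.+1) (k : 'I_N.+1) :
    \sum_(j < N.+1) j.+1%:Z * (if k == j then 2 else
      if (k.+1 == j :> nat) || (j.+1 == k :> nat) then -1 else 0) = (k == ord_max)%:R * N.+2%:Z.
  have -> : (k == ord_max) = (k == N :> nat) by [].
  rewrite (tridiagonal_sum (fun j => j.+1%:Z) (ltn_ord k)).
  have := ltn_ord k; rewrite ltnS => kN; move: (nat_of_ord k) kN => {}k kN.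
  rewrite ltnS; have [kN'|] := ltnP k N; first by rewrite (ltn_eqF kN') mul0r;
    case: k {kN kN'} => [|k] /=; lia.
  move=> Nk; have -> : k = N by lia.
  by rewrite eqxx mul1r; case: N {k kN Nk c v} => [|k] /=; lia.
split=> [[c ->]|[t ht]].
  exists (c 0 ord_max).
  under eq_bigr do rewrite mxE mulr_sumr.
  rewrite exchange_big /= (eq_bigr (fun k => c 0 k * ((k == ord_max)%:R * N.+2%:Z))).
    rewrite (bigD1 ord_max) //= big1 ?addr0 ?eqxx ?mul1r 1?mulrC // => k kN.
    by rewrite (negbTE kN) mul0r mulr0.
  move=> k _; rewrite -(row_sum c) mulr_sumr; apply: eq_bigr => j _.
  by rewrite mxE mulrCA.
(* The inverse Cartan matrix min(k, l) - k l / r applied to [v], the hypothesis on t making it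
   integral. It vanishes at 0 and at r, so that the Cartan matrix acts as a second difference up to
   the boundary. *)
pose C (k : nat) : int := \sum_(j < N.+1) (minn k j.+1)%:Z * v 0 j - k%:Z * t.
exists (\row_k C k.+1); apply/rowP => j; rewrite mxE.
have C0 : C 0%N = 0 by rewrite /C mul0r subr0 big1 // => k _; rewrite min0n mul0r.
have CN : C N.+2 = 0.
  rewrite /C -ht -sumrB big1 // => k _; rewrite (minn_idPr _) ?subrr //.
  by rewrite ltnW // ltnS.
rewrite (eq_bigr (fun k : 'I_N.+1 => C k.+1 * (if j == k :> nat then 2 else
    if (j.+1 == k) || (k.+1 == j) then -1 else 0))); last first.
  by move=> k _; rewrite !mxE [k == j]eq_sym orbC.
rewrite (tridiagonal_sum (fun k => C k.+1) (ltn_ord j)).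
have -> : (if (j.+1 < N.+1)%N then C j.+2 else 0) = C j.+2.
  case: ltnP => // jN; have -> : j.+2 = N.+2 by have := ltn_ord j; lia.
  by rewrite CN.
have -> : (if (0 < j)%N then C j.-1.+1 else 0) = C j.
  by case: (nat_of_ord j) => [|k] /=; rewrite ?C0.
rewrite /C.
have -> : v 0 j = \sum_(k < N.+1) (2 * (minn j.+1 k.+1)%:Z - (minn j.+2 k.+1)%:Z - (minn j
  k.+1)%:Z) * v 0 k.
  rewrite (bigD1 j) //= big1 ?addr0 => [|k kj].
    rewrite minnn (minn_idPr _) // (minn_idPl _) //; by rewrite -[LHS]mul1r; congr (_ * _); lia.
  rewrite (_ : 2 * _ - _ - _ = 0) ?mul0r //; have {}kj : (k : nat) <> j.
    by move=> e; case/eqP: kj; apply: val_inj.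
  move: (nat_of_ord k) (nat_of_ord j) kj => {}k {}j kj.
  by rewrite /minn; case: (ltnP j.+1) => h1; case: (ltnP j.+2) => h2; case: (ltnP j) => h3; lia.
under eq_bigr do rewrite !mulrBl -mulrA.
rewrite !sumrB -mulr_sumr !intS; ring.
Qed.

Lemma sumn_nth M (s : seq nat) : (size s <= M)%N -> sumn s = (\sum_(j < M) nth 0 s j)%N.
Proof.
move=> sM; rewrite sumnE (big_nth 0%N) big_mkord.
rewrite [LHS](big_ord_widen_cond M predT (fun j => nth 0%N s j)) //=.
by rewrite big_mkcond; apply: eq_bigr => j _ /=; case: ltnP => // h; rewrite nth_default.
Qed.

Lemma nth_filter_pos (s : seq nat) j : sorted geq s ->
  nth 0%N [seq x <- s | (0 < x)%N] j = nth 0%N s j.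
Proof.
elim: s j => [//|x s IH] j /= sx; have ss := path_sorted sx.
case: (posnP x) => [x0|_]; last by case: j => //= j; exact: IH.
have sall : all (fun y => y == 0)%N s.
  move: sx; rewrite x0 (path_sortedE (rev_trans leq_trans)) => /andP[/allP h _].
  by apply/allP => y /h /=; rewrite leqn0.
rewrite (eq_in_filter (a2 := pred0)) ?filter_pred0; last first.
  by move=> y /(allP sall) /eqP ->.
rewrite nth_nil x0; case: j => [//|j] /=; have [js|sj] := ltnP j (size s).
  by rewrite (eqP (allP sall _ (mem_nth 0%N js))).
by rewrite nth_default.
Qed.

Lemma sorted_mkseq_geq (f : nat -> nat) M : (forall j, (f j.+1 <= f j)%N) -> sorted geq (mkseq f M).
Proof.
move=> hf; apply/(sortedP 0%N) => i; rewrite size_mkseq => iM.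
by rewrite !nth_mkseq ?(ltnW iM) //; exact: hf.
Qed.

Lemma eq_nth_pos (s t : seq nat) : 0%N \notin s -> 0%N \notin t ->
  (forall j, nth 0%N s j = nth 0%N t j) -> s = t.
Proof.
have le_size u v : 0%N \notin v -> (forall j, nth 0%N u j = nth 0%N v j) -> (size v <= size u)%N.
  move=> v0 h; rewrite leqNgt; apply/negP => uv; move: (h (size u)).
  by rewrite nth_default // => e; move: v0; rewrite e mem_nth.
move=> s0 t0 h; apply: (eq_from_nth (x0 := 0%N)) => [|j _]; last exact: h.
by apply/eqP; rewrite eqn_leq !le_size.
Qed.

Section WeightPartition.
Variable r : nat.
Hypothesis r2 : (2 <= r)%N.
Implicit Type mu : weight r.

Let wp_fun mu j := (\sum_(k < r.-1 | (j <= k)%N) `|mu 0%R k|)%N.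

Let wp_fun_le mu j : (wp_fun mu j.+1 <= wp_fun mu j)%N.
Proof.
rewrite /wp_fun big_mkcond [leqRHS]big_mkcond; apply: leq_sum => k _.
by case: ltnP => // /ltnW ->.
Qed.

Lemma nth_wp mu j : nth 0%N (weight_partition mu) j = (\sum_(k < r.-1 | (j <= k)%N) `|mu 0%R k|)%N.
Proof.
rewrite nth_filter_pos; last by apply: sorted_mkseq_geq => k; exact: wp_fun_le.
have [jr|rj] := ltnP j r.-1; first by rewrite nth_mkseq.
rewrite nth_default ?size_mkseq // big_pred0 // => k.
by apply/negbTE; rewrite -ltnNge (leq_trans (ltn_ord k)).
Qed.

Lemma wp_sorted mu : sorted geq (weight_partition mu).
Proof.
apply: sorted_filter; first exact: (rev_trans leq_trans).
by apply: sorted_mkseq_geq => k; exact: wp_fun_le.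
Qed.

Lemma wp_size mu : (size (weight_partition mu) <= r.-1)%N.
Proof. by rewrite size_filter (leq_trans (count_size _ _)) // size_mkseq. Qed.

Lemma nth_wp_step mu (j : 'I_r.-1) :
  nth 0%N (weight_partition mu) j = (`|mu 0%R j| + nth 0%N (weight_partition mu) j.+1)%N.
Proof.
rewrite !nth_wp (bigD1 j) //=; congr (_ + _)%N; apply: eq_bigl => k.
by rewrite -(inj_eq val_inj) /= eq_sym ltn_neqAle andbC.
Qed.

Lemma sumn_wp mu : sumn (weight_partition mu) = (\sum_(j < r.-1) j.+1 * `|mu 0%R j|)%N.
Proof.
rewrite (sumn_nth (wp_size mu)); under eq_bigr do rewrite nth_wp big_mkcond.
rewrite exchange_big /=; apply: eq_bigr => k _; rewrite -big_mkcond /= sum_nat_const.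
congr (_ * _)%N; transitivity (\sum_(j < r.-1 | (j < k.+1)%N) 1)%N; first by rewrite sum1_card.
by rewrite -(big_ord_widen _ (fun=> 1%N) (ltn_ord k)) sum1_card card_ord.
Qed.

Definition mu_of (la : seq nat) : weight r :=
  \row_j ((nth 0%N la j)%:Z - (nth 0%N la j.+1)%:Z).

Lemma mu_of_wp mu : dominant mu -> mu_of (weight_partition mu) = mu.
Proof.
move=> d; apply/rowP => j; rewrite mxE nth_wp_step; have := d j; lia.
Qed.

(** [la] consists of the partition of its weight and of full columns, as many as its r-th part. *)
Lemma nth_la_wp la j : sorted geq la -> (j < r)%N ->
  nth 0%N la j = (nth 0%N (weight_partition (mu_of la)) j + nth 0%N la r.-1)%N.
Proof.
move=> las; have [d] := ubnP (r.-1 - j); elim: d j => // d IH j dj jr.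
have [jr1|] := ltnP j r.-1; last first.
  move=> rj; have -> : j = r.-1 by lia.
  rewrite [X in (X + _)%N]nth_default ?add0n //; exact: wp_size.
have := nth_wp_step (mu_of la) (Ordinal jr1); rewrite mxE /= => ->.
have := IH j.+1; have := nth_la_le las j; lia.
Qed.

Lemma dominant_mu_of la : sorted geq la -> dominant (mu_of la).
Proof. by move=> las j; rewrite mxE; have := nth_la_le las j; lia. Qed.

Lemma sumn_mu_of la : sorted geq la -> (size la <= r)%N ->
  sumn la = (r * nth 0%N la r.-1 + sumn (weight_partition (mu_of la)))%N.
Proof.
move=> las lar; rewrite (sumn_nth lar) (sumn_nth (leq_trans (wp_size _) (leq_pred r))).
under eq_bigr => j _ do rewrite (nth_la_wp las (ltn_ord j)).
by rewrite big_split /= sum_nat_const card_ord addnC.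
Qed.

(** The class of a weight modulo the root lattice is the size of its partition modulo r, and i
    Lambda_1 has size i. *)
Lemma coset_wp mu i : dominant mu ->
  root_lattice (mu - Lambda1 r *+ i) <->
  exists t : int, (sumn (weight_partition mu))%:Z - i%:Z = r%:Z * t.
Proof.
move=> d; rewrite root_latticeP //.
suff -> : \sum_(j < r.-1) j.+1%:Z * (mu - Lambda1 r *+ i) 0 j = (sumn (weight_partition mu))%:Z
  - i%:Z by [].
have L1 k (j : 'I_r.-1) : (Lambda1 r *+ k) 0 j = k%:Z * (j == 0 :> nat)%:R.
  elim: k => [|k IH]; first by rewrite mulr0n mxE mul0r.
  by rewrite mulrS mxE IH mxE intS mulrDl mul1r.
have E (j : 'I_r.-1) : (mu - Lambda1 r *+ i) 0 j = mu 0 j - i%:Z * (j == 0 :> nat)%:R.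
  by rewrite !mxE -L1.
under eq_bigr => j _ do rewrite E mulrBr.
rewrite sumrB sumn_wp (big_morph Posz PoszD (erefl _)); congr (_ - _).
  by apply: eq_bigr => j _; rewrite PoszM; congr (_ * _); have := d j; lia.
have r1 : (0 < r.-1)%N by lia.
rewrite (bigD1 (Ordinal r1)) //= big1 ?addr0 ?mulr1 ?mul1r // => j j0.
by have -> : (j == 0 :> nat) = false; [apply/negbTE|rewrite !mulr0].
Qed.
End WeightPartition.

Lemma kappaE r (la : seq nat) : (size la <= r)%N ->
  (kappa la)%:~R = \sum_(i < r) ((nth 0%N la i)%:R ^+ 2 - (nth 0%N la i)%:R
     - 2 * i%:R * (nth 0%N la i)%:R) :> rat.
Proof.
move=> lar; rewrite /kappa.
have inner (i m : nat) : 2 * \sum_(j < m) (j%:Z - i%:Z) = m%:Z ^+ 2 - m%:Z - 2 * i%:Z * m%:Z.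
  elim: m => [|m IH]; first by rewrite big_ord0; ring.
  by rewrite big_ord_recr /= mulrDr IH !intS; ring.
rewrite mulr_sumr; under eq_bigr do rewrite inner.
rewrite (big_ord_widen_cond r predT (fun i => (nth 0%N la i)%:Z ^+ 2 - (nth 0%N la i)%:Z
   - 2 * i%:Z * (nth 0%N la i)%:Z)) //= big_mkcond rmorph_sum /=.
apply: eq_bigr => i _; case: ltnP => h; last by rewrite nth_default //; ring.
by rewrite !rmorphB !rmorphM /=.
Qed.

Section Exponents.
Variable r : nat.
Hypothesis r2 : (2 <= r)%N.
Implicit Type mu : weight r.

Local Notation qform mu := (wform mu (mu + weyl_vector r *+ 2)).

Lemma weyl_entry mu j : (mu + weyl_vector r *+ 2) 0 j = mu 0 j + 2.
Proof. by rewrite mulr2n !mxE. Qed.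

Lemma qform_kappa n la : (size la <= r)%N -> sumn la = (n * r.+1)%N ->
  qform (mu_of r la) = (kappa la)%:~R +
    (- (n%:R ^+ 2 * r.+1%:R ^+ 2) / r%:R + n%:R * r%:R * r.+1%:R).
Proof.
move=> lar lan; have r0 : r%:R != 0 :> rat by rewrite pnatr_eq0; lia.
(* The Weyl vector has the coordinates - j up to a common constant, which the form ignores, as it
   ignores full columns. *)
rewrite (@wformE r _ _ (fun j => (nth 0%N la j)%:R) (fun j => (nth 0%N la j)%:R - 2 * j%:R));
  last first.
- by move=> j; rewrite weyl_entry mxE rmorphD rmorphB /= -natr1; ring.
- by move=> j; rewrite mxE rmorphB.
- lia.
rewrite (kappaE lar).
have S1 : \sum_(i < r) (nth 0%N la i)%:R = n%:R * r.+1%:R :> rat.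
  by rewrite -natr_sum -(sumn_nth lar) lan natrM.
have S0 : \sum_(i < r) (i%:R : rat) = r%:R * (r%:R - 1) / 2.
  elim: (r) => [|k IH]; first by rewrite big_ord0 !mul0r.
  by rewrite big_ord_recr /= IH -natr1; field.
rewrite [\sum_(i < r) (_ - 2 * _)]sumrB -mulr_sumr S1 S0.
have -> : \sum_(i < r) (nth 0%N la i)%:R * ((nth 0%N la i)%:R - 2 * i%:R) =
   \sum_(i < r) ((nth 0%N la i)%:R ^+ 2 - (nth 0%N la i)%:R - 2 * i%:R * (nth 0%N la i)%:R)
   + n%:R * r.+1%:R :> rat.
  rewrite -S1 -big_split; apply: eq_bigr => i _ /=; ring.
by rewrite -natr1; field.
Qed.

Let coef_ge0 (i j : 'I_r.-1) :
  0 <= (minn i.+1 j.+1)%:R - (i.+1 * j.+1)%N%:R / r%:R :> rat.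
Proof.
rewrite subr_ge0 ler_pdivrMr ?ltr0n; last by lia.
rewrite -natrM ler_nat; have := ltn_ord i; have := ltn_ord j.
move: (nat_of_ord i) (nat_of_ord j) => {}i {}j hj hi.
case: (leqP i.+1 j.+1) => h; first by rewrite leq_mul2l; lia.
by rewrite mulnC leq_mul2l; lia.
Qed.

Let coef_diag (j : 'I_r.-1) :
  1 / 2 <= (minn j.+1 j.+1)%:R - (j.+1 * j.+1)%N%:R / r%:R :> rat.
Proof.
have r0 : 0 < r%:R :> rat by rewrite ltr0n; lia.
have jr := ltn_ord j; move: (nat_of_ord j) jr => k kr; rewrite minnn.
have hk : (r + 2 * (k.+1 * k.+1) <= 2 * (k.+1 * r))%N by nia.
have {}hk : r%:R + 2 * (k.+1%:R * k.+1%:R) <= 2 * (k.+1%:R * r%:R) :> rat.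
  by rewrite -!natrM -natrD ler_nat.
rewrite -subr_ge0 natrM.
have -> : k.+1%:R - k.+1%:R * k.+1%:R / r%:R - 1 / 2 =
    (2 * (k.+1%:R * r%:R) - (r%:R + 2 * (k.+1%:R * k.+1%:R))) / (2 * r%:R) :> rat.
  by field; rewrite gt_eqF.
by apply: divr_ge0; [rewrite subr_ge0|rewrite mulr_ge0 // ltW].
Qed.

(** All the entries of the inverse Cartan matrix are non-negative and its diagonal ones are at least
    1/2: keep the diagonal terms. *)
Lemma qform_ge mu : dominant mu ->
  \sum_(j < r.-1) ((mu 0 j)%:~R ^+ 2 / 2) <= qform mu.
Proof.
move=> d; apply: ler_sum => i _.
rewrite (bigD1 i) //=; apply: ler_wpDr; last first.
  have m0 : 0 <= (mu 0 i)%:~R :> rat by rewrite ler0z.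
  have := coef_diag i; rewrite weyl_entry rmorphD /=.
  move: (_ - _ / _) (mu 0 i)%:~R m0 => q x x0 hq.
  have h : 0 <= x * (x + 2) * (q - 1 / 2) by rewrite mulr_ge0 ?subr_ge0 // mulr_ge0 // addr_ge0.
  nra.
apply: sumr_ge0 => j _; apply: mulr_ge0; last exact: coef_ge0.
by apply: mulr_ge0; rewrite ler0z ?weyl_entry ?addr_ge0.
Qed.

Lemma gt_weight_ge la c : gt_pattern r la c -> (size la <= r)%N ->
  - (r%:R * (sumn la)%:R) <= gt_weight r c.
Proof.
move=> hc lar; rewrite /gt_weight.
have -> : - (r%:R * (sumn la)%:R) =
    \sum_(a < r) ((gt_total r c a.+1)%:R - (gt_total r c a)%:R) * (- r%:R) :> rat.
  rewrite -mulr_suml -(big_mkord predT (fun a => (gt_total r c a.+1)%:R - (gt_total r c a)%:R)).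
  rewrite telescope_sumr // (gt_total0 r hc) subr0 mulrN mulrC; congr (- (_%:R * _)).
  rewrite (sumn_nth lar); apply: eq_bigr => j _; by case: hc => _ _ -> .
apply: ler_sum => a _; apply: ler_wpM2l.
  by rewrite subr_ge0 ler_nat; apply: leq_sum => j _; case: hc.
rewrite /qexponent; have : (a%:R : rat) <= r%:R - 1.
  by rewrite lerBrDr natr1 ler_nat.
have : 0 <= r%:R :> rat by [].
lra.
Qed.

(* The constant comes from b x <= x^2 / 2 + b^2, where x is a coordinate of mu
   and b = r^2 + 1. *)
Definition wbound : rat := r%:R * (r%:R ^+ 2 + 1) ^+ 2.

(** Let s be the sum of the coordinates of mu. The partition has size at most r s, so a tableau
    lowers the exponent by at most r^2 s, while the quadratic part is at least (1 + r^2) s -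
    [wbound]. Hence s <= e + [wbound], and the coefficient of q^e only sees finitely many mu. *)
Lemma term_bound p mu c e : (2 <= p)%N -> dominant mu ->
  gt_pattern r (weight_partition mu) c ->
  e = p%:R / 2 * qform mu + gt_weight r c ->
  (sumn (weight_partition mu))%:R <= r%:R * (e + wbound).
Proof.
move=> p2 d hc ->.
set s := \sum_(j < r.-1) (mu 0 j)%:~R : rat.
have m0 j : 0 <= (mu 0 j)%:~R :> rat by rewrite ler0z.
have s0 : 0 <= s by apply: sumr_ge0.
have ws : (sumn (weight_partition mu))%:R <= r%:R * s.
  rewrite sumn_wp natr_sum mulr_sumr; apply: ler_sum => j _.
  rewrite natrM; have -> : (`|mu 0%R j|%N)%:R = (mu 0 j)%:~R :> rat.
    by rewrite -[LHS]/((`|mu 0%R j|%N%:Z)%:~R) gez0_abs.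
  by apply: ler_wpM2r => //; rewrite ler_nat; have := ltn_ord j; lia.
have gw : - (r%:R * (r%:R * s)) <= gt_weight r c.
  apply: le_trans (gt_weight_ge hc _); last by rewrite (leq_trans (wp_size _)) // leq_pred.
  by rewrite lerN2 ler_wpM2l.
have q0 := qform_ge d.
have q1 : s + r%:R * (r%:R * s) - wbound <= \sum_(j < r.-1) ((mu 0 j)%:~R ^+ 2 / 2).
  set b := r%:R ^+ 2 + 1 : rat.
  have -> : s + r%:R * (r%:R * s) = \sum_(j < r.-1) b * (mu 0 j)%:~R :> rat.
    by rewrite -mulr_sumr -/s /b; ring.
  rewrite lerBlDr; apply: (@le_trans _ _ (\sum_(j < r.-1) ((mu 0 j)%:~R ^+ 2 / 2 + b ^+ 2))).
    by apply: ler_sum => j _; nra.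
  rewrite big_split /= lerD2l sumr_const card_ord -mulr_natl /wbound -/b.
  by apply: ler_wpM2r; rewrite ?exprn_ge0 ?ler_nat ?leq_pred // addr_ge0 // exprn_ge0.
have qp : qform mu <= p%:R / 2 * qform mu.
  apply: ler_peMl; last by rewrite ler_pdivlMr // mul1r ler_nat.
  by apply: le_trans q0; apply: sumr_ge0 => j _; rewrite divr_ge0 // exprn_ge0.
apply: le_trans ws _; apply: ler_wpM2l => //; lra.
Qed.
End Exponents.

(** * The limit *)

Section Limit.
Variables (R : realType) (r p i : nat).
Hypotheses (r2 : (2 <= r)%N) (p2 : (2 <= p)%N).

Let r0 : (0 < r)%N. Proof. exact: ltnW. Qed.

Local Notation qform mu := (wform mu (mu + weyl_vector r *+ 2)).

Lemma schur_support (mu : weight r) e : dominant mu ->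
  schur (weight_partition mu) (principal r) (e - p%:R / 2 * qform mu) != 0 ->
  (sumn (weight_partition mu))%:R <= r%:R * (e + wbound r).
Proof.
have wr : (size (weight_partition mu) <= r)%N by rewrite (leq_trans (wp_size mu)) // leq_pred.
move=> d; rewrite (schur_gt (wp_sorted mu) wr) => h.
have [c [hc he]] : exists c, gt_pattern r (weight_partition mu) c /\
    e - p%:R / 2 * qform mu = gt_weight r c.
  apply: contra_neqP h => /forallNP h; apply: fsbig1 => c hc.
  by case: eqP => // he; case: (h c).
by apply: (term_bound r2 p2 d hc); rewrite -he addrC subrK.
Qed.

Lemma dim_irr_gt (mu : weight r) : dominant mu ->
  dim_irr R mu = #|` fset_set (gt_pattern r (weight_partition mu))|.
Proof.
move=> d; have wr : (size (weight_partition mu) <= r)%N by rewrite (leq_trans (wp_size mu)) //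
  leq_pred.
rewrite -(card_ssyt_gt r (wp_sorted mu)).
apply: dim_irr_ssyt => // [|j]; first exact: wp_sorted.
by rewrite -{1}(mu_of_wp r2 d) mxE.
Qed.

Section Shape.
Variables (n : nat) (la : seq nat).
Hypotheses (la_part : is_partition (n * r.+1) la) (la_size : (size la <= r)%N).

Local Notation mu := (mu_of r la).

Let la_sorted : sorted geq la. Proof. by case: la_part. Qed.
Let la_sum : sumn la = (n * r.+1)%N. Proof. by case: la_part. Qed.
Let wr : (size (weight_partition mu) <= r)%N.
Proof. by rewrite (leq_trans (wp_size mu)) // leq_pred. Qed.

Let shape_nth j :
  nth 0%N la j = (nth 0 (weight_partition mu) j + nth 0 la r.-1 * (j < r))%N.
Proof.
have [jr|rj] := ltnP j r; first by rewrite muln1 (nth_la_wp r2 la_sorted jr).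
by rewrite muln0 addn0 !nth_default // (leq_trans _ rj).
Qed.

Lemma schur_shape e : schur la (principal r) e = schur (weight_partition mu) (principal r) e.
Proof.
rewrite (schur_gt la_sorted la_size) (schur_gt (wp_sorted mu) wr).
rewrite (reindex_fsbig _ _ _ _ (gt_shift_bij (wp_sorted mu) wr shape_nth)).
by apply: eq_fsbigr => c _; rewrite gt_weight_shift.
Qed.

(** Stabilization with c0 the last part of [la] and w the size of the partition of mu, followed by
    the removal of the full columns. *)
Lemma kostka_shape : (r.+1 * sumn (weight_partition mu) <= n)%N ->
  kostka la (nseq r.+1 n) = dim_irr R mu.
Proof.
move=> hn; rewrite (kostka_gt la_sorted la_size la_sum).
rewrite (dim_irr_gt (dominant_mu_of r2 la_sorted)).
have ge j : (j < r)%N -> (nth 0 la r.-1 <= nth 0 la j)%N.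
  by move=> jr; rewrite (nth_la_wp r2 la_sorted jr) leq_addl.
have bij := gt_trim_bij r0 la_size ge (sumn_mu_of r2 la_sorted la_size) la_sum hn.
have fA : finite_set (gt_pattern r.+1 la `&` column_weight r n)%classic.
  by apply: finite_setIl; exact: finite_gt_pattern.
have [_ ->] := set_bij_card fA bij.
by have [_ ->] := set_bij_card (finite_gt_pattern r (wp_sorted mu)) (gt_shift_bij (wp_sorted
  mu) wr shape_nth).
Qed.
End Shape.

Let full_columns n (mu : weight r) := ((n * r.+1 - sumn (weight_partition mu)) %/ r)%N.

Let shape_of n (mu : weight r) : seq nat :=
  [seq x <- mkseq (fun j => (nth 0 (weight_partition mu) j + full_columns n mu)%N) r | (0 < x)%N].

Let nth_shape_of n mu j : nth 0%N (shape_of n mu) j =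
  if (j < r)%N then (nth 0 (weight_partition mu) j + full_columns n mu)%N else 0%N.
Proof.
rewrite nth_filter_pos; last first.
  by apply: sorted_mkseq_geq => k; rewrite leq_add2r nth_la_le // wp_sorted.
case: ltnP => jr; first by rewrite nth_mkseq.
by rewrite nth_default // size_mkseq.
Qed.

(** The truncation at M <= n makes room for the boxes: every such mu comes from a partition of n (r
    + 1). *)
Lemma shape_bij n M : (M <= n)%N -> n = i %[mod r] ->
  set_bij
    ([set la | is_partition (n * r.+1) la /\ (size la <= r)%N] `&`
     [set la | (sumn (weight_partition (mu_of r la)) <= M)%N])%classic
    ([set mu : weight r | root_lattice (mu - Lambda1 r *+ i) /\ dominant mu] `&`
     [set mu | (sumn (weight_partition mu) <= M)%N])%classic
    (mu_of r).
Proof.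
move=> Mn ni; apply: (set_bij_can (g := shape_of n)).
- move=> la [/= [[la_s la_0 la_n] la_r] hM]; split=> //=; split; last exact: (dominant_mu_of r2).
  apply/(coset_wp r2); first exact: (dominant_mu_of r2).
  (* The size of the partition of the weight is n (r + 1) minus r times the last part; subtract i
     and divide by r, n and i having the same remainder. *)
  exists ((n %/ r)%:Z - (i %/ r)%:Z + n%:Z - (nth 0%N la r.-1)%:Z).
  have := sumn_mu_of r2 la_s la_r; rewrite la_n.
  have := divn_eq n r; have := divn_eq i r; rewrite ni; nia.
- move=> mu [/= [hc d] hM]; have [t ht] := (coset_wp r2 i d).1 hc.
  (* Modulo r, n (r + 1) is n, hence i, hence the size of the partition of mu. *)
  have dvd : (r %| n * r.+1 - sumn (weight_partition mu))%N.
    rewrite -eqn_mod_dvd; last by rewrite (leq_trans hM) // (leq_trans Mn) // leq_pmulr.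
    rewrite mulnS addnC modnMDl ni; apply/eqP.
    have [[k hk]|[k hk]] : (exists k, sumn (weight_partition mu) = i + k * r)%N \/
        (exists k, i = sumn (weight_partition mu) + k * r)%N.
    - by case: t ht => t ht; [left; exists t|right; exists t.+1]; nia.
    - by rewrite hk addnC modnMDl.
    - by rewrite {1}hk addnC modnMDl.
  have hsum : (r * full_columns n mu + sumn (weight_partition mu) = n * r.+1)%N.
    rewrite mulnC /full_columns divnK // subnK //.
    by rewrite (leq_trans hM) // (leq_trans Mn) // leq_pmulr.
  have sz : (size (shape_of n mu) <= r)%N.
    by rewrite size_filter (leq_trans (count_size _ _)) // size_mkseq.
  have mk : mu_of r (shape_of n mu) = mu.
    rewrite -[RHS](mu_of_wp r2 d); apply/rowP => j; rewrite !mxE !nth_shape_of.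
    have jr : (j.+1 < r)%N by have := ltn_ord j; lia.
    by rewrite jr (ltnW jr); lia.
  split=> /=; last by rewrite mk.
  split=> //; split.
  + apply: sorted_filter; first exact: (rev_trans leq_trans).
    by apply: sorted_mkseq_geq => k; rewrite leq_add2r nth_la_le // wp_sorted.
  + by rewrite mem_filter.
  rewrite (sumn_nth sz); under eq_bigr do rewrite nth_shape_of ltn_ord.
  rewrite big_split /= sum_nat_const card_ord addnC -hsum; congr (_ + _)%N.
  by rewrite -sumn_nth // (leq_trans (wp_size mu)) // leq_pred.
- move=> la [/= [[la_s la_0 la_n] la_r] hM]; apply: eq_nth_pos => //; first by rewrite mem_filter.
  move=> j; rewrite nth_shape_of; case: ltnP => jr; last by rewrite nth_default // (leq_trans la_r).
  rewrite (nth_la_wp r2 la_s jr); congr (_ + _)%N.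
  by rewrite /full_columns -la_n (sumn_mu_of r2 la_s la_r) addnK mulKn.
move=> mu [/= [hc d] hM]; rewrite -[RHS](mu_of_wp r2 d); apply/rowP => j;
  rewrite !mxE !nth_shape_of.
have jr : (j.+1 < r)%N by have := ltn_ord j; lia.
by rewrite jr (ltnW jr); lia.
Qed.
End Limit.

Theorem theorem6 (R : realType) (r p i : nat)
    (hr : (2 <= r)%N) (hp : (2 <= p)%N) (hi : (i <= r.-1)%N) :
  qcvg (fun n : nat => n = i %[mod r])
    (fun n : nat =>
       qmul
         (qmon (p%:R / 2 *
            (- (n%:R ^+ 2 * r.+1%:R ^+ 2) / r%:R + n%:R * r%:R * r.+1%:R)))
         (J r r.+1 p n))
    (qmul
       (qmul (qpow qpoch r.-1) (qinv (qvandermonde r)))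
       (triplet_char R p (Lambda1 r *+ i))).
Proof.
move=> e; rewrite /triplet_char; set D := [set mu : weight r | _]%classic.
set F := fun mu : weight r => _; set S := qsum D F.
have FE mu x : F mu x = (dim_irr R mu)%:Z *
    schur (weight_partition mu) (principal r) (x - p%:R / 2 * wform mu (mu + weyl_vector r *+ 2)).
  by rewrite /F /qscale qmul_monE.
have Fsupp mu x : D mu -> F mu x != 0 ->
    (sumn (weight_partition mu))%:R <= r%:R * (x + wbound r).
  move=> [_ d]; rewrite FE mulf_eq0 negb_or => /andP[_]; exact: schur_support.
(* The size bound of [Fsupp] is non-negative, which bounds the exponents from below and allows the
   cancellation of the prefactors. *)
have Sb : lower_bounded (- wbound r) S.
  move=> x Sx; have [mu [Dmu Fmu]] : exists mu, D mu /\ F mu x != 0.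
    apply: contra_neqP Sx => /forallNP h; apply: fsbig1 => mu Dmu.
    by apply/eqP; apply: contraT => Fmu; case: (h mu).
  have := Fsupp _ _ Dmu Fmu; move=> /(le_trans (ler0n _ _)).
  by rewrite pmulr_rge0 ?ltr0n ?(ltnW hr) // -lerBlDr sub0r.
rewrite (qmul_cancel (unit_qpow _ unit_qpoch) (unit_qvandermonde r) Sb).
have [M hM] := ratr_bound (r%:R * (e + wbound r)).
have small mu : D mu -> F mu e != 0 -> (sumn (weight_partition mu) <= M)%N.
  by move=> Dmu /(Fsupp _ _ Dmu) h; rewrite ltnW // -(ltr_nat rat) (le_lt_trans h).
(* For this n, [kostka_shape] applies to every weight whose partition has size at most M. *)
exists (r.+1 * M)%N => n nM ni; rewrite qmul_monE.
have Mn : (M <= n)%N by apply: leq_trans nM; rewrite leq_pmull.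
pose A := [set la : seq nat | is_partition (n * r.+1) la /\ (size la <= r)%N]%classic.
have bij := shape_bij hr hp Mn ni.
pose As := [set la : seq nat | (sumn (weight_partition (mu_of r la)) <= M)%N]%classic.
pose Ds := [set mu : weight r | (sumn (weight_partition mu) <= M)%N]%classic.
(* By the choice of M, the truncation loses nothing in the coefficient of q^e; it makes [shape_bij]
   applicable. *)
have -> : S e = \sum_(mu \in (D `&` Ds)%classic) F mu e.
  rewrite /S /qsum; apply/esym/fsbig_widen; first by move=> mu [].
  move=> mu [Dmu hmu] /=; apply/eqP; apply: contraT => Fmu.
  by case: hmu; split=> //; exact: small.
rewrite (reindex_fsbig _ _ _ _ bij) /J /qsum -/A -/As.
have termE la : A la ->
    qscale (kostka la (nseq r.+1 n))%:Z (qmul (qmon (p%:R / 2 * (kappa la)%:~R)) (schur la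
      (principal r)))
      (e - p%:R / 2 * (- (n%:R ^+ 2 * r.+1%:R ^+ 2) / r%:R + n%:R * r%:R * r.+1%:R)) =
    (kostka la (nseq r.+1 n))%:Z * schur (weight_partition (mu_of r la)) (principal r)
      (e - p%:R / 2 * wform (mu_of r la) (mu_of r la + weyl_vector r *+ 2)).
  move=> [lap lar]; rewrite /qscale qmul_monE (schur_shape hr lap lar).
  have [_ _ lan] := lap; rewrite (qform_kappa hr lar lan); congr (_ * schur _ _ _); ring.
transitivity (\sum_(la \in (A `&` As)%classic) F (mu_of r la) e) => //.
(* The same truncation for the link invariant: beyond M the Schur factor vanishes, whatever the
   Kostka number is. *)
rewrite -(fsbig_widen (A `&` As)%classic).
- apply: eq_fsbigr => la; rewrite inE => -[Ala Asla]; rewrite termE // FE.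
  rewrite (kostka_shape R hr (proj1 Ala) (proj2 Ala)) //.
  by apply: leq_trans nM; rewrite leq_mul2l; apply/orP; right.
- by move=> la [].
move=> la [Ala hla] /=; rewrite termE //; apply/eqP; rewrite mulf_eq0; apply/orP; right.
apply: contraT => hs; case: hla; split=> //.
have [[las _ _] _] := Ala.
have := schur_support hr hp (dominant_mu_of hr las) hs.
by move=> h; rewrite /As /= ltnW // -(ltr_nat rat) (le_lt_trans h).
Qed.
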